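(* Let $(\Omega,\mathcal A,\mathrm P)$ be a probability space, $E$ and $F$ be separable Banach spaces, and $X:\Omega\to E$ and $Y:\Omega\to F$ be jointly Gaussian random variables. Moreover, let $\mu:F\to E$ be a measurable map such that $Z:=\mu\circ Y$ is a version of $\mathbb E(X|Y)$. Then $$\mathrm P_{X|Y}(\cdot|y):=\mathcal N\bigl(\mu(y),\operatorname{cov}(X)-\operatorname{cov}(\mu\circ Y)\bigr),\qquad y\in F,$$ defines a version of the regular conditional probability of $X$ given $Y$.
   Context: All Banach spaces are real; $E'$ is the dual of $E$ and $\langle x',x\rangle_{E',E}:=x'(x)$. $\mathfrak B(E)$ is the Borel $\sigma$-algebra of $E$; measurability of maps between separable Banach spaces is Borel measurability. Real Gaussian random variables may be degenerate (variance $0$ allowed). A random variable $X:\Omega\to E$ is Gaussian if $\langle x',X\rangle_{E',E}$ is a real Gaussian random variable for all $x'\in E'$; a probability measure on $\mathfrak B(E)$ is Gaussian if its image under every $x'\in E'$ is a real Gaussian measure. $X:\Omega\to E$ and $Y:\Omega\to F$ are jointly Gaussian if $(X,Y):\Omega\to E\times F$ is Gaussian. $\mathbb E X$ denotes the Bochner integral. For square Bochner integrable $X:\Omega\to E$, $\operatorname{cov}(X):E'\to E$ is the bounded linear operator $\operatorname{cov}(X)(x')=\int_\Omega\langle x',X-\mathbb E X\rangle_{E',E}\,(X-\mathbb E X)\,d\mathrm P$. A Gaussian measure $\mathrm Q$ on $\mathfrak B(E)$ has mean $m=\int_E x\,d\mathrm Q(x)$ and covariance $K:E'\to E$, $Kx'=\int_E\langle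 x',x-m\rangle_{E',E}(x-m)\,d\mathrm Q(x)$; it is uniquely determined by $(m,K)$ and is denoted $\mathcal N(m,K)$. A version of the regular conditional probability of $X:\Omega\to E$ given $Y:\Omega\to F$ is a map $\mathrm P_{X|Y}(\cdot|\cdot):\mathfrak B(E)\times F\to[0,1]$ such that $\mathrm P_{X|Y}(\cdot|y)$ is a probability measure for all $y\in F$, $\mathrm P_{X|Y}(B|\cdot)$ is measurable for all $B\in\mathfrak B(E)$, and $\mathrm P(X\in B,Y\in A)=\int_A\mathrm P_{X|Y}(B|y)\,d\mathrm P_Y(y)$ for all $B\in\mathfrak B(E)$, $A\in\mathfrak B(F)$, where $\mathrm P_Y$ is the distribution of $Y$. A version of $\mathbb E(X|Y)$ is a $\sigma(Y)$-measurable Bochner integrable $Z:\Omega\to E$ with $\int_C Z\,d\mathrm P=\int_C X\,d\mathrm P$ for all $C\in\sigma(Y)$. *)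

(* Defs.v *)
From HB Require Import structures.
From mathcomp Require Import all_boot all_order all_algebra.
From mathcomp Require Import all_classical all_reals all_analysis.
From mathcomp Require Import measurable_realfun.

Set Implicit Arguments.
Unset Strict Implicit.
Unset Printing Implicit Defensive.

Import Order.TTheory GRing.Theory Num.Theory.
Import numFieldNormedType.Exports.

Local Open Scope classical_set_scope.
Local Open Scope ring_scope.

Definition separable (T : topologicalType) : Prop :=
  exists2 D : set T, countable D & dense D.

Definition borel (R : realType) (E : normedModType R) :=
  g_sigma_algebraType (@open E).

Record dual (R : realType) (E : normedModType R) := Dual {
  dual_val :> {linear E -> R^o} ;
  dual_continuous : continuous dual_val }.

Section bochner.
Context {d : measure_display} {T : measurableType d} {R : realType}.
Context {E : normedModType R}.
Implicit Types (P : probability T R) (D : set T) (f s : T -> E).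

Definition borel_fun D f : Prop := measurable_fun D (f : T -> borel E).

Definition simple s : Prop := borel_fun setT s /\ finite_set (range s).

Definition simple_integral P D s : E :=
  \sum_(v \in range s) fine (P (D `&` s @^-1` [set v])) *: v.

(* The almost everywhere approximability by simple functions, part of the
   usual definition, is automatic for Borel functions into separable spaces. *)
Definition bochner_approx P D f (s : nat -> T -> E) : Prop :=
  (forall n, simple (s n)) /\
  (\int[P]_(x in D) (`|f x - s n x|)%:E)%E @[n --> \oo] --> 0%E.

Definition bochner_integrable P D f : Prop :=
  borel_fun D f /\ exists s : nat -> T -> E, bochner_approx P D f s.

(* Meaningful when [f] is Bochner integrable on [D] and [E] is complete: the
   limit then exists and does not depend on the approximating sequence. *)
Definition bochner P D f : E :=
  get [set v | exists s : nat -> T -> E, bochner_approx P D f s /\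
                         simple_integral P D (s n) @[n --> \oo] --> v].

Definition mean P f : E := bochner P setT f.

Definition cov P f (x' : dual E) : E :=
  bochner P setT (fun w => x' (f w - mean P f) *: (f w - mean P f)).

End bochner.

(* The Dirac case is separate because [normal_prob m 0] is, by convention, the
   uniform law on [0, 1].  Laws are compared on measurable sets only, since a
   measure takes arbitrary values on the other sets. *)
Definition real_gaussian (R : realType) (Q : set (measurableTypeR R) -> \bar R)
    : Prop :=
  exists m sigma : R, forall B : set (measurableTypeR R), measurable B ->
    Q B = if sigma == 0 then dirac m B else normal_prob m sigma B.

Section gaussian.
Context {d : measure_display} {T : measurableType d} {R : realType}.

Definition gaussian_rv (E : normedModType R) (P : probability T R)
    (X : T -> E) : Prop :=
  forall x' : dual E,
    real_gaussian (pushforward P (fun w => x' (X w) : measurableTypeR R)).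

Definition jointly_gaussian (E F : normedModType R) (P : probability T R)
    (X : T -> E) (Y : T -> F) : Prop :=
  @gaussian_rv (E * F)%type P (fun w => (X w, Y w)).

End gaussian.

Section normal_law.
Context {R : realType} {E : completeNormedModType R}.
Implicit Types (Q : probability (borel E) R) (m : E) (K : dual E -> E).

Definition gaussian_measure Q : Prop :=
  forall x' : dual E,
    real_gaussian (pushforward Q (fun x : borel E => x' x : measurableTypeR R)).

Definition is_normal m K Q : Prop :=
  [/\ gaussian_measure Q,
      bochner_integrable Q setT (fun x : borel E => x : E),
      mean Q (fun x => x) = m &
      forall x' : dual E,
        bochner_integrable Q setT (fun x : borel E => x' (x - m) *: (x - m)) /\
        bochner Q setT (fun x : borel E => x' (x - m) *: (x - m)) = K x'].

(* A Dirac measure, by default, when there is no Gaussian measure with mean [m]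
   and covariance [K]. *)
Definition normal m K : probability (borel E) R := get (is_normal m K).

End normal_law.

Section conditioning.
Context {d : measure_display} {T : measurableType d} {R : realType}.
Context {E F : completeNormedModType R}.
Variable P : probability T R.

Definition is_cond_expectation (X : T -> E) (Y : T -> borel F) (Z : T -> E)
    : Prop :=
  [/\ borel_fun (T := g_sigma_algebra_preimageType Y) setT Z,
      bochner_integrable P setT Z &
      forall C : set T, g_sigma_algebra_preimage Y C ->
        bochner P C Z = bochner P C X].

Definition is_regular_cond_prob (X : {RV P >-> borel E})
    (Y : {RV P >-> borel F}) (kappa : F -> probability (borel E) R) : Prop :=
  (forall B : set (borel E), measurable B ->
     measurable_fun setT (fun y : borel F => kappa y B)) /\
  (forall (B : set (borel E)) (A : set (borel F)),
     measurable B -> measurable A ->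
     P (X @^-1` B `&` Y @^-1` A) =
     (\int[distribution P Y]_(y in A) kappa y B)%E).

End conditioning.

(* Main.v *)
Require Import Defs.
From HB Require Import structures.
From mathcomp Require Import all_boot all_order all_algebra.
From mathcomp Require Import all_classical all_reals all_analysis.
From mathcomp Require Import measurable_realfun ring lra.

(* U = X - Z turns out to be Gaussian, centered and independent of Y, so that
   X = mu(Y) + U has conditional law "U shifted by mu(y)" given Y = y, with
   covariance cov(U) = cov(X) - cov(Z) by orthogonality.
   For x' in E', let q be the squared L2-distance of x'X to the affine
   functionals of Y.  Along a minimising sequence l_n these functionals converge
   in L1 to some g(Y), and joint Gaussianity gives
     E cos(a (x'X - g(Y)) + l(Y)) = exp(-a^2 q / 2) E cos(l(Y)).
   The right-hand side is even in a, so (x'X - g(Y), Y) and (g(Y) - x'X, Y) have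
   the same law; hence x'X - g(Y) integrates to 0 over the events of Y, that is,
   g(Y) = E(x'X | Y) = x'Z.  Laws on separable Banach spaces are determined by the
   integrals of the cosines of their affine functionals, so that this identity
   yields the independence of U and Y.
   Square integrability of Gaussian vectors is a weak form of Fernique's theorem,
   and Bochner integrals are computed by testing against the dual. *)

Set Implicit Arguments.
Unset Strict Implicit.
Unset Printing Implicit Defensive.

Import Order.TTheory GRing.Theory Num.Theory.
Import numFieldNormedType.Exports.

Local Open Scope classical_set_scope.
Local Open Scope ring_scope.

(** * Hahn-Banach theorem *)

(** F may be infinite-dimensional, so the infimum q need not be attained and g need not be an affine
    functional. Hence (x'X, g(Y)) is not known to be Gaussian: joint Gaussianity is available only
    along l_n and has to be used in a form that survives L1 limits. Cosine integrals do, the cosine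
    being 1-Lipschitz. The convergence takes place in L1 of the law of Y, which makes g a measurable
    function on F. Constants among the affine functionals act as phases, so that cosines alone carry
    what the complex characteristic function does. Both [bochner] and [normal] are choices,
    meaningful only where a limit, respectively a Gaussian measure, exists. Values of the former
    therefore rest on integrability, which for cov(X) and cov(Z) means second moments of the norm. X
    and U have them because they are Gaussian, and Z = X - U inherits them. The latter calls for an
    explicit witness at every y, which is the law of mu(y) + U. *)

Section dual_construction.
Context {R : realType} {E : normedModType R}.
Implicit Types (f : E -> R) (x y : E).

Lemma dual_of f : linear (f : E -> R^o) ->
  (exists C, forall x, `|f x| <= C * `|x|) -> exists x' : dual E, x' =1 f.
Proof.
move=> lf [C fC].
pose fL := GRing.isLinear.Build R E R^o *:%R (f : E -> R^o) lf.
pose F : {linear E -> R^o} := HB.pack (f : E -> R^o) fL.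
have cF : continuous F.
  apply: bounded_linear_continuous; apply/linear_boundedP.
  exists C; split=> [|r Cr x]; first exact: num_real.
  by rewrite (le_trans (fC x))// ler_wpM2r// ltW.
by exists (Dual cF).
Qed.

Lemma dual_bound (x' : dual E) : exists2 C, 0 < C & forall x, `|x' x| <= C * `|x|.
Proof.
by have [C C0 x'C] := linear_lipschitz (@dual_continuous _ _ x'); exists C.
Qed.

Lemma dualD (x' : dual E) x y : x' (x + y) = x' x + x' y.
Proof. by rewrite linearD. Qed.
Lemma dualB (x' : dual E) x y : x' (x - y) = x' x - x' y.
Proof. by rewrite linearB. Qed.
Lemma dualZ (x' : dual E) a x : x' (a *: x) = a * x' x.
Proof. by rewrite linearZ. Qed.

Lemma dual_lin (x' y' : dual E) (a b : R) :
  exists z' : dual E, z' =1 (fun x => a * x' x + b * y' x).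
Proof.
have [C C0 x'C] := dual_bound x'; have [D D0 y'D] := dual_bound y'.
apply: dual_of.
  by move=> c x y /=; rewrite !dualD !dualZ /GRing.scale/=; ring.
exists (`|a| * C + `|b| * D) => x.
rewrite (le_trans (ler_normD _ _))// !normrM mulrDl -!mulrA lerD//.
  by rewrite ler_wpM2l.
by rewrite ler_wpM2l.
Qed.

End dual_construction.

Section hahn_banach.
Context {R : realType} {E : normedModType R}.
Implicit Types (p q : E -> R) (x y z : E).

Definition sublinear q :=
  (forall x y, q (x + y) <= q x + q y) /\
  (forall t x, 0 <= t -> q (t *: x) <= t * q x).

Lemma sublinear0 q : sublinear q -> q 0 = 0.
Proof.
move=> [qD qZ]; apply/eqP; rewrite eq_le; apply/andP; split.
  by have := qZ 0 0 (lexx _); rewrite scale0r mul0r.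
by have := qD 0 0; rewrite addr0; lra.
Qed.

Lemma sublinearZ q t x : sublinear q -> 0 <= t -> q (t *: x) = t * q x.
Proof.
move=> sq; rewrite le_eqVlt => /predU1P[<-|t0].
  by rewrite scale0r mul0r sublinear0.
have [qD qZ] := sq.
apply/eqP; rewrite eq_le (qZ _ _ (ltW t0))/=.
have tV0 : 0 <= t^-1 by rewrite invr_ge0 ltW.
have := qZ t^-1 (t *: x) tV0.
by rewrite scalerA mulVf ?gt_eqF// scale1r ler_pdivlMl.
Qed.

Lemma sublinear_opp q x : sublinear q -> - q (- x) <= q x.
Proof.
by move=> sq; have := sq.1 x (- x); rewrite subrr sublinear0//; lra.
Qed.

Lemma sublinear_norm : sublinear (fun x => `|x|).
Proof.
split=> [x y|t x t0]; first exact: ler_normD.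
by rewrite normrZ ger0_norm.
Qed.

Lemma has_lbound_family (F : set (E -> R)) p x :
  (forall q, F q -> sublinear q /\ forall z, q z <= p z) ->
  has_lbound [set q x | q in F].
Proof.
move=> Fp; exists (- p (- x)) => _ [q /Fp[sq qp] <-].
by rewrite (le_trans _ (sublinear_opp _ sq))// lerN2.
Qed.

(** A linear l <= q with l y = q y satisfies l x = l (x + t y) - t (l y) <= q (x + t y) - t (q y)
    for t >= 0. The infimum is the bound that such an l has to obey at x. *)
Definition contract q y x :=
  inf [set q (x + t *: y) - t * q y | t in [set t | 0 <= t]].

Lemma contract_le q y x t : sublinear q -> 0 <= t ->
  contract q y x <= q (x + t *: y) - t * q y.
Proof.
move=> sq t0; apply: ge_inf; last by exists t.
(* Lower bound of the family: s q(y) = q(s y) <= q(x + s y) + q(-x). *)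
exists (- q (- x)) => _ [s /= s0 <-].
by have := sq.1 (x + s *: y) (- x); rewrite addrAC subrr add0r sublinearZ//; lra.
Qed.

Lemma le_contract q y x a :
  (forall t, 0 <= t -> a <= q (x + t *: y) - t * q y) -> a <= contract q y x.
Proof.
move=> h; apply: lb_le_inf; first by exists (q (x + 0 *: y) - 0 * q y); exists 0 => /=.
by move=> _ [t t0 <-]; exact: h.
Qed.

Lemma contract_sublinear q y : sublinear q -> sublinear (contract q y).
Proof.
move=> sq; split=> [x x'|l x l0].
  (* Parameters t at x and s at x' are matched by the parameter t + s at x + x'. *)
  rewrite -lerBlDr; apply: le_contract => t t0.
  rewrite lerBlDr -lerBlDl; apply: le_contract => s s0.
  rewrite lerBlDl; apply: (le_trans (contract_le _ _ _ (addr_ge0 t0 s0))) => //.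
  have := sq.1 (x + t *: y) (x' + s *: y).
  by rewrite addrACA -scalerDl; lra.
move: l0; rewrite le_eqVlt => /predU1P[<-|l0].
  rewrite scale0r mul0r; apply: le_trans (contract_le _ _ sq (lexx 0)) _.
  by rewrite scale0r addr0 mul0r subr0 sublinear0.
rewrite -ler_pdivrMl//; apply: le_contract => t t0.
rewrite ler_pdivrMl//.
have := contract_le y (l *: x) sq (mulr_ge0 (ltW l0) t0).
by rewrite -scalerA -scalerDr (sublinearZ _ sq (ltW l0)) => /le_trans; apply; lra.
Qed.

Lemma contract_self q y x : sublinear q -> contract q y x <= q x.
Proof.
move=> sq; have := contract_le y x sq (lexx 0).
by rewrite scale0r addr0 mul0r subr0.
Qed.

(* A minimal sublinear functional [q] is linear: minimality gives
   [contract q y = q], whence [q x <= q (x + y) - q y]. *)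
Lemma minimal_sublinear p : sublinear p ->
  exists q, [/\ sublinear q, forall x, q x <= p x & linear (q : E -> R^o)].
Proof.
move=> sp.
pose T := {q | sublinear q /\ forall x, q x <= p x}.
(* The order is reversed, so that a maximal element in the sense of Zorn is a minimal sublinear
   functional. *)
pose r (q1 q2 : T) := `[< forall x, sval q2 x <= sval q1 x >].
have [||||[q [sq qp]] qmin] := @Zorn T r.
- by move=> t; apply/asboolP.
- move=> q1 q2 q3 /asboolP h1 /asboolP h2; apply/asboolP => x.
  exact: le_trans (h2 x) (h1 x).
- move=> [q1 p1] [q2 p2] /asboolP/= h1 /asboolP/= h2; apply: eq_exist.
  by apply/funext => x; apply/eqP; rewrite eq_le h1 h2.
- move=> A totA; have [/set0P[q0 Aq0]|] := boolP (A != set0); last first.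
    move/negPn/eqP => ->.
    by exists (exist _ p (conj sp (fun x => lexx (p x)))).
  pose F : set (E -> R) := [set sval q | q in A].
  have FP q : F q -> sublinear q /\ forall x, q x <= p x.
    by move=> [[q' ?] _ <-].
  pose m x := inf [set q x | q in F].
  have lem q x : F q -> m x <= q x.
    by move=> Fq; apply: ge_inf; [exact: has_lbound_family FP|exists q].
  have gem x a : (forall q, F q -> a <= q x) -> a <= m x.
    move=> h; apply: lb_le_inf; last by move=> _ [q Fq <-]; exact: h.
    by exists (sval q0 x); exists (sval q0) => //; exists q0.
  have Fq0 : F (sval q0) by exists q0.
  have sm : sublinear m.
    split=> [x y|t x t0].
      rewrite -lerBlDr; apply: (gem) => q1 Fq1; rewrite lerBlDr -lerBlDl.
      apply: (gem) => q2 Fq2; rewrite lerBlDl.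
      (* In a chain the smaller of q1 and q2 lies below both; this is what makes the pointwise
         infimum subadditive. *)
      have [q3 [Fq3 [h1 h2]]] : exists q3, F q3 /\
          (forall z, q3 z <= q1 z) /\ forall z, q3 z <= q2 z.
        case: Fq1 Fq2 => q1' Aq1 <- [q2' Aq2 <-].
        have [/asboolP h|/asboolP h] := totA _ _ Aq1 Aq2.
          by exists (sval q2'); split; [exists q2'|split].
        by exists (sval q1'); split; [exists q1'|split].
      rewrite (le_trans (lem q3 _ Fq3))//.
      by rewrite (le_trans ((FP _ Fq3).1.1 _ _))// lerD.
    move: t0; rewrite le_eqVlt => /predU1P[<-|t0].
      rewrite scale0r mul0r (le_trans (lem _ _ Fq0))//.
      by rewrite sublinear0//; exact: (FP _ Fq0).1.
    rewrite -ler_pdivrMl//; apply: (gem) => q' Fq'.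
    by rewrite ler_pdivrMl// -(sublinearZ _ (FP _ Fq').1 (ltW t0)) lem.
  have mp x : m x <= p x.
    by rewrite (le_trans (lem _ x Fq0))//; exact: (FP _ Fq0).2.
  exists (exist _ m (conj sm mp)) => s As; apply/asboolP => x /=.
  by apply: (lem); exists s.
have key x y : q x <= q (x + y) - q y.
  have cq : sublinear (contract q y) /\ forall x, contract q y x <= p x.
    split; first exact: contract_sublinear.
    by move=> z; rewrite (le_trans _ (qp z))// contract_self.
  have := qmin (exist _ _ cq) _.
  have -> : r (exist _ q (conj sq qp)) (exist _ (contract q y) cq).
    by apply/asboolP => z /=; exact: contract_self.
  move=> /(_ isT)/(congr1 (fun f => sval f x))/= <-.
  by have := contract_le y x sq ler01; rewrite scale1r mul1r.
have qD x y : q (x + y) = q x + q y.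
  by apply/eqP; rewrite eq_le sq.1/=; have := key x y; lra.
have qN x : q (- x) = - q x.
  by have := qD x (- x); rewrite subrr sublinear0//; lra.
exists q; split=> // a x y; rewrite qD; congr (_ + _).
have [a0|a0] := leP 0 a; first by rewrite sublinearZ.
rewrite -[a]opprK scaleNr qN sublinearZ//; last by rewrite oppr_ge0 ltW.
by rewrite /GRing.scale/= !mulNr.
Qed.

(** The minimal functional is taken below [contract] of the norm at x0 instead of the norm itself:
    the parameter t = 1 at - x0 yields q(- x0) <= - |x0|, which forces equality at x0. *)
Lemma norming_functional (x0 : E) :
  exists x' : dual E, x' x0 = `|x0| /\ forall x, `|x' x| <= `|x|.
Proof.
have sn := sublinear_norm.
have [q [sq qp ql]] := minimal_sublinear (contract_sublinear x0 sn).
have qn x : q x <= `|x| by rewrite (le_trans (qp x))//; exact: contract_self.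
have qN x : q (- x) = - q x.
  have := ql (-1) x 0.
  by rewrite scaleN1r !addr0 sublinear0// addr0 scaleN1r.
have qa x : `|q x| <= `|x|.
  by rewrite ler_norml qn andbT lerNl -qN (le_trans (qn _))// normrN.
have [||x' x'E] := @dual_of _ _ q; first exact: ql.
  by exists 1 => x; rewrite mul1r.
exists x'; split; last by move=> x; rewrite x'E.
rewrite x'E; apply/eqP; rewrite eq_le qn/=.
have := contract_le x0 (- x0) sn ler01; rewrite scale1r addNr normr0 mul1r sub0r.
by move/(le_trans (qp _)); rewrite qN lerN2.
Qed.

Lemma dual_separates x y : (forall x' : dual E, x' x = x' y) -> x = y.
Proof.
move=> h; apply/eqP; rewrite -subr_eq0 -normr_eq0.
by have [x' [<- _]] := norming_functional (x - y); rewrite dualB h subrr.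
Qed.

End hahn_banach.

(** * Measures determined by the cosines of a vector space of functions *)

Section real_integrals.
Context {d : measure_display} {T : measurableType d} {R : realType}.
Implicit Types (f g : T -> R) (C : R).

Lemma integrable_of_bounded (P : probability T R) f C :
  measurable_fun setT f -> (forall x, `|f x| <= C) ->
  P.-integrable setT (EFin \o f).
Proof.
move=> mf fC; apply: measurable_bounded_integrable => //.
  by rewrite (le_lt_trans (probability_le1 P measurableT))// ltry.
exists C; split; first exact: num_real.
by move=> M CM x _ /=; rewrite (le_trans (fC x))// ltW.
Qed.

Lemma Rintegral_dominated (mu : {measure set T -> \bar R}) (fn : nat -> T -> R) f g :
  (forall n, measurable_fun setT (fn n)) ->
  (forall x, fn n x @[n --> \oo] --> f x) ->
  mu.-integrable setT (EFin \o g) ->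
  (forall n x, `|fn n x| <= g x) ->
  \int[mu]_x fn n x @[n --> \oo] --> \int[mu]_x f x.
Proof.
move=> mfn fnf ig fng.
have mf : measurable_fun setT f by apply: measurable_fun_cvg => // x _; exact: fnf.
have fg x : `|f x| <= g x.
  have h : `|fn n x| @[n --> \oo] --> `|f x| by apply: cvg_norm; exact: fnf.
  rewrite -(cvg_lim _ h)//; apply: limr_le; first exact: cvgP h.
  exact: nearW.
have intf : mu.-integrable setT (EFin \o f).
  apply: le_integrable ig => //; first exact/measurable_EFinP.
  by move=> x _ /=; rewrite lee_fin (le_trans (fg x))// ler_norm.
rewrite /Rintegral; apply: fine_cvg; rewrite fineK; last exact: integrable_fin_num.
apply: (@dominated_cvg _ _ _ mu _ _ _ _ (EFin \o g)) => //.
- by move=> n; exact/measurable_EFinP.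
- by move=> x _; apply: cvg_EFin; [exact: nearW|exact: fnf].
- by move=> n x _ /=; rewrite lee_fin.
Qed.

Lemma Rintegral_bounded_cvg (P : probability T R) (fn : nat -> T -> R) f C :
  (forall n, measurable_fun setT (fn n)) ->
  (forall x, fn n x @[n --> \oo] --> f x) ->
  (forall n x, `|fn n x| <= C) ->
  \int[P]_x fn n x @[n --> \oo] --> \int[P]_x f x.
Proof.
move=> mfn fnf fnC; apply: (@Rintegral_dominated P _ _ (cst C)) => //.
apply: (@integrable_of_bounded P _ `|C|) => //.
Qed.

End real_integrals.

(** * The sign function as a limit of polynomials *)

Section sign_iteration.
Context {R : realType}.
Implicit Types x : R.

(* Iterating this odd cubic pushes [-1, 1] to the sign function. *)
Definition smoothstep x := (3 * x - x ^+ 3) / 2.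

Lemma smoothstepN x : smoothstep (- x) = - smoothstep x.
Proof. by rewrite /smoothstep; field. Qed.

Lemma smoothstep_gt0 x : 0 < x <= 1 -> x <= smoothstep x <= 1.
Proof.
move=> /andP[x0 x1]; rewrite /smoothstep.
(* The two nonnegative products are twice [smoothstep x - x] and twice [1 - smoothstep x]. *)
have h : 0 <= x * (1 - x ^+ 2).
  by rewrite mulr_ge0 ?(ltW x0)// subr_ge0 expr_le1// ltW.
have h' : 0 <= (1 - x) ^+ 2 * (2 + x) by rewrite mulr_ge0 ?sqr_ge0//; lra.
have e : x * (1 - x ^+ 2) = x - x ^+ 3 by ring.
have e' : (1 - x) ^+ 2 * (2 + x) = 2 - 3 * x + x ^+ 3 by ring.
rewrite ler_pdivlMr// ler_pdivrMr//; move: h h'; rewrite e e' => h h'.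
by apply/andP; split; lra.
Qed.

Lemma iter_smoothstep_gt0 n x : 0 < x <= 1 -> x <= iter n smoothstep x <= 1.
Proof.
move=> x01; elim: n => [|n /andP[IH1 IH2]] /=; first by case/andP: x01 => _ ->; rewrite lexx.
have /andP[h1 ->] : iter n smoothstep x <= smoothstep (iter n smoothstep x) <= 1.
  by apply: smoothstep_gt0; rewrite IH2 andbT (lt_le_trans _ IH1)//; case/andP: x01.
by rewrite andbT (le_trans IH1).
Qed.

Lemma iter_smoothstepN n x : iter n smoothstep (- x) = - iter n smoothstep x.
Proof. by elim: n => //= n ->; rewrite smoothstepN. Qed.

Lemma iter_smoothstep0 n : iter n smoothstep 0 = 0.
Proof. by elim: n => //= n ->; rewrite /smoothstep; field. Qed.

Lemma iter_smoothstep_le1 n x : `|x| <= 1 -> `|iter n smoothstep x| <= 1.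
Proof.
wlog x0 : x / 0 <= x => [wl|].
  have [|x0 x1] := leP 0 x; first exact: wl.
  by rewrite -[x]opprK iter_smoothstepN normrN wl ?normrN// oppr_ge0 ltW.
move: x0; rewrite le_eqVlt => /predU1P[<- _|x0]; first by rewrite iter_smoothstep0 normr0.
rewrite gtr0_norm// => x1.
have /andP[h1 h2] : x <= iter n smoothstep x <= 1.
  by apply: iter_smoothstep_gt0; rewrite x0.
by rewrite ger0_norm// (le_trans _ h1)// ltW.
Qed.

(** On (0, 1] the iterates increase and stay below 1, so they converge to a positive fixed point;
    the fixed points are -1, 0 and 1. Oddness settles the negative side. *)
Lemma cvg_iter_smoothstep x : `|x| <= 1 ->
  iter n smoothstep x @[n --> \oo] --> Num.sg x.
Proof.
wlog x0 : x / 0 <= x => [wl|].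
  have [|x0 x1] := leP 0 x; first exact: wl.
  rewrite -[x]opprK sgrN; under eq_fun do rewrite iter_smoothstepN.
  by apply: cvgN; apply: wl; rewrite ?normrN// oppr_ge0 ltW.
move: x0; rewrite le_eqVlt => /predU1P[<- _|x0].
  by rewrite sgr0; under eq_fun do rewrite iter_smoothstep0; exact: cvg_cst.
rewrite gtr0_norm// gtr0_sg// => x1.
have x01 : 0 < x <= 1 by rewrite x0.
set u := fun n => iter n smoothstep x.
have u1 n : x <= u n <= 1 by exact: iter_smoothstep_gt0.
have ndu : {homo u : n m / (n <= m)%N >-> n <= m}.
  apply/nondecreasing_seqP => n.
  have /andP[h1 h2] := u1 n.
  suff /andP[] : u n <= smoothstep (u n) <= 1 by [].
  by apply: smoothstep_gt0; rewrite h2 andbT (lt_le_trans x0).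
have cu : cvgn u.
  by apply: nondecreasing_is_cvgn => //; exists 1 => _ [n _ <-]; case/andP: (u1 n).
have lx : x <= limn u by apply: limr_ge => //; apply: nearW => n; case/andP: (u1 n).
have cs : (fun n => smoothstep (u n)) @ \oo --> smoothstep (limn u).
  apply: cvgM; last exact: cvg_cst.
  apply: cvgB; first by apply: cvgM => //; exact: cvg_cst.
  by rewrite !exprS expr0 mulr1; under eq_fun do rewrite !exprS expr0 mulr1;
    apply: cvgM => //; exact: cvgM.
have : smoothstep (limn u) = limn u.
  rewrite -(cvg_lim _ cs)//; apply: cvg_lim => //.
  have : [sequence u n.+1]_n @ \oo --> limn u by rewrite cvg_shiftS.
  exact.
move=> eql; suff l1 : limn u = 1 by rewrite -l1.
have l0 : 0 < limn u by exact: lt_le_trans lx.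
have : limn u * (1 - limn u) * (1 + limn u) = 0.
  have -> : limn u * (1 - limn u) * (1 + limn u) =
            2 * (smoothstep (limn u) - limn u) by rewrite /smoothstep; field.
  by rewrite eql subrr mulr0.
move/eqP; rewrite !mulf_eq0 gt_eqF//= => /orP[|/eqP]; last by lra.
by rewrite subr_eq0 => /eqP.
Qed.

End sign_iteration.

(** * Indicators in algebras closed under bounded pointwise limits *)

Section bounded_limit_algebra.
Context {T : Type} {R : realType} (M : set (T -> R)).
Hypothesis M1 : M (cst 1).
Hypothesis MZ : forall a f, M f -> M (a \*o f).
Hypothesis MD : forall f g, M f -> M g -> M (f \+ g).
Hypothesis MM : forall f g, M f -> M g -> M (f \* g).
Hypothesis Mlim : forall (fn : nat -> T -> R) f C, (forall n, M (fn n)) ->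
  (forall n x, `|fn n x| <= C) -> (forall x, fn n x @[n --> \oo] --> f x) -> M f.

(** [smoothstep] is a polynomial, hence built from the algebra operations. *)
Lemma algebra_smoothstep n f : M f -> M (fun x => iter n smoothstep (f x)).
Proof.
move=> Mf; elim: n => // n IH.
have -> : (fun x => iter n.+1 smoothstep (f x)) =
  (3 / 2 \*o (fun x => iter n smoothstep (f x))) \+
  (- (1 / 2) \*o ((fun x => iter n smoothstep (f x)) \*
     ((fun x => iter n smoothstep (f x)) \* (fun x => iter n smoothstep (f x))))).
  apply/funext => x /=; move: (iter n smoothstep (f x)) => y.
  by rewrite /smoothstep; field.
by apply: MD; apply: MZ => //; apply: MM => //; exact: MM.
Qed.

Lemma algebra_sg f : M f -> (forall x, `|f x| <= 1) -> M (fun x => Num.sg (f x)).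
Proof.
move=> Mf f1; apply: (@Mlim (fun n x => iter n smoothstep (f x)) _ 1).
- by move=> n; exact: algebra_smoothstep.
- by move=> n x; exact: iter_smoothstep_le1.
- by move=> x; exact: cvg_iter_smoothstep.
Qed.

(* The sign of [f] is the limit of the signs of [sin (f / n)]. *)
Lemma algebra_ray f : (forall a, M (fun x => sin (a * f x))) ->
  M \1_[set x | f x < 0].
Proof.
move=> Msin.
have Msg : M (fun x => Num.sg (f x)).
  apply: (@Mlim (fun n x => Num.sg (sin (n.+1%:R^-1 * f x))) _ 1).
  - by move=> n; apply: algebra_sg => // x; exact: sin_max.
  - by move=> n x; rewrite normr_sg; case: eqP.
  - move=> x; apply: cvg_near_cst.
    (* From this rank on the argument of [sin] lies in (-1, 1), inside (-pi, pi), where [sin] has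
       the sign of its argument. The sequence is constant from there. *)
    have [N hN] : exists N : nat, `|f x| < N.+1%:R.
      exists (Num.truncn `|f x|); exact: truncnS_gt.
    exists N => // n /= Nn.
    have n1 : `|n.+1%:R^-1 * f x| < 1.
      rewrite normrM ger0_norm ?invr_ge0// ltr_pdivrMl// mulr1.
      by rewrite (lt_le_trans hN)// ler_nat.
    have n0 : 0 < (n.+1%:R : R)^-1 by rewrite invr_gt0.
    have pi1 : (1 : R) < pi by rewrite (lt_le_trans _ (pi_ge2 R))// ltr1n.
    have [f0|f0|f0] := ltrgtP (f x) 0.
    + rewrite (ltr0_sg f0) ltr0_sg// -[_ * _]opprK sinN oppr_lt0 sin_gt0_pi//.
      rewrite oppr_gt0 pmulr_rlt0// f0/= (le_lt_trans _ pi1)//.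
      by rewrite (le_trans (ler_norm _))// normrN ltW.
    + rewrite (gtr0_sg f0) gtr0_sg// sin_gt0_pi// mulr_gt0//=.
      by rewrite (le_lt_trans _ pi1)// (le_trans (ler_norm _))// ltW.
    + by rewrite f0 mulr0 sin0.
(* Among the values -1, 0, 1 of a sign s, the polynomial (s^2 - s) / 2 singles out -1. *)
have -> : \1_[set x | f x < 0] = (1 / 2 \*o ((fun x => Num.sg (f x)) \*
    (fun x => Num.sg (f x)))) \+ (- (1 / 2) \*o (fun x => Num.sg (f x))) :> (T -> R).
  apply/funext => x /=; rewrite indicE; case: (ltrgtP (f x) 0) => fx.
  - by rewrite mem_set//= (ltr0_sg fx); field.
  - rewrite memNset; last by move=> /= /(lt_trans fx); rewrite ltxx.
    by rewrite (gtr0_sg fx)/=; field.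
  - by rewrite memNset/= fx ?ltxx// sgr0/=; field.
by apply: MD; apply: MZ => //; exact: MM.
Qed.

End bounded_limit_algebra.

(** * Two probabilities with equal cosine integrals *)

Section cosine_uniqueness.
Context {d : measure_display} {T : measurableType d} {R : realType}.
Variables (mu nu : probability T R) (V : set (T -> R)).
Hypothesis mV : forall f, V f -> measurable_fun setT f.
Hypothesis Vcst : forall c, V (cst c).
Hypothesis VD : forall f g, V f -> V g -> V (f \+ g).
Hypothesis VZ : forall a f, V f -> V (a \*o f).
Hypothesis Vcos : forall f, V f -> \int[mu]_x cos (f x) = \int[nu]_x cos (f x).

Let bmeas (f : T -> R) := measurable_fun setT f /\ exists C, forall x, `|f x| <= C.

Let H (h : T -> R) := bmeas h /\
  forall f, V f -> \int[mu]_x (h x * cos (f x)) = \int[nu]_x (h x * cos (f x)).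

(** Products of elements of [H] are not visibly in [H], whereas multipliers of [H] compose, so that
    [M] is an algebra at once. Since the constant 1 belongs to [H], so does every multiplier. *)
Let M (p : T -> R) := bmeas p /\ forall h, H h -> H (h \* p).

Let bmeasM f g : bmeas f -> bmeas g -> bmeas (f \* g).
Proof.
move=> [mf [C fC]] [mg [D gD]]; split; first exact: measurable_funM.
by exists (C * D) => x; rewrite normrM ler_pM.
Qed.

Let bmeasD f g : bmeas f -> bmeas g -> bmeas (f \+ g).
Proof.
move=> [mf [C fC]] [mg [D gD]]; split; first exact: measurable_funD.
by exists (C + D) => x; rewrite (le_trans (ler_normD _ _))// lerD.
Qed.

Let bmeasZ a f : bmeas f -> bmeas (a \*o f).
Proof.
move=> [mf [C fC]]; split; first exact: measurable_funM.
by exists (`|a| * C) => x /=; rewrite normrM ler_wpM2l.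
Qed.

Let bmeas_cos f : V f -> bmeas (fun x => cos (f x)).
Proof.
move=> Vf; split; last by exists 1 => x; exact: cos_max.
apply: measurableT_comp; last exact: mV.
by apply: continuous_measurable_fun; exact: continuous_cos.
Qed.

Let bint (P : probability T R) f : bmeas f -> P.-integrable setT (EFin \o f).
Proof. by move=> [mf [C fC]]; exact: integrable_of_bounded fC. Qed.

Let HD h k : H h -> H k -> H (h \+ k).
Proof.
move=> [bh Hh] [bk Hk]; split=> [|f Vf]; first exact: bmeasD.
have bc := bmeas_cos Vf.
have e (P : probability T R) : \int[P]_x ((h \+ k) x * cos (f x)) =
    \int[P]_x (h x * cos (f x)) + \int[P]_x (k x * cos (f x)).
  rewrite -RintegralD//; [|exact: (bint _ (bmeasM bh bc))|exact: (bint _ (bmeasM bk bc))].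
  by apply: eq_Rintegral => x _; rewrite /= mulrDl.
by rewrite !e Hh// Hk.
Qed.

Let HZ a h : H h -> H (a \*o h).
Proof.
move=> [bh Hh]; split=> [|f Vf]; first exact: bmeasZ.
have bc := bmeas_cos Vf.
have e (P : probability T R) : \int[P]_x ((a \*o h) x * cos (f x)) =
    a * \int[P]_x (h x * cos (f x)).
  rewrite -RintegralZl//; last exact: (bint _ (bmeasM bh bc)).
  by apply: eq_Rintegral => x _; rewrite /= mulrA.
by rewrite !e Hh.
Qed.

Let Hlim (fn : nat -> T -> R) f C : (forall n, H (fn n)) ->
  (forall n x, `|fn n x| <= C) -> (forall x, fn n x @[n --> \oo] --> f x) -> H f.
Proof.
move=> Hfn fnC fnf.
have mfn n : measurable_fun setT (fn n) by case: (Hfn n) => -[].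
split.
  split; first by apply: measurable_fun_cvg => // x _; exact: fnf.
  exists C => x.
  have h : `|fn n x| @[n --> \oo] --> `|f x| by apply: cvg_norm; exact: fnf.
  rewrite -(cvg_lim _ h)//; apply: limr_le; first exact: cvgP h.
  exact: nearW.
move=> g Vg; have [mc [_ _]] := bmeas_cos Vg.
have e (P : probability T R) : \int[P]_x (fn n x * cos (g x)) @[n --> \oo] -->
    \int[P]_x (f x * cos (g x)).
  apply: (@Rintegral_bounded_cvg _ _ _ P _ _ C).
  - by move=> n; exact: measurable_funM.
  - by move=> x; apply: cvgM; [exact: fnf|exact: cvg_cst].
  - move=> n x; rewrite normrM (le_trans _ (fnC n x))// ler_piMr//.
    exact: cos_max.
have eqn : (fun n => \int[mu]_x (fn n x * cos (g x))) =
    (fun n => \int[nu]_x (fn n x * cos (g x))).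
  by apply/funext => n; exact: (Hfn n).2.
by rewrite -(cvg_lim _ (e mu))// -(cvg_lim _ (e nu))// eqn.
Qed.

Let Mlim (fn : nat -> T -> R) f C : (forall n, M (fn n)) ->
  (forall n x, `|fn n x| <= C) -> (forall x, fn n x @[n --> \oo] --> f x) -> M f.
Proof.
move=> Mfn fnC fnf.
have mfn n : measurable_fun setT (fn n) by case: (Mfn n) => -[].
split.
  split; first by apply: measurable_fun_cvg => // x _; exact: fnf.
  exists C => x.
  have h : `|fn n x| @[n --> \oo] --> `|f x| by apply: cvg_norm; exact: fnf.
  rewrite -(cvg_lim _ h)//; apply: limr_le; first exact: cvgP h.
  exact: nearW.
move=> h Hh; have [[_ [D hD]] _] := Hh.
apply: (@Hlim (fun n => h \* fn n) _ (D * C)).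
- by move=> n; exact: (Mfn n).2.
- by move=> n x /=; rewrite normrM ler_pM.
- by move=> x /=; apply: cvgM; [exact: cvg_cst|exact: fnf].
Qed.

Let M1 : M (cst 1).
Proof.
split; first by split=> //; exists 1 => x; rewrite normr1.
by move=> h Hh; congr H: Hh; apply/funext => x /=; rewrite mulr1.
Qed.

Let MD f g : M f -> M g -> M (f \+ g).
Proof.
move=> [bf Mf] [bg Mg]; split=> [|h Hh]; first exact: bmeasD.
have -> : h \* (f \+ g) = (h \* f) \+ (h \* g).
  by apply/funext => x /=; rewrite mulrDr.
by apply: HD; [exact: Mf|exact: Mg].
Qed.

Let MZ a f : M f -> M (a \*o f).
Proof.
move=> [bf Mf]; split=> [|h Hh]; first exact: bmeasZ.
have -> : h \* (a \*o f) = a \*o (h \* f).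
  by apply/funext => x /=; rewrite mulrCA.
by apply: HZ; exact: Mf.
Qed.

Let MM f g : M f -> M g -> M (f \* g).
Proof.
move=> [bf Mf] [bg Mg]; split=> [|h Hh]; first exact: bmeasM.
have -> : h \* (f \* g) = (h \* f) \* g by apply/funext => x /=; rewrite mulrA.
by apply: Mg; exact: Mf.
Qed.

(** Product formula: 2 cos g cos f = cos (g + f) + cos (g - f), and [V] is a vector space. *)
Let Mcos g : V g -> M (fun x => cos (g x)).
Proof.
move=> Vg; split=> [|h [bh Hh]]; first exact: bmeas_cos.
split=> [|f Vf]; first by apply: bmeasM => //; exact: bmeas_cos.
have Vp : V (g \+ f) by exact: VD.
have Vm : V (g \+ (-1 \*o f)) by apply: VD => //; exact: VZ.
have bp := bmeas_cos Vp; have bm := bmeas_cos Vm.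
have e (P : probability T R) : \int[P]_x ((h \* (fun x => cos (g x))) x * cos (f x)) =
    1 / 2 * (\int[P]_x (h x * cos ((g \+ f) x)) +
             \int[P]_x (h x * cos ((g \+ (-1 \*o f)) x))).
  rewrite -RintegralD//; [|exact: (bint _ (bmeasM bh bp))|exact: (bint _ (bmeasM bh bm))].
  rewrite -RintegralZl//; last first.
    exact: (bint _ (bmeasD (bmeasM bh bp) (bmeasM bh bm))).
  by apply: eq_Rintegral => x _ /=; rewrite mulN1r !cosD cosN sinN; field.
by rewrite !e !Hh.
Qed.

(** The sets whose indicator is a multiplier form a sigma-algebra, and it contains the sets where
    some f in [V] is negative. Multiplying the weight 1 by the indicator of A and testing with the
    cosine of 0 compares the two measures of A. *)
Lemma cos_unique A : measurable A ->
  <<s [set [set x | f x < 0] | f in V] >> A -> mu A = nu A.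
Proof.
move=> mA sA.
have Mray f : V f -> M \1_[set x | f x < 0].
  move=> Vf; apply: algebra_ray => // a.
  (* sin u = cos (u + pi / 2 + pi), and the phase is a constant belonging to [V]. *)
  have -> : (fun x => sin (a * f x)) = (fun x => cos (((a \*o f) \+ cst (pi / 2 + pi)) x)).
    by apply/funext => x /=; rewrite addrA cosDpi cosDpihalf opprK.
  by apply: Mcos; apply: VD => //; exact: VZ.
have Msalg : sigma_algebra setT [set A | M \1_A].
  split=> /=.
  - have -> : \1_set0 = 0 \*o cst 1 :> (T -> R).
      by apply/funext => x /=; rewrite indic0 mul0r.
    exact: MZ.
  - move=> B MB; have -> : \1_(setT `\` B) = cst 1 \+ (-1 \*o \1_B) :> (T -> R).
      apply/funext => x /=; rewrite setTD !indicE in_setC mulN1r.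
      by case: (x \in B) => /=; rewrite ?subrr ?subr0.
    by apply: MD => //; exact: MZ.
  - move=> F MF.
    (* One minus this product is the indicator of the union of the first n sets; at each point it is
       eventually constant in n. *)
    have Mfin n : M (fun x => \prod_(i < n) (1 - \1_(F i) x)).
      elim: n => [|n IH].
        by have -> : (fun x => \prod_(i < 0) (1 - \1_(F i) x)) = cst 1 :> (T -> R)
          by apply/funext => x; rewrite big_ord0.
      have -> : (fun x => \prod_(i < n.+1) (1 - \1_(F i) x)) =
          (fun x => \prod_(i < n) (1 - \1_(F i) x)) \* (cst 1 \+ (-1 \*o \1_(F n))) :> (T -> R).
        by apply/funext => x; rewrite big_ord_recr/= mulN1r.
      by apply: MM => //; apply: MD => //; exact: MZ.
    apply: (@Mlim (fun n x => 1 - \prod_(i < n) (1 - \1_(F i) x)) _ 1).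
    + move=> n; have -> : (fun x => 1 - \prod_(i < n) (1 - \1_(F i) x)) =
        cst 1 \+ (-1 \*o (fun x => \prod_(i < n) (1 - \1_(F i) x))) :> (T -> R).
        by apply/funext => x /=; rewrite mulN1r.
      by apply: MD => //; exact: MZ.
    + move=> n x.
      have : 0 <= (\prod_(i < n) (1 - \1_(F i) x) : R) <= 1.
        elim/big_ind: _ => [|y z /andP[y0 y1] /andP[z0 z1]|i _].
        - by rewrite ler01 lexx.
        - by rewrite mulr_ge0//= mulr_ile1.
        - by rewrite indicE; case: (x \in F i); rewrite ?subrr ?subr0 lexx ler01.
      by rewrite ler_norml; lra.
    + move=> x; apply: cvg_near_cst.
      have [[k _ Fk]|nF] := pselect ((\bigcup_n F n) x).
        exists k.+1 => // n /= kn.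
        rewrite [RHS]indicE mem_set//; last by exists k.
        rewrite (bigD1 (Ordinal kn))//= indicE mem_set// subrr mul0r subr0//.
      apply: nearW => n; rewrite [RHS]indicE memNset// big1 ?subrr// => i _.
      by rewrite indicE memNset ?subr0// => Fi; apply: nF; exists i.
have H1 : H (cst 1).
  split; first by split=> //; exists 1 => x; rewrite normr1.
  by move=> f Vf; under eq_Rintegral do rewrite mul1r; rewrite Vcos//;
    under [RHS]eq_Rintegral do rewrite mul1r.
have V0 : V (cst 0) by exact: Vcst.
have MA : M \1_A.
  by apply: (smallest_sub Msalg _ sA) => _ [f Vf <-]; exact: Mray.
have [_ HA] := MA.2 _ H1; have := HA _ V0.
have e (P : probability T R) : \int[P]_x ((cst 1 \* \1_A) x * cos (cst 0 x)) = fine (P A).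
  under eq_Rintegral do rewrite /= cos0 mulr1 mul1r.
  by rewrite /Rintegral integral_indic// setIT.
rewrite !e => h.
by rewrite -[LHS]fineK ?fin_num_measure// h fineK// fin_num_measure.
Qed.

End cosine_uniqueness.

(** * Gaussian laws on the line *)

Section lebesgue_invariance.
Context {R : realType}.
Local Notation mu := (@lebesgue_measure R).

Lemma lebesgue_measure_translation (c : R) (A : set (measurableTypeR R)) : measurable A ->
  mu ((fun x => x + c) @^-1` A) = mu A.
Proof.
have mc : measurable_fun setT (fun x : measurableTypeR R => x + c : measurableTypeR R).
  by apply: measurable_funD.
move=> mA; symmetry; move: A mA.
suff h : forall A, measurable A -> mu A = pushforward mu (fun x : measurableTypeR R => x + c : measurableTypeR R) A.
  by move=> A mA; rewrite h.
apply: lebesgue_measure_unique.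
move=> _ [[a b] _ <-] /=; transitivity (mu ((fun x : measurableTypeR R => x + c : measurableTypeR R) @^-1` `]a, b]%classic)); last by [].
rewrite (_ : _ @^-1` _ = `]a - c, b - c]%classic); last first.
  by apply/seteqP; split => x; rewrite /= !in_itv/= ltrBlDr lerBrDr.
rewrite !lebesgue_measure_itv/= !lte_fin ltrD2r; case: ifPn => // _.
by rewrite -!EFinB; congr EFin; ring.
Qed.

Lemma lebesgue_measure_reflection (A : set (measurableTypeR R)) : measurable A ->
  mu (-%R @^-1` A) = mu A.
Proof.
have mc : measurable_fun setT (fun x : measurableTypeR R => - x : measurableTypeR R).
  by apply: measurableT_comp.
move=> mA; symmetry; move: A mA.
suff h : forall A, measurable A -> mu A = pushforward mu (-%R : measurableTypeR R -> measurableTypeR R) A.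
  by move=> A mA; rewrite h.
apply: lebesgue_measure_unique.
move=> _ [[a b] _ <-] /=; transitivity (mu ((-%R : measurableTypeR R -> measurableTypeR R) @^-1` `]a, b]%classic)); last by [].
rewrite (_ : _ @^-1` _ = `[- b, - a[%classic); last first.
  by apply/seteqP; split => x; rewrite /= !in_itv/= ltrNr lerNl andbC.
rewrite !lebesgue_measure_itv/= !lte_fin ltrN2; case: ifPn => // _.
by rewrite -!EFinB; congr EFin; ring.
Qed.

End lebesgue_invariance.

(** * Integration along an image measure *)

Section image_measure.
Context {d d' : measure_display} {T : measurableType d} {T' : measurableType d'}.
Context {R : realType} (nu : {measure set T -> \bar R}) (mu : {measure set T' -> \bar R}).
Variable phi : T -> T'.
Hypothesis mphi : measurable_fun setT phi.
(** Agreement on measurable sets only, so that laws given by other formulas, such as [normal_prob],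
    also count as images. *)
Hypothesis image : forall A, measurable A -> mu A = nu (phi @^-1` A).

Lemma ge0_integral_image D (g : T' -> \bar R) : measurable D -> measurable_fun setT g ->
  (forall x, (0 <= g x)%E) ->
  (\int[mu]_(x in D) g x = \int[nu]_(x in phi @^-1` D) g (phi x))%E.
Proof.
move=> mD mg g0; rewrite -(ge0_integral_pushforward mphi nu mD (measurable_funTS mg))//.
by apply: eq_measure_integral => A mA _; exact: image.
Qed.

Lemma integrable_image (g : T' -> R) : measurable_fun setT g ->
  mu.-integrable setT (EFin \o g) <-> nu.-integrable setT (EFin \o (g \o phi)).
Proof.
move=> mg.
have eqi : (\int[mu]_x `|(EFin \o g) x| = \int[nu]_x `|(EFin \o (g \o phi)) x|)%E.
  rewrite (@ge0_integral_image setT (fun x => `|(EFin \o g) x|%E))//.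
  by apply: measurableT_comp => //; exact/measurable_EFinP.
split=> /integrableP[_ fin]; apply/integrableP; split.
- by apply/measurable_EFinP; exact: measurableT_comp.
- by rewrite -eqi.
- exact/measurable_EFinP.
- by rewrite eqi.
Qed.

Lemma Rintegral_image (g : T' -> R) : measurable_fun setT g ->
  mu.-integrable setT (EFin \o g) -> \int[mu]_x g x = \int[nu]_x g (phi x).
Proof.
move=> mg ig; rewrite /Rintegral; congr fine.
transitivity (\int[nu]_(x in phi @^-1` setT) (EFin \o g \o phi) x)%E; last by [].
rewrite -(integral_pushforward mphi)//.
- by apply: eq_measure_integral => A mA _; exact: image.
- exact/measurable_EFinP.
- exact: (integrable_image mg).1.
Qed.

End image_measure.

Section normal_prob_facts.
Context {R : realType} (s : R).
Hypothesis s0 : s != 0.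
Local Notation leb := (@lebesgue_measure R).
Local Notation rT := (measurableTypeR R).

(** The change of variables comes with the Radon-Nikodym derivative, which equals the density almost
    everywhere because both have the same integral over every measurable set. *)
Lemma integral_normal_prob m (g : rT -> \bar R) : measurable_fun setT g ->
  (forall x, (0 <= g x)%E) ->
  (\int[normal_prob m s]_x g x = \int[leb]_x (g x * (normal_pdf m s x)%:E))%E.
Proof.
move=> mg g0; have dom := @normal_prob_dominates R m s.
rewrite -(Radon_Nikodym_SigmaFinite.change_of_variables dom)//.
have intf := Radon_Nikodym_SigmaFinite.f_integrable dom.
have mp : measurable_fun setT (fun x : rT => (normal_pdf m s x)%:E).
  by apply/measurable_EFinP; exact: measurable_normal_pdf.
apply: ae_eq_integral => //.
- by apply: emeasurable_funM => //; exact: measurable_int intf.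
- exact: emeasurable_funM.
- apply: ae_eqe_mul2l; apply: integral_ae_eq => // A _ mA.
  by rewrite -Radon_Nikodym_SigmaFinite.f_integral.
Qed.

Lemma normal_prob_translation m c (A : set rT) : measurable A ->
  normal_prob (m + c) s A = normal_prob m s ((fun x => x + c) @^-1` A).
Proof.
move=> mA; rewrite /normal_prob.
have mc : measurable_fun setT (fun x : rT => x + c : rT) by exact: measurable_funD.
have mp : measurable_fun setT (fun x : rT => (normal_pdf (m + c) s x)%:E).
  by apply/measurable_EFinP; exact: measurable_normal_pdf.
have p0 (x : rT) : (0 <= (normal_pdf (m + c) s x)%:E)%E by rewrite lee_fin normal_pdf_ge0.
have inv (B : set rT) (mB : measurable B) := esym (lebesgue_measure_translation c mB).
rewrite (ge0_integral_image mc inv mA mp p0).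
apply: eq_integral => x _; rewrite !normal_pdfE// /normal_fun.
by have -> : x + c - (m + c) = x - m :> R by ring.
Qed.

Lemma normal_prob_reflection (A : set rT) : measurable A ->
  normal_prob 0 s A = normal_prob 0 s (-%R @^-1` A).
Proof.
move=> mA; rewrite /normal_prob.
have mc : measurable_fun setT (fun x : rT => - x : rT) by apply: measurableT_comp.
have mp : measurable_fun setT (fun x : rT => (normal_pdf 0 s x)%:E).
  by apply/measurable_EFinP; exact: measurable_normal_pdf.
have p0 (x : rT) : (0 <= (normal_pdf 0 s x)%:E)%E by rewrite lee_fin normal_pdf_ge0.
have inv (B : set rT) (mB : measurable B) := esym (lebesgue_measure_reflection mB).
rewrite (ge0_integral_image mc inv mA mp p0).
apply: eq_integral => x _; rewrite !normal_pdfE// /normal_fun.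
by rewrite !subr0 sqrrN.
Qed.

Lemma integral_normal_translation m (g : rT -> \bar R) : measurable_fun setT g ->
  (forall x, (0 <= g x)%E) ->
  (\int[normal_prob m s]_x g x = \int[normal_prob 0 s]_x g (x + m)%R)%E.
Proof.
move=> mg g0.
have mc : measurable_fun setT (fun x : rT => x + m : rT) by exact: measurable_funD.
have inv A (mA : measurable A) : normal_prob m s A = normal_prob 0 s ((fun x : rT => x + m) @^-1` A).
  by rewrite -[in LHS](add0r m); exact: normal_prob_translation.
by rewrite (ge0_integral_image mc inv measurableT mg g0).
Qed.

(* Completing the square. *)
Lemma integral_normal_tilt h (g : rT -> R) : measurable_fun setT g ->
  (forall x, 0 <= g x) ->
  (\int[normal_prob 0 s]_x (expR (h * x) * g x)%:E =
   (expR (h ^+ 2 * s ^+ 2 / 2))%:E * \int[normal_prob 0 s]_x (g (x + h * s ^+ 2)%R)%:E)%E.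
Proof.
move=> mg g0.
have me : measurable_fun setT (fun x : rT => expR (h * x)).
  by apply: measurableT_comp => //; exact: measurable_funM.
have mEg : measurable_fun setT (fun x : rT => (g x)%:E) by exact/measurable_EFinP.
have mEeg : measurable_fun setT (fun x : rT => (expR (h * x) * g x)%:E).
  by apply/measurable_EFinP; exact: measurable_funM.
have mp m : measurable_fun setT (fun x : rT => (normal_pdf m s x)%:E).
  by apply/measurable_EFinP; exact: measurable_normal_pdf.
have Eg0 x : (0 <= (g x)%:E)%E by rewrite lee_fin.
have Eeg0 x : (0 <= (expR (h * x) * g x)%:E)%E.
  by rewrite lee_fin mulr_ge0// expR_ge0.
rewrite -(integral_normal_translation (h * s ^+ 2) mEg Eg0).
rewrite (integral_normal_prob _ mEg Eg0) (integral_normal_prob _ mEeg Eeg0).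
rewrite -ge0_integralZl//; last first.
- by move=> x _; rewrite mule_ge0// lee_fin normal_pdf_ge0.
- by apply: emeasurable_funM => //; exact: mp.
apply: eq_integral => x _; rewrite -!EFinM !normal_pdfE// /normal_fun.
have -> : - (x - h * s ^+ 2) ^+ 2 / (s ^+ 2 *+ 2) =
  - (h ^+ 2 * s ^+ 2 / 2) + h * x + - (x - 0) ^+ 2 / (s ^+ 2 *+ 2) :> R.
  by rewrite -mulr_natr; field.
have e0 : expR (h ^+ 2 * s ^+ 2 / 2) != 0 by rewrite gt_eqF// expR_gt0.
by rewrite !expRD expRN; congr EFin; field.
Qed.

Local Notation N := (normal_prob 0 s : probability rT R).
Local Notation Phi := (fun t : R => \int[N]_x cos (t * x)).

Let msin t c : measurable_fun setT (fun x : rT => sin (t * x + c)).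
Proof.
apply: measurableT_comp; last by apply: measurable_funD => //; exact: measurable_funM.
by apply: continuous_measurable_fun; exact: continuous_sin.
Qed.

Let mcos t c : measurable_fun setT (fun x : rT => cos (t * x + c)).
Proof.
apply: measurableT_comp; last by apply: measurable_funD => //; exact: measurable_funM.
by apply: continuous_measurable_fun; exact: continuous_cos.
Qed.

Let mexp h : measurable_fun setT (fun x : rT => expR (h * x)).
Proof. by apply: measurableT_comp => //; exact: measurable_funM. Qed.

Lemma normal_exp_integrable h : N.-integrable setT (EFin \o (fun x : rT => expR (h * x))).
Proof.
apply/integrableP; split; first exact/measurable_EFinP.
have := @integral_normal_tilt h (cst 1) (measurable_cst _) (fun=> ler01).
have e1 : (\int[N]_x (cst 1 (x + h * s ^+ 2)%R)%:E = 1)%E.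
  transitivity (\int[N]_x cst 1%E x)%E => //.
  by rewrite integral_cst// mul1e; exact: (@probability_setT _ _ _ N).
rewrite e1 mule1 => e.
rewrite [X in (X < _)%E](_ : _ = (expR (h ^+ 2 * s ^+ 2 / 2))%:E) ?ltry// -e.
by apply: eq_integral => x _ /=; rewrite mulr1 ger0_norm// expR_ge0.
Qed.

(** Dominates x^2 and |x| exp |x|, the bounds that occur when differentiating under the integral
    with parameters in (-1, 1). It is free of absolute values, so its integrability is that of
    [expR (h * x)] at h = 2 and h = -2. *)
Definition exp_envelope (x : R) : R := expR (2 * x) + expR (- 2 * x).

Lemma exp_envelope_integrable : N.-integrable setT (EFin \o exp_envelope).
Proof.
rewrite (_ : _ \o _ = (EFin \o (fun x => expR (2 * x))) \+ (EFin \o (fun x => expR (- 2 * x))))%E.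
  by apply: integrableD => //; exact: normal_exp_integrable.
by apply/funext => x.
Qed.

Lemma exp_envelope_ge (x : R) :
  expR `|x| * expR `|x| <= exp_envelope x.
Proof.
rewrite /exp_envelope -expRD; have [x0|x0] := leP 0 x.
  have -> : `|x| + `|x| = 2 * x by rewrite ger0_norm//; ring.
  by rewrite lerDl expR_ge0.
have -> : `|x| + `|x| = - 2 * x by rewrite ltr0_norm//; ring.
by rewrite lerDr expR_ge0.
Qed.

Lemma norm_le_expR (x : R) : `|x| <= expR `|x|.
Proof. by rewrite (le_trans _ (expR_ge1Dx _))// lerDr. Qed.

Lemma norm_le_exp_envelope (x : R) : `|x| <= exp_envelope x.
Proof.
rewrite (le_trans _ (exp_envelope_ge x))// (le_trans (norm_le_expR x))//.
by rewrite ler_peMr// ?expR_ge0// -expR0 ler_expR.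
Qed.

Lemma sqr_le_exp_envelope (x : R) : x ^+ 2 <= exp_envelope x.
Proof.
rewrite (le_trans _ (exp_envelope_ge x))// -real_normK ?num_real// expr2.
by rewrite ler_pM// norm_le_expR.
Qed.

Lemma normal_integrable_le (g : rT -> R) : measurable_fun setT g ->
  (forall x, `|g x| <= exp_envelope x) -> N.-integrable setT (EFin \o g).
Proof.
move=> mg gG; apply: le_integrable exp_envelope_integrable => //.
  exact/measurable_EFinP.
by move=> x _; rewrite /= lee_fin (le_trans (gG x))// ler_norm.
Qed.

Lemma normal_odd (g : rT -> R) : measurable_fun setT g ->
  N.-integrable setT (EFin \o g) -> (forall x, g (- x) = - g x) -> \int[N]_x g x = 0.
Proof.
move=> mg ig godd.
have mN : measurable_fun setT (fun x : rT => - x : rT) by apply: measurableT_comp.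
have : \int[N]_x g x = - \int[N]_x g x.
  rewrite [LHS](Rintegral_image mN (@normal_prob_reflection) mg ig).
  rewrite -mulN1r -RintegralZl//; apply: eq_Rintegral => x _.
  by rewrite mulN1r godd.
by lra.
Qed.

(** The tilt is known for nonnegative integrands: apply it to g + 1 and to 1, and subtract. *)
Lemma normal_tilt_bounded h (g : rT -> R) : measurable_fun setT g ->
  (forall x, `|g x| <= 1) -> \int[N]_x (expR (h * x) * g x) =
  expR (h ^+ 2 * s ^+ 2 / 2) * \int[N]_x g (x + h * s ^+ 2).
Proof.
move=> mg g1.
have ms : measurable_fun setT (fun x : rT => x + h * s ^+ 2 : rT).
  exact: measurable_funD.
have mgs : measurable_fun setT (fun x : rT => g (x + h * s ^+ 2)).
  exact: (measurableT_comp mg ms).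
have key (k : rT -> R) : measurable_fun setT k -> (forall x, 0 <= k x <= 2) ->
    \int[N]_x (expR (h * x) * k x) =
    expR (h ^+ 2 * s ^+ 2 / 2) * \int[N]_x k (x + h * s ^+ 2).
  move=> mk k02; have k0 x : 0 <= k x by case/andP: (k02 x).
  have mks : measurable_fun setT (fun x : rT => k (x + h * s ^+ 2)).
    exact: (measurableT_comp mk ms).
  rewrite [LHS]/Rintegral integral_normal_tilt// fineM//.
  apply: integrable_fin_num => //; apply: (@integrable_of_bounded _ _ _ N _ 2) => //.
  by move=> x; rewrite ger0_norm//; case/andP: (k02 (x + h * s ^+ 2)).
have m1 : measurable_fun setT (fun x : rT => g x + 1) by exact: measurable_funD.
have b1 x : 0 <= g x + 1 <= 2.
  by move: (g1 x); rewrite ler_norml; lra.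
have b2 (x : R) : 0 <= (1 : R) <= 2 by lra.
have ieg : N.-integrable setT (EFin \o (fun x : rT => expR (h * x) * g x)).
  apply: le_integrable (normal_exp_integrable h) => //.
    by apply/measurable_EFinP; exact: measurable_funM.
  by move=> x _; rewrite /= lee_fin normrM ler_piMr.
have ig : N.-integrable setT (EFin \o (fun x : rT => g (x + h * s ^+ 2))).
  exact: (@integrable_of_bounded _ _ _ N _ 1).
have k1 := key _ m1 b1.
have k2 : \int[N]_x (expR (h * x) * 1) = expR (h ^+ 2 * s ^+ 2 / 2) * \int[N]_x (1 : R).
  exact: (key (fun=> 1) (@measurable_cst _ _ _ _ setT (1 : R)) b2).
have i1 : N.-integrable setT (EFin \o (fun _ : rT => 1 : R)).
  by apply: (@integrable_of_bounded _ _ _ N _ 1) => // x; rewrite normr1.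
have ie1 : N.-integrable setT (EFin \o (fun x : rT => expR (h * x) * 1)).
  rewrite (_ : _ \o _ = EFin \o (fun x : rT => expR (h * x))).
    exact: normal_exp_integrable.
  by apply/funext => x /=; rewrite mulr1.
have e1 : \int[N]_x (expR (h * x) * (g x + 1)) =
    \int[N]_x (expR (h * x) * g x) + \int[N]_x (expR (h * x) * 1).
  by rewrite -RintegralD//; apply: eq_Rintegral => x _; rewrite mulrDr.
have e2 : \int[N]_x (g (x + h * s ^+ 2) + 1) =
    \int[N]_x g (x + h * s ^+ 2) + \int[N]_x (1 : R) by rewrite -RintegralD.
by move: k1; rewrite e1 e2 k2 mulrDr => /addIr.
Qed.

Lemma normal_sin t : \int[N]_x sin (t * x) = 0.
Proof.
apply: normal_odd.
- by under eq_fun do rewrite -[_ * _]addr0; exact: msin.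
- apply: (@integrable_of_bounded _ _ _ N _ 1) => [|x]; last exact: sin_max.
  by under eq_fun do rewrite -[_ * _]addr0; exact: msin.
- by move=> x; rewrite mulrN sinN.
Qed.

(** The tilt shifts x by h s^2; in the addition formula for the sine the odd term integrates to 0.
    What remains is the cosine transform times a factor whose derivative at h = 0 is t s^2. *)
Lemma normal_exp_sin h t : \int[N]_x (expR (h * x) * sin (t * x)) =
  expR (h ^+ 2 * s ^+ 2 / 2) * sin (t * (h * s ^+ 2)) * Phi t.
Proof.
have ms : measurable_fun setT (fun x : rT => sin (t * x)).
  by under eq_fun do rewrite -[_ * _]addr0; exact: msin.
have mc : measurable_fun setT (fun x : rT => cos (t * x)).
  by under eq_fun do rewrite -[_ * _]addr0; exact: mcos.
have is_ : N.-integrable setT (EFin \o (fun x : rT => sin (t * x))).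
  by apply: (@integrable_of_bounded _ _ _ N _ 1) => // x; exact: sin_max.
have ic : N.-integrable setT (EFin \o (fun x : rT => cos (t * x))).
  by apply: (@integrable_of_bounded _ _ _ N _ 1) => // x; exact: cos_max.
rewrite normal_tilt_bounded//; last by move=> x; exact: sin_max.
rewrite -[RHS]mulrA; congr (_ * _).
transitivity (\int[N]_x (cos (t * (h * s ^+ 2)) * sin (t * x) + sin (t * (h * s ^+ 2)) * cos (t * x))).
  by apply: eq_Rintegral => x _; rewrite mulrDr sinD mulrC [X in _ + X]mulrC.
rewrite RintegralD//; last 2 first.
- exact: (integrableZl _ (cos (t * (h * s ^+ 2))) is_).
- exact: (integrableZl _ (sin (t * (h * s ^+ 2))) ic).
by rewrite RintegralZl// RintegralZl// normal_sin mulr0 add0r.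
Qed.

End normal_prob_facts.

Section derivative_under_integral.
Context {d : measure_display} {T : measurableType d} {R : realType}.

Lemma is_derive_Rintegral (mu : {measure set T -> \bar R}) (f df : R -> T -> R) (a : R) (G : T -> R) :
  (forall (x : R) y, is_derive x 1 (f^~ y : R -> R) (df x y)) ->
  (forall x, mu.-integrable setT (EFin \o f x)) ->
  mu.-integrable setT (EFin \o G) ->
  (forall x y, x \in `]a - 1, a + 1[ -> `|df x y| <= G y) ->
  is_derive a 1 (fun x => \int[mu]_y f x y : R) (\int[mu]_y df a y).
Proof.
move=> fdf intf intG dfG.
have aI : `]a - 1, a + 1[%classic a by rewrite /= in_itv/= ltrBlDr !ltrDl ltr01.
have p1 x y : partial1of2 f x y = df x y.
  by rewrite /partial1of2 derive1E; exact: derive_val.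
have G0 y : 0 <= G y by rewrite (le_trans _ (dfG a y aI)).
have dG x y : `]a - 1, a + 1[%classic x -> [set: T] y -> `|partial1of2 f x y| <= G y.
  by move=> xI _; rewrite p1; exact: dfG.
have df1 x y : `]a - 1, a + 1[%classic x -> [set: T] y -> derivable (f^~ y) x 1.
  by move=> _ _; exact: ex_derive.
apply: DeriveDef.
  exact: (derivable_under_integral measurableT aI (fun x _ => intf x) df1 G0 intG dG).
rewrite -derive1E.
rewrite (differentiation_under_integral measurableT aI (fun x _ => intf x) df1 G0 intG dG).
by apply: eq_Rintegral => y _; exact: p1.
Qed.

End derivative_under_integral.

Section normal_moments.
Context {R : realType} (s : R).
Hypothesis s0 : s != 0.
Local Notation rT := (measurableTypeR R).
Local Notation N := (normal_prob 0 s : probability rT R).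
Local Notation Phi := (fun t : R => \int[N]_x cos (t * x)).

Let mlin t : measurable_fun setT (fun x : rT => t * x : rT).
Proof. exact: measurable_funM. Qed.

Let msin t : measurable_fun setT (fun x : rT => sin (t * x)).
Proof.
by apply: (measurableT_comp _ (mlin t)); apply: continuous_measurable_fun; exact: continuous_sin.
Qed.

Let mcos t : measurable_fun setT (fun x : rT => cos (t * x)).
Proof.
by apply: (measurableT_comp _ (mlin t)); apply: continuous_measurable_fun; exact: continuous_cos.
Qed.

Let mexp t : measurable_fun setT (fun x : rT => expR (t * x)).
Proof. by apply: (measurableT_comp _ (mlin t)). Qed.

Let icos t : N.-integrable setT (EFin \o (fun x : rT => cos (t * x))).
Proof. by apply: (@integrable_of_bounded _ _ _ N _ 1) => // x; exact: cos_max. Qed.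

Let ixsin t : N.-integrable setT (EFin \o (fun x : rT => x * sin (t * x))).
Proof.
apply: normal_integrable_le => // [|x].
  exact: measurable_funM.
rewrite normrM (le_trans _ (norm_le_exp_envelope x))// ler_piMr//.
exact: sin_max.
Qed.

(* Differentiating the tilted sine integral at h = 0. *)
Lemma normal_x_sin t : \int[N]_x (x * sin (t * x)) = t * s ^+ 2 * Phi t.
Proof.
have d1 : is_derive (0 : R) 1 (fun h => \int[N]_x (expR (h * x) * sin (t * x)))
    (\int[N]_x (x * expR (0 * x) * sin (t * x))).
  apply: (@is_derive_Rintegral _ _ _ N (fun h x => expR (h * x) * sin (t * x))
     (fun h x => x * expR (h * x) * sin (t * x)) _ exp_envelope).
  - move=> h y; apply: is_derive_eq.
    by rewrite !scaler0 !add0r; rewrite /GRing.scale/=; ring.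
  - move=> h; apply: le_integrable (normal_exp_integrable s0 h) => //.
      by apply/measurable_EFinP; exact: measurable_funM.
    by move=> x _; rewrite /= lee_fin normrM ler_piMr// sin_max.
  - exact: exp_envelope_integrable.
  - move=> h x; rewrite in_itv/= sub0r add0r => /andP[h1 h2].
    rewrite (le_trans _ (exp_envelope_ge x))// 2!normrM.
    rewrite (le_trans (ler_piMr _ (sin_max _)))// ler_pM// ?norm_le_expR//.
    rewrite ger0_norm ?expR_ge0// ler_expR (le_trans (ler_norm _))// normrM ler_piMl//.
    by rewrite ler_norml !ltW.
have d2 : is_derive (0 : R) 1 (fun h => \int[N]_x (expR (h * x) * sin (t * x)))
    (t * s ^+ 2 * Phi t).
  rewrite (_ : (fun h => _) = (fun h => expR (h ^+ 2 * s ^+ 2 / 2) *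
     sin (t * (h * s ^+ 2)) * Phi t)); last first.
    by apply/funext => h; rewrite normal_exp_sin.
  apply: is_derive_eq.
  rewrite /GRing.scale/= !(mul0r, mulr0, expr0n, sin0, cos0, expR0)/=. ring.
have := @derive_val _ _ _ _ _ _ _ d1; rewrite (@derive_val _ _ _ _ _ _ _ d2) => ->.
by apply: eq_Rintegral => x _; rewrite mul0r expR0 mulr1.
Qed.

(** [normal_x_sin] amounts to the differential equation Phi' = - t s^2 Phi. Hence Phi(t) exp (t^2
    s^2 / 2) is constant, with value 1 at 0. *)
Lemma normal_cos t : Phi t = expR (- (t ^+ 2 * s ^+ 2 / 2)).
Proof.
have d1 (a : R) : is_derive a 1 Phi (- (a * s ^+ 2 * Phi a)).
  have -> : - (a * s ^+ 2 * Phi a) = \int[N]_x (- (x * sin (a * x))).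
    rewrite -normal_x_sin -mulN1r -RintegralZl//; last exact: ixsin.
    by apply: eq_Rintegral => x _; rewrite mulN1r.
  apply: (@is_derive_Rintegral _ _ _ N (fun h x => cos (h * x))
     (fun h x => - (x * sin (h * x))) _ exp_envelope) => //.
  - move=> h y; apply: is_derive_eq.
    by rewrite !scaler0 ?add0r ?addr0 /GRing.scale/=; ring.
  - exact: exp_envelope_integrable.
  - move=> h x _; rewrite normrN normrM (le_trans _ (norm_le_exp_envelope x))//.
    by rewrite ler_piMr// sin_max.
have d2 (a : R) : is_derive a 1 (fun t => Phi t * expR (t ^+ 2 * s ^+ 2 / 2)) 0.
  have da := d1 a.
  by apply: is_derive_eq; rewrite /GRing.scale/=; field.
have := is_derive_0_is_cst t 0 d2.
rewrite expr0n/= !mul0r expR0 mulr1.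
under [X in _ = X -> _]eq_Rintegral do rewrite mul0r cos0.
rewrite [X in _ = X -> _](_ : _ = 1); last first.
  have e : N [set: rT] = 1%E := probability_setT N.
  by rewrite Rintegral_cst// mul1r [X in fine X]e.
move=> e; rewrite expRN; apply: (mulIf (lt0r_neq0 (expR_gt0 (t ^+ 2 * s ^+ 2 / 2)))).
by rewrite e mulVf// gt_eqF// expR_gt0.
Qed.

Lemma normal_mean : \int[N]_x (x : R) = 0.
Proof.
apply: (normal_odd s0) => //; apply: normal_integrable_le => //.
exact: norm_le_exp_envelope.
Qed.

(** Derivative at t = 0 of [normal_x_sin], in which [normal_cos] has made the right-hand side
    explicit. *)
Lemma normal_variance : \int[N]_x (x ^+ 2) = s ^+ 2.
Proof.
have d1 : is_derive (0 : R) 1 (fun t => \int[N]_x (x * sin (t * x)))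
    (\int[N]_x (x * (x * cos (0 * x)))).
  apply: (@is_derive_Rintegral _ _ _ N (fun t x => x * sin (t * x))
     (fun t x => x * (x * cos (t * x))) _ exp_envelope) => //.
  - move=> h y; apply: is_derive_eq.
    by rewrite !scaler0 ?add0r ?addr0 /GRing.scale/=; ring.
  - exact: exp_envelope_integrable.
  - move=> h x _; rewrite mulrA normrM (le_trans _ (sqr_le_exp_envelope x))//.
    by rewrite -expr2 ger0_norm ?sqr_ge0// ler_piMr ?sqr_ge0// cos_max.
have d2 : is_derive (0 : R) 1 (fun t => \int[N]_x (x * sin (t * x))) (s ^+ 2).
  rewrite (_ : (fun t => _) = (fun t => t * s ^+ 2 * expR (- (t ^+ 2 * s ^+ 2 / 2)))).
    apply: is_derive_eq; rewrite /GRing.scale/= !(mul0r, mulr0, expr0n)/= oppr0 expR0; ring.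
  by apply/funext => t; rewrite normal_x_sin normal_cos.
have := @derive_val _ _ _ _ _ _ _ d1; rewrite (@derive_val _ _ _ _ _ _ _ d2) => ->.
by apply: eq_Rintegral => x _; rewrite mul0r cos0 mulr1 expr2.
Qed.

Lemma normal_square_integrable : N.-integrable setT (EFin \o (fun x : rT => (x : R) ^+ 2)).
Proof.
apply: normal_integrable_le => // x.
by rewrite ger0_norm ?sqr_ge0// sqr_le_exp_envelope.
Qed.

End normal_moments.

Section square_integrable.
Context {d : measure_display} {T : measurableType d} {R : realType}.
Variable P : probability T R.
Implicit Types (f g : T -> R).

Definition square_integrable f :=
  measurable_fun setT f /\ P.-integrable setT (EFin \o (fun x => f x ^+ 2)).

Lemma Rintegral_cstP (c : R) : \int[P]_x c = c.
Proof.
have e : P [set: T] = 1%E := probability_setT P.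
by rewrite Rintegral_cst// [X in _ * fine X]e mulr1.
Qed.

Lemma integrable_cstP (c : R) : P.-integrable setT (EFin \o (fun=> c)).
Proof. by apply: (@integrable_of_bounded _ _ _ P _ `|c|). Qed.

Lemma integrable_le f g : measurable_fun setT f -> P.-integrable setT (EFin \o g) ->
  (forall x, `|f x| <= g x) -> P.-integrable setT (EFin \o f).
Proof.
move=> mf ig fg; apply: le_integrable ig => //; first exact/measurable_EFinP.
by move=> x _; rewrite /= lee_fin (le_trans (fg x))// ler_norm.
Qed.

Lemma integrableDR f g : P.-integrable setT (EFin \o f) -> P.-integrable setT (EFin \o g) ->
  P.-integrable setT (EFin \o (fun x => f x + g x)).
Proof. exact: (@integrableD _ _ _ P setT measurableT). Qed.

Lemma integrableZR a f : P.-integrable setT (EFin \o f) ->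
  P.-integrable setT (EFin \o (fun x => a * f x)).
Proof. exact: (@integrableZl _ _ _ P setT measurableT). Qed.

Lemma square_integrableM f g : square_integrable f -> square_integrable g ->
  P.-integrable setT (EFin \o (fun x => f x * g x)).
Proof.
move=> [mf f2] [mg g2].
apply: (@integrable_le _ (fun x => f x ^+ 2 + g x ^+ 2)).
- exact: measurable_funM.
- exact: integrableDR.
- move=> x; rewrite normrM -[f x ^+ 2]real_normK ?num_real// -[g x ^+ 2]real_normK ?num_real//.
  have := sqr_ge0 (`|f x| - `|g x|); rewrite sqrrB.
  have := normr_ge0 (f x); have := normr_ge0 (g x).
  move: `|f x| `|g x| => a b b0 a0; have := mulr_ge0 a0 b0.
  rewrite -mulr_natr; lra.
Qed.

Lemma square_integrable_cst c : square_integrable (fun=> c).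
Proof. by split => //; exact: integrable_cstP. Qed.

Lemma square_integrable_integrable f : square_integrable f ->
  P.-integrable setT (EFin \o f).
Proof.
move=> sf; have := square_integrableM sf (square_integrable_cst 1).
by rewrite (_ : (fun x => _) = f)//; apply/funext => x; rewrite mulr1.
Qed.

Lemma square_integrableZ a f : square_integrable f -> square_integrable (fun x => a * f x).
Proof.
move=> [mf f2]; split; first exact: measurable_funM.
rewrite (_ : (fun x => _) = (fun x => a ^+ 2 * f x ^+ 2)); first exact: integrableZR.
by apply/funext => x; rewrite exprMn.
Qed.

Lemma square_integrableD f g : square_integrable f -> square_integrable g ->
  square_integrable (fun x => f x + g x).
Proof.
move=> sf sg; split; first exact: (measurable_funD sf.1 sg.1).
rewrite (_ : (fun x => _) = (fun x => (f x ^+ 2 + 2 * (f x * g x)) + g x ^+ 2)).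
  apply: integrableDR; last exact: sg.2.
  apply: integrableDR; first exact: sf.2.
  exact/integrableZR/square_integrableM.
by apply/funext => x; ring.
Qed.

Lemma square_integrableB f g : square_integrable f -> square_integrable g ->
  square_integrable (fun x => f x - g x).
Proof.
move=> sf sg; have := square_integrableD sf (square_integrableZ (-1) sg).
by rewrite (_ : (fun x => f x + _) = (fun x => f x - g x))//; apply/funext => x; rewrite mulN1r.
Qed.

End square_integrable.

(** * Characteristic functions of real Gaussian variables *)

Section gaussian_characterization.
Context {d : measure_display} {T : measurableType d} {R : realType}.
Variable P : probability T R.
Implicit Types (f : T -> R).
Local Notation rT := (measurableTypeR R).

(** The characteristic function of the law with mean m and variance v in real form: the phase c = 0
    gives its real part, c = - pi / 2 its imaginary part. The value v = 0 covers point masses. *)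
Definition gaussian_cf f m v := forall t c : R,
  \int[P]_x cos (t * f x + c) = cos (t * m + c) * expR (- (t ^+ 2 * v / 2)).

Let mcosl t c : measurable_fun setT (fun x : rT => cos (t * x + c)).
Proof.
apply: measurableT_comp; last by apply: measurable_funD => //; exact: measurable_funM.
by apply: continuous_measurable_fun; exact: continuous_cos.
Qed.

Lemma cos_affine_integrable (Q : probability rT R) (t c : R) :
  Q.-integrable setT (EFin \o (fun x : rT => cos (t * x + c))).
Proof. by apply: (@integrable_of_bounded _ _ _ Q _ 1) => // x; exact: cos_max. Qed.

Lemma normal_cos_affine (s t c : R) : s != 0 ->
  \int[normal_prob 0 s]_x cos (t * x + c) = cos c * expR (- (t ^+ 2 * s ^+ 2 / 2)).
Proof.
move=> s0; have msin : measurable_fun setT (fun x : rT => sin (t * x)).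
  apply: measurableT_comp; last exact: measurable_funM.
  by apply: continuous_measurable_fun; exact: continuous_sin.
have is_ : (normal_prob 0 s).-integrable setT (EFin \o (fun x : rT => sin (t * x))).
  by apply: (@integrable_of_bounded _ _ _ (normal_prob 0 s) _ 1) => // x; exact: sin_max.
have ic : (normal_prob 0 s).-integrable setT (EFin \o (fun x : rT => cos (t * x))).
  have := cos_affine_integrable (normal_prob 0 s) t 0.
  by under [X in _.-integrable _ (_ \o X)]eq_fun do rewrite addr0.
transitivity (\int[normal_prob 0 s]_x (cos c * cos (t * x) + (- sin c) * sin (t * x))).
  by apply: eq_Rintegral => x _; rewrite cosD; ring.
rewrite RintegralD//; last 2 first.
- exact: (integrableZl _ (cos c) ic).
- exact: (integrableZl _ (- sin c) is_).
by rewrite RintegralZl// RintegralZl// normal_sin// normal_cos// mulr0 addr0.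
Qed.

Lemma gaussian_facts f : measurable_fun setT f ->
  real_gaussian (pushforward P (f : T -> rT)) ->
  square_integrable P f /\
  gaussian_cf f (\int[P]_x f x) (\int[P]_x (f x - \int[P]_x f x) ^+ 2).
Proof.
move=> mf [m [s Ps]].
have mf' : @measurable_fun _ _ T rT setT f := mf.
have [s0|s0] := eqVneq s 0.
  have im A : measurable A -> (dirac (m : rT) : probability rT R) A = P (f @^-1` A).
    by move=> mA; have := Ps A mA; rewrite s0 eqxx => /esym; exact.
  have H (g : rT -> R) : measurable_fun setT g ->
      P.-integrable setT (EFin \o (g \o f)) /\ \int[P]_x g (f x) = g m.
    move=> mg.
    have ig : (dirac (m : rT) : probability rT R).-integrable setT (EFin \o g).
      apply/integrableP; split; first exact/measurable_EFinP.
      rewrite integral_dirac//; last by apply: measurableT_comp => //; exact/measurable_EFinP.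
      by rewrite diracT mul1e ltry.
    split; first exact: ((integrable_image mf' im mg).1 ig).
    rewrite -(Rintegral_image mf' im mg ig) /Rintegral integral_dirac//; last exact/measurable_EFinP.
    by rewrite diracT mul1e.
  have mid : measurable_fun setT (fun x : rT => x : R) by [].
  have Ef : \int[P]_x f x = m by have [] := H _ mid.
  have msq : measurable_fun setT (fun x : rT => (x : R) ^+ 2) by exact: measurable_funX.
  split; first by split => //; have [] := H _ msq.
  have msm : measurable_fun setT (fun x : rT => (x - m : R) ^+ 2).
    by apply: measurable_funX; exact: measurable_funB.
  have [_ v0] := H _ msm.
  move=> t c; rewrite Ef v0 subrr expr0n/= mulr0 mul0r oppr0 expR0 mulr1.
  by have [_ ->] := H _ (mcosl t c).
have madd : measurable_fun setT (fun x : rT => x + m : rT) by exact: measurable_funD.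
have im1 A : measurable A -> normal_prob m s A = P (f @^-1` A).
  by move=> mA; have := Ps A mA; rewrite (negbTE s0) => /esym; exact.
have im2 (A : set rT) : measurable A ->
    normal_prob m s A = normal_prob 0 s ((fun x : rT => x + m) @^-1` A).
  by move=> mA; rewrite -[in LHS](add0r m); exact: normal_prob_translation.
have H (g : rT -> R) : measurable_fun setT g ->
    (normal_prob 0 s).-integrable setT (EFin \o (fun x : rT => g (x + m))) ->
    P.-integrable setT (EFin \o (g \o f)) /\
    \int[P]_x g (f x) = \int[normal_prob 0 s]_x g (x + m).
  move=> mg ig.
  have ig' : (normal_prob m s).-integrable setT (EFin \o g).
    exact: ((integrable_image madd im2 mg).2 ig).
  split; first exact: ((integrable_image mf' im1 mg).1 ig').
  by rewrite -(Rintegral_image mf' im1 mg ig') (Rintegral_image madd im2 mg ig').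
have sid : square_integrable (normal_prob 0 s : probability rT R) (fun x => x : R).
  by split => //; exact: normal_square_integrable.
have sm := square_integrableD sid (square_integrable_cst (normal_prob 0 s : probability rT R) m).
have mid : measurable_fun setT (fun x : rT => x : R) by [].
have Ef : \int[P]_x f x = m.
  have [_ ->] := H _ mid (square_integrable_integrable sm).
  rewrite RintegralD//; last 2 first.
  - exact: (square_integrable_integrable sid).
  - exact: integrable_cstP.
  by rewrite normal_mean// add0r Rintegral_cstP.
have msq : measurable_fun setT (fun x : rT => (x : R) ^+ 2) by exact: measurable_funX.
split; first by split => //; have [] := H _ msq sm.2.
have msm : measurable_fun setT (fun x : rT => (x - m : R) ^+ 2).
  by apply: measurable_funX; exact: measurable_funB.
have [|_ v0] := H _ msm.
  under eq_fun do rewrite addrK; exact: sid.2.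
move=> t c; rewrite Ef v0.
rewrite [X in expR (- (_ * X / _))](_ : _ = s ^+ 2); last first.
  by rewrite -(normal_variance s0); apply: eq_Rintegral => x _; rewrite addrK.
have [|_ ->] := H _ (mcosl t c).
  apply: (@integrable_of_bounded _ _ _ (normal_prob 0 s) _ 1).
    exact: (measurableT_comp (mcosl t c) madd).
  by move=> x; exact: cos_max.
rewrite -normal_cos_affine//; apply: eq_Rintegral => x _; congr cos; ring.
Qed.

End gaussian_characterization.

Section gaussian_of_cf.
Context {d : measure_display} {T : measurableType d} {R : realType}.
Variable P : probability T R.
Local Notation rT := (measurableTypeR R).

Lemma eq_law_affine (mu nu : probability rT R) :
  (forall t c : R, \int[mu]_x cos (t * x + c) = \int[nu]_x cos (t * x + c)) ->
  forall A, measurable A -> mu A = nu A.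
Proof.
move=> h A mA.
pose V : set (rT -> R) := [set f | exists t c, f = (fun x : rT => t * x + c)].
have mV f : V f -> measurable_fun setT f.
  by move=> [t [c ->]]; apply: measurable_funD => //; exact: measurable_funM.
apply: (@cos_unique _ _ _ mu nu V) => //.
- by move=> c; exists 0, c; apply/funext => x; rewrite mul0r add0r.
- move=> f g [t [c ->]] [u [e ->]]; exists (t + u), (c + e).
  by apply/funext => x /=; ring.
- move=> a f [t [c ->]]; exists (a * t), (a * c).
  by apply/funext => x /=; ring.
- by move=> f [t [c ->]].
- move: mA; rewrite RGenOInfty.measurableE.
  apply: sub_sigma_algebra2 => _ [y ->].
  exists (fun x => (-1) * x + y); first by exists (-1), y.
  by apply/seteqP; split => x; rewrite /= in_itv/= andbT; lra.
Qed.

Lemma gaussian_of_cf (f : T -> R) m v : measurable_fun setT f -> 0 <= v ->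
  gaussian_cf P f m v -> real_gaussian (pushforward P (f : T -> rT)).
Proof.
move=> mf v0 cf.
have mf' : @measurable_fun _ _ T rT setT f := mf.
pose F : {mfun T >-> rT} := @mfun_Sub _ _ T rT f (mem_set mf').
pose Q := distribution P F.
have imQ (A : set rT) : measurable A -> Q A = P (f @^-1` A) by [].
have Qcos t c : \int[Q]_x cos (t * x + c) = cos (t * m + c) * expR (- (t ^+ 2 * v / 2)).
  have mc : measurable_fun setT (fun x : rT => cos (t * x + c)).
    apply: measurableT_comp; last by apply: measurable_funD => //; exact: measurable_funM.
    by apply: continuous_measurable_fun; exact: continuous_cos.
  by rewrite (Rintegral_image mf' imQ mc (cos_affine_integrable Q t c)).
exists m, (Num.sqrt v) => B mB; transitivity (Q B) => //.
have [s0|s0] := eqVneq (Num.sqrt v) 0.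
  have v00 : v = 0 by apply/eqP; rewrite eq_le v0 andbT -sqrtr_eq0 s0.
  apply: (eq_law_affine (mu := Q) (nu := dirac (m : rT))) => // t c; rewrite Qcos v00.
  rewrite mulr0 mul0r oppr0 expR0 mulr1 /Rintegral integral_dirac//.
    by rewrite diracT mul1e.
  apply/measurable_EFinP/measurableT_comp.
    by apply: continuous_measurable_fun; exact: continuous_cos.
  by apply: measurable_funD => //; exact: measurable_funM.
apply: (eq_law_affine (mu := Q) (nu := normal_prob m (Num.sqrt v))) => // t c.
rewrite Qcos.
have madd : measurable_fun setT (fun x : rT => x + m : rT) by exact: measurable_funD.
have im2 (A : set rT) : measurable A ->
    normal_prob m (Num.sqrt v) A = normal_prob 0 (Num.sqrt v) ((fun x : rT => x + m) @^-1` A).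
  by move=> mA; rewrite -[in LHS](add0r m); exact: normal_prob_translation.
have mc : measurable_fun setT (fun x : rT => cos (t * x + c)).
  apply: measurableT_comp; last by apply: measurable_funD => //; exact: measurable_funM.
  by apply: continuous_measurable_fun; exact: continuous_cos.
rewrite (Rintegral_image madd im2 mc (cos_affine_integrable _ t c)).
have := normal_cos_affine t (t * m + c) s0; rewrite sqr_sqrtr// => <-.
by apply: eq_Rintegral => x _; congr cos; ring.
Qed.

End gaussian_of_cf.

(** * Borel sets of separable normed spaces *)

Section borel_sets.
Context {R : realType} {E : normedModType R}.
Local Notation rT := (measurableTypeR R).

Lemma continuous_borel (phi : E -> R) : continuous phi ->
  @measurable_fun _ _ (borel E) rT setT phi.
Proof.
move=> cphi; apply: (measurability (@RGenOpens.G R)); first exact: RGenOpens.measurableE.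
move=> _ [_ [a [b ->]] <-]; rewrite setTI; apply: sub_sigma_algebra.
by apply: open_comp; [move=> x _; exact: cphi|exact: interval_open].
Qed.

Lemma dual_borel (x' : dual E) : @measurable_fun _ _ (borel E) rT setT x'.
Proof. by apply: continuous_borel; exact: dual_continuous. Qed.

Lemma norm_borel : @measurable_fun _ _ (borel E) rT setT (fun x : E => `|x|).
Proof. by apply: continuous_borel; exact: norm_continuous. Qed.

Hypothesis sepE : separable E.

Lemma dense_seq : exists e : nat -> E, forall x r, 0 < r -> exists n, `|x - e n| < r.
Proof.
have [D cD dD] := sepE; have /countable_injP[f injf] := cD.
(* An index that is not hit by the injection receives an arbitrary point, which is harmless since
   only closeness to x is asserted. *)
exists (fun n => get [set d | D d /\ f d = n]) => x r r0.
have [||d [xd Dd]] := dD (ball x r).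
- by exists x; exact: ballxx.
- exact: ball_open.
exists (f d); have [Dg fg] : [set z | D z /\ f z = f d] (get [set z | D z /\ f z = f d]).
  by apply: getPex; exists d.
by rewrite (injf _ d _ _ fg) ?inE//; move: xd; rewrite -ball_normE.
Qed.

(** Functionals norming the points e_n of a dense sequence suffice: if e_n is within r / 2 of x,
    then x'_n x >= |e_n| - r / 2 >= |x| - r. *)
Lemma norming_seq : exists x' : nat -> dual E, (forall n x, `|x' n x| <= `|x|) /\
  forall x c, (forall n, x' n x <= c) -> `|x| <= c.
Proof.
have [e de] := dense_seq.
have [x' x'P] := choice (fun n => norming_functional (e n)).
exists x'; split=> [n x|x c xc]; first exact: (x'P n).2.
apply/ler_addgt0Pr => r r0; have [|n xn] := de x (r / 2); first by rewrite divr_gt0.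
have h1 : `|e n| - `|x| >= - (r / 2).
  have := ler_normB x (x - e n); rewrite opprB addrCA subrr addr0.
  by move=> _; have := ler_dist_dist x (e n); rewrite ler_norml; lra.
have h2 := xc n; have := (x'P n).2 (e n - x); rewrite distrC dualB (x'P n).1.
by rewrite ler_norml => /andP[_ h3]; lra.
Qed.

(** By separability an open set is a countable union of closed balls, and by [norming_seq] a closed
    ball is a countable intersection of half-spaces. *)
Lemma borel_ind (G : set (set E)) : sigma_algebra setT G ->
  (forall (x' : dual E) c, G [set x | x' x < c]) ->
  forall A : set (borel E), measurable A -> G A.
Proof.
move=> sG Gx' A mA; apply: (smallest_sub sG _ mA) => U oU.
have [e de] := dense_seq; have [x' [x'1 x'n]] := norming_seq.
have [G0 GC Gbig] := sG.
have {}GC B : G B -> G (~` B) by move=> /GC; rewrite setTD.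
have Gcap (F : nat -> set E) : (forall n, G (F n)) -> G (\bigcap_n F n).
  move=> GF; rewrite -[X in G X]setCK setC_bigcap; apply: (GC); apply: (Gbig) => n.
  exact: GC.
have Gle (y' : dual E) c : G [set x | y' x <= c].
  have [z' z'E] := dual_lin y' y' (-1) 0.
  rewrite (_ : mkset _ = ~` [set x | z' x < - c]); first exact/GC.
  apply/seteqP; split=> x; rewrite /= z'E mul0r addr0 mulN1r ltrN2.
    by move=> h; apply/negP; rewrite -leNgt.
  by move=> /negP; rewrite -leNgt.
have Gball a r : G [set x | `|x - a| <= r].
  rewrite (_ : mkset _ = \bigcap_n [set x | x' n x <= r + x' n a]).
    by apply: (Gcap) => n; exact: Gle.
  apply/seteqP; split=> x /=.
    move=> h n _ /=; rewrite -lerBlDr -dualB (le_trans _ h)//.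
    by rewrite (le_trans (ler_norm _)).
  by move=> h; apply: x'n => n; rewrite dualB lerBlDr; exact: h.
pose B n k := [set x | `|x - e n| <= k.+1%:R^-1].
(* Balls that do not fit inside U are replaced by the empty set, which keeps the union indexed by
   pairs of numbers. *)
rewrite (_ : U = \bigcup_n \bigcup_k (if `[< B n k `<=` U >] then B n k else set0)).
  by apply: (Gbig) => n; apply: (Gbig) => k; case: ifP => _ //; exact: Gball.
apply/seteqP; split=> [x Ux|x [n _ [k _]]]; last by case: asboolP => // h /h.
have /nbhs_ballP[r /= r0 rU] : nbhs x U by exact: open_nbhs_nbhs.
have [k kr] : exists k : nat, k.+1%:R^-1 < r / 2.
  exists (Num.truncn (r / 2)^-1); rewrite invf_plt ?posrE ?divr_gt0//.
  exact: truncnS_gt.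
have [|n xn] := de x (k.+1%:R^-1); first by rewrite invr_gt0.
exists n => //; exists k => //; rewrite asboolT; first exact: ltW.
move=> y /= yn; apply: rU; rewrite -ball_normE /=.
rewrite -(subrK (e n) x) -addrA (le_lt_trans (ler_normD _ _))//.
rewrite (distrC (e n)) (le_lt_trans (lerD (ltW xn) yn))//.
by rewrite [ltRHS]splitr ltrD.
Qed.

Lemma borel_measurableP d (T : measurableType d) (f : T -> E) :
  (forall x' : dual E, measurable_fun setT (fun w => x' (f w))) ->
  @measurable_fun _ _ T (borel E) setT f.
Proof.
move=> h _ A mA; rewrite setTI; move: A mA.
apply: (@borel_ind [set A | measurable (f @^-1` A)]).
  split=> /=.
  - by rewrite preimage_set0.
  - by move=> B mB; rewrite setTD preimage_setC; exact: measurableC.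
  - by move=> F mF; rewrite preimage_bigcup; exact: bigcup_measurable.
move=> x' c; have := h x' measurableT `]-oo, c[%classic (measurable_itv _).
by rewrite setTI; congr measurable; apply/seteqP; split=> w; rewrite /= in_itv.
Qed.

Lemma borel_measurable_dual d (T : measurableType d) (f : T -> E) (x' : dual E) :
  @measurable_fun _ _ T (borel E) setT f -> measurable_fun setT (fun w => x' (f w)).
Proof. by move=> mf; exact: (measurableT_comp (dual_borel x') mf). Qed.

End borel_sets.

(** * Uniqueness of laws on separable spaces and their products *)

Section uniqueness_of_laws.
Context {R : realType} {E F : normedModType R}.
Hypothesis sepE : separable E.
Hypothesis sepF : separable F.

(** The sigma-algebra is the product one, on which product measures live. It is generated by
    half-spaces pulled back along the projections; pairing a functional with the zero functional of
    the other factor puts them among the sets that [cos_unique] requires. *)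
Lemma borel_prod_law (mu nu : probability (borel E * borel F)%type R) :
  (forall (x' : dual E) (y' : dual F) (c : R),
     \int[mu]_z cos (x' z.1 + y' z.2 + c) = \int[nu]_z cos (x' z.1 + y' z.2 + c)) ->
  forall A, measurable A -> mu A = nu A.
Proof.
move=> h A mA.
pose V : set (borel E * borel F -> R) := [set f | exists (x' : dual E) (y' : dual F) c,
  f = (fun z => x' z.1 + y' z.2 + c)].
have [zE zEE] : exists x' : dual E, forall x, x' x = 0.
  have [||z' z'E] := @dual_of R E (fun=> 0).
  - by move=> a x y; rewrite scaler0 addr0.
  - by exists 0 => x; rewrite normr0 mul0r.
  by exists z' => x; rewrite z'E.
have [zF zFE] : exists x' : dual F, forall x, x' x = 0.
  have [||z' z'E] := @dual_of R F (fun=> 0).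
  - by move=> a x y; rewrite scaler0 addr0.
  - by exists 0 => x; rewrite normr0 mul0r.
  by exists z' => x; rewrite z'E.
apply: (@cos_unique _ _ _ mu nu V) => //.
- move=> f [x' [y' [c ->]]]; apply: measurable_funD => //; apply: measurable_funD.
    exact: (measurableT_comp (dual_borel x') measurable_fst).
  exact: (measurableT_comp (dual_borel y') measurable_snd).
- by move=> c; exists zE, zF, c; apply/funext => z; rewrite zEE zFE !add0r.
- move=> f g [x' [y' [c ->]]] [u' [v' [e ->]]].
  have [p' p'E] := dual_lin x' u' 1 1; have [q' q'E] := dual_lin y' v' 1 1.
  exists p', q', (c + e); apply/funext => z /=; rewrite p'E q'E; ring.
- move=> a f [x' [y' [c ->]]].
  have [p' p'E] := dual_lin x' x' a 0; have [q' q'E] := dual_lin y' y' a 0.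
  exists p', q', (a * c); apply/funext => z /=; rewrite p'E q'E; ring.
- by move=> f [x' [y' [c ->]]].
pose W := <<s [set [set x | f x < 0] | f in V] >>.
have sW : sigma_algebra setT W by exact: smallest_sigma_algebra.
have [W0 WC Wbig] := sW.
have Wpre (T : Type) (phi : borel E * borel F -> T) :
    sigma_algebra setT [set B | W (phi @^-1` B)].
  split=> /=.
  - by rewrite preimage_set0.
  - by move=> B WB; rewrite setTD preimage_setC -setTD; exact: WC.
  - by move=> G WG; rewrite preimage_bigcup; exact: Wbig.
have W1 (B : set (borel E)) : measurable B -> W (fst @^-1` B).
  move: B; apply: (borel_ind sepE (G := [set B | W (fst @^-1` B)])); first exact: Wpre.
  move=> x' c; apply: sub_sigma_algebra; exists (fun z => x' z.1 + zF z.2 - c).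
    by exists x', zF, (- c).
  by apply/seteqP; split=> z /=; rewrite zFE; lra.
have W2 (B : set (borel F)) : measurable B -> W (snd @^-1` B).
  move: B; apply: (borel_ind sepF (G := [set B | W (snd @^-1` B)])); first exact: Wpre.
  move=> y' c; apply: sub_sigma_algebra; exists (fun z => zE z.1 + y' z.2 - c).
    by exists zE, y', (- c).
  by apply/seteqP; split=> z /=; rewrite zEE; lra.
apply: (smallest_sub sW _ mA) => _ [[B mB <-]|[B mB <-]]; rewrite setTI.
  exact: W1.
exact: W2.
Qed.

Lemma borel_law (mu nu : probability (borel E) R) :
  (forall (x' : dual E) (c : R), \int[mu]_x cos (x' x + c) = \int[nu]_x cos (x' x + c)) ->
  forall A, measurable A -> mu A = nu A.
Proof.
move=> h A mA.
pose V : set (borel E -> R) := [set f | exists (x' : dual E) c, f = (fun z => x' z + c)].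
have [zE zEE] : exists x' : dual E, forall x, x' x = 0.
  have [||z' z'E] := @dual_of R E (fun=> 0).
  - by move=> a x y; rewrite scaler0 addr0.
  - by exists 0 => x; rewrite normr0 mul0r.
  by exists z' => x; rewrite z'E.
apply: (@cos_unique _ _ _ mu nu V) => //.
- by move=> f [x' [c ->]]; apply: measurable_funD => //; exact: dual_borel.
- by move=> c; exists zE, c; apply/funext => z; rewrite zEE add0r.
- move=> f g [x' [c ->]] [u' [e ->]].
  have [p' p'E] := dual_lin x' u' 1 1.
  by exists p', (c + e); apply/funext => z /=; rewrite p'E; ring.
- move=> a f [x' [c ->]]; have [p' p'E] := dual_lin x' x' a 0.
  by exists p', (a * c); apply/funext => z /=; rewrite p'E; ring.
- by move=> f [x' [c ->]].
apply: (borel_ind sepE _ _ mA); first exact: smallest_sigma_algebra.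
move=> x' c; apply: sub_sigma_algebra; exists (fun z => x' z - c).
  by exists x', (- c).
by apply/seteqP; split=> z /=; lra.
Qed.

End uniqueness_of_laws.

(** * Square integrability of Gaussian vectors *)

Section bounded_integrals.
Context {d : measure_display} {T : measurableType d} {R : realType}.

Lemma fatou_integrable (mu : {measure set T -> \bar R}) (fn : nat -> T -> R) f M :
  (forall n, measurable_fun setT (fn n)) -> (forall n x, 0 <= fn n x) ->
  (forall x, fn n x @[n --> \oo] --> f x) ->
  (forall n, (\int[mu]_x (fn n x)%:E <= M%:E)%E) ->
  (\int[mu]_x (f x)%:E <= M%:E)%E /\ mu.-integrable setT (EFin \o f).
Proof.
move=> mfn fn0 fnf fnM.
have mf : measurable_fun setT f by apply: measurable_fun_cvg => // x _; exact: fnf.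
have f0 x : 0 <= f x.
  rewrite -(cvg_lim _ (fnf x))//; apply: limr_ge; first exact: cvgP (fnf x).
  exact: nearW.
have fM : (\int[mu]_x (f x)%:E <= M%:E)%E.
  have := @fatou _ _ _ mu _ measurableT (fun n x => (fn n x)%:E)
    (fun n => (measurable_EFinP setT (fn n)).2 (mfn n)) (fun n x _ => fn0 n x).
  rewrite (eq_integral (fun x => (f x)%:E)); last first.
    move=> x _; have cx : (fn n x)%:E @[n --> \oo] --> (f x)%:E.
      by apply: cvg_EFin; [exact: nearW|exact: fnf].
    by rewrite is_cvg_limn_einfE; [exact: cvg_lim|exact: cvgP cx].
  move/le_trans; apply; rewrite limn_einf_lim; apply: lime_le; first exact: is_cvg_einfs.
  apply: nearW => n; rewrite (le_trans _ (fnM n))//; apply: ereal_inf_lbound.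
  by exists n => /=.
split=> //; apply/integrableP; split; first exact/measurable_EFinP.
under eq_integral do rewrite /= ger0_norm//.
exact: le_lt_trans fM (ltry _).
Qed.

End bounded_integrals.

Section product_characteristic.
Context {d1 d2 : measure_display} {T1 : measurableType d1} {T2 : measurableType d2}.
Context {R : realType} (P1 : probability T1 R) (P2 : probability T2 R).

Lemma Rintegral_prod (f : T1 * T2 -> R) : (P1 \x P2)%E.-integrable setT (EFin \o f) ->
  (forall x, P2.-integrable setT (EFin \o (fun y => f (x, y)))) ->
  \int[(P1 \x P2)%E]_z f z = \int[P1]_x \int[P2]_y f (x, y).
Proof.
move=> fi fxi; rewrite /Rintegral -integral12_prod_meas1//; congr fine.
apply: eq_integral => x _; rewrite /fubini_F /= fineK//.
exact: (integrable_fin_num measurableT (fxi x)).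
Qed.

(** Here the phase in [gaussian_cf] pays off: for fixed x the inner integral is the one for g with
    phase t (f x) + c. *)
Lemma product_gaussian_cf (f : T1 -> R) (g : T2 -> R) m1 v1 m2 v2 :
  measurable_fun setT f -> measurable_fun setT g ->
  gaussian_cf P1 f m1 v1 -> gaussian_cf P2 g m2 v2 ->
  gaussian_cf (P1 \x P2)%E (fun z => f z.1 + g z.2) (m1 + m2) (v1 + v2).
Proof.
move=> mf mg cf cg t c.
have mcosR : measurable_fun setT (cos : R -> R).
  by apply: continuous_measurable_fun; exact: continuous_cos.
have mz : measurable_fun setT (fun z : T1 * T2 => cos (t * (f z.1 + g z.2) + c)).
  apply: (measurableT_comp mcosR); apply: measurable_funD => //.
  apply: measurable_funM => //; apply: measurable_funD.
    exact: (measurableT_comp mf measurable_fst).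
  exact: (measurableT_comp mg measurable_snd).
rewrite Rintegral_prod; last 2 first.
- by apply: (@integrable_of_bounded _ _ _ (P1 \x P2)%E _ 1) => // z; exact: cos_max.
- move=> x; apply: (@integrable_of_bounded _ _ _ P2 _ 1) => [|y]; last exact: cos_max.
  apply: (measurableT_comp mcosR); apply: measurable_funD => //=.
  by apply: measurable_funM => //; exact: measurable_funD.
transitivity (\int[P1]_x (expR (- (t ^+ 2 * v2 / 2)) * cos (t * f x + (t * m2 + c)))).
  apply: eq_Rintegral => x _ /=; rewrite mulrC.
  transitivity (\int[P2]_y cos (t * g y + (t * f x + c))).
    by apply: eq_Rintegral => y _; congr cos; ring.
  by rewrite cg; congr (cos _ * _); ring.
rewrite RintegralZl//; last first.
  apply: (@integrable_of_bounded _ _ _ P1 _ 1) => [|x]; last exact: cos_max.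
  apply: (measurableT_comp mcosR); apply: measurable_funD => //=.
  exact: measurable_funM.
rewrite cf [LHS]mulrCA -expRD; congr (cos _ * expR _); ring.
Qed.

End product_characteristic.

Section fernique.
Context {R : realType} {E : completeNormedModType R}.
Hypothesis sepE : separable E.
Local Notation rT := (measurableTypeR R).
Implicit Type Q : probability (borel E) R.

Lemma gaussian_dual Q (x' : dual E) : gaussian_measure Q ->
  square_integrable Q x' /\
  gaussian_cf Q x' (\int[Q]_x x' x) (\int[Q]_x (x' x - \int[Q]_x x' x) ^+ 2).
Proof. by move=> gQ; apply: gaussian_facts (dual_borel x') (gQ x'). Qed.

Definition norm_tail Q (t : R) := fine (Q [set x : borel E | t < `|x : E|]).

Lemma measurable_norm_gt t : measurable [set x : borel E | t < `|x : E|].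
Proof.
have := @norm_borel R E measurableT `]t, +oo[%classic (measurable_itv _).
by rewrite setTI; congr measurable; apply/seteqP; split=> x; rewrite /= in_itv/= andbT.
Qed.

Lemma norm_tail_ge0 Q t : 0 <= norm_tail Q t.
Proof. by rewrite fine_ge0. Qed.

Section centered.
Variable Q : probability (borel E) R.
Hypothesis gQ : gaussian_measure Q.
Hypothesis Q0 : forall x' : dual E, \int[Q]_x x' x = 0.
Local Notation Q2 := (Q \x Q)%E.

Let var (x' : dual E) := \int[Q]_x (x' x ^+ 2).

Let centered_cf (x' : dual E) : gaussian_cf Q x' 0 (var x').
Proof.
have [_] := gaussian_dual x' gQ; rewrite Q0.
by under [X in gaussian_cf _ _ _ X -> _]eq_Rintegral do rewrite subr0.
Qed.

Let pair_cf (x' y' : dual E) c :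
  \int[Q2]_z cos (x' z.1 + y' z.2 + c) = cos c * expR (- ((var x' + var y') / 2)).
Proof.
have := product_gaussian_cf (dual_borel x') (dual_borel y') (centered_cf x')
  (centered_cf y') 1 c.
rewrite addr0 mul1r add0r expr1n mul1r => <-.
by apply: eq_Rintegral => z _; rewrite mul1r.
Qed.

Let r : R := (Num.sqrt 2)^-1.

Let r2 : r ^+ 2 = 2^-1.
Proof. by rewrite /r exprVn sqr_sqrtr. Qed.

(** The orthogonal map (x, y) to ((x + y) / sqrt 2, (x - y) / sqrt 2) of pairs, a rotation by 45
    degrees up to a reflection. *)
Let rot (z : borel E * borel E) : borel E * borel E :=
  (r *: ((z.1 : E) + (z.2 : E)), r *: ((z.1 : E) - (z.2 : E))).

Let mfst (x' : dual E) : measurable_fun setT (fun z : borel E * borel E => x' z.1).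
Proof. exact: (measurableT_comp (dual_borel x') measurable_fst). Qed.

Let msnd (x' : dual E) : measurable_fun setT (fun z : borel E * borel E => x' z.2).
Proof. exact: (measurableT_comp (dual_borel x') measurable_snd). Qed.

Let mrot : measurable_fun setT rot.
Proof.
apply: measurable_fun_pair; apply: (borel_measurableP sepE) => x'.
  rewrite (_ : (fun w => _) = (fun z : borel E * borel E => r * (x' z.1 + x' z.2))).
    by apply: measurable_funM => //; apply: measurable_funD; [exact: mfst|exact: msnd].
  by apply/funext => z; rewrite dualZ dualD.
rewrite (_ : (fun w => _) = (fun z : borel E * borel E => r * (x' z.1 - x' z.2))).
  by apply: measurable_funM => //; apply: measurable_funB; [exact: mfst|exact: msnd].
by apply/funext => z; rewrite dualZ dualB.
Qed.

(** A cosine integral under the product depends only on the sum of two variances, which the rotation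
    preserves by the parallelogram identity and 2 r^2 = 1. Centering matters, as a mean (m, m) would
    be moved. *)
Lemma gaussian_rotation A : measurable A -> Q2 (rot @^-1` A) = Q2 A.
Proof.
pose F : {mfun (borel E * borel E)%type >-> (borel E * borel E)%type} :=
  mfun_Sub (mem_set mrot).
pose D := distribution Q2 F.
have imD B : measurable B -> D B = Q2 (rot @^-1` B) by move=> _.
move=> mA; transitivity (D A); first exact/esym/imD.
apply: (@borel_prod_law R E E sepE sepE D Q2 _ A mA) => x' y' c.
have mcos : measurable_fun setT (fun z : borel E * borel E => cos (x' z.1 + y' z.2 + c)).
  apply: measurableT_comp.
    by apply: continuous_measurable_fun; exact: continuous_cos.
  by apply: measurable_funD => //; apply: measurable_funD; [exact: mfst|exact: msnd].
rewrite (Rintegral_image mrot imD mcos); last first.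
  by apply: (@integrable_of_bounded _ _ _ D _ 1) => // z; exact: cos_max.
have [a' a'E] := dual_lin x' y' r r.
have [b' b'E] := dual_lin x' y' r (- r).
transitivity (\int[Q2]_z cos (a' z.1 + b' z.2 + c)).
  apply: eq_Rintegral => z _; rewrite /rot/= !dualZ dualD dualB a'E b'E.
  by congr cos; ring.
suff e : var a' + var b' = var x' + var y' by rewrite [LHS]pair_cf [RHS]pair_cf e.
have [sx _] := gaussian_dual x' gQ; have [sy _] := gaussian_dual y' gQ.
have [sa _] := gaussian_dual a' gQ; have [sb _] := gaussian_dual b' gQ.
rewrite /var -RintegralD//; [|exact: sa.2|exact: sb.2].
rewrite -RintegralD//; [|exact: sx.2|exact: sy.2].
apply: eq_Rintegral => x _; rewrite a'E b'E.
transitivity (2 * r ^+ 2 * (x' x ^+ 2 + y' x ^+ 2)); first by ring.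
by rewrite r2 divff// mul1r.
Qed.

(** Fernique's argument: after the rotation the left-hand event reads |x - y| <= sqrt 2 s and |x +
    y| > sqrt 2 s + 2 t. As |x + y| <= 2 |x| + |x - y|, and likewise for y, both norms exceed t. *)
Lemma gaussian_tail_ineq s t : (1 - norm_tail Q s) * norm_tail Q (s + Num.sqrt 2 * t) <= norm_tail Q t ^+ 2.
Proof.
have ballE u : [set x : borel E | `|x : E| <= u] = ~` [set x : borel E | u < `|x : E|].
  apply/seteqP; split => x /=; first by move=> h; apply/negP; rewrite -leNgt.
  by move/negP; rewrite -leNgt.
have mle u : measurable [set x : borel E | `|x : E| <= u].
  by rewrite ballE; exact: measurableC (measurable_norm_gt _).
have e1 u : (1 - norm_tail Q u)%:E = Q [set x : borel E | `|x : E| <= u].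
  by rewrite ballE (probability_setC _ (measurable_norm_gt _)) EFinB fineK ?fin_num_measure//; exact: measurable_norm_gt.
have e2 u : (norm_tail Q u)%:E = Q [set x : borel E | u < `|x : E|].
  by rewrite fineK ?fin_num_measure//; exact: measurable_norm_gt.
rewrite -lee_fin mulrC EFinM e1 e2 expr2 EFinM !e2.
set B1 := [set x : borel E | s + _ < _]; set B2 := [set x : borel E | _ <= s].
set B3 := [set x : borel E | t < _].
have mB : measurable (B1 `*` B2) by exact: (measurableX (measurable_norm_gt _) (mle _)).
have p1 : (Q B1 * Q B2 = Q2 (B1 `*` B2))%E.
  by rewrite (product_measure1E Q Q (measurable_norm_gt _) (mle _)).
have p2 : (Q B3 * Q B3 = Q2 (B3 `*` B3))%E.
  by rewrite (product_measure1E Q Q (measurable_norm_gt _) (measurable_norm_gt _)).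
rewrite p1 p2 -(gaussian_rotation mB); apply: le_measure; rewrite ?inE.
- by rewrite -[X in measurable X]setTI; exact: mrot.
- exact: (measurableX (measurable_norm_gt _) (measurable_norm_gt _)).
move=> [z1 z2] [/=]; rewrite /B1 /B2 /B3 /= !normrZ.
have sq2 : Num.sqrt 2 = 2 * r :> R.
  have q0 : Num.sqrt 2 != 0 :> R by rewrite gt_eqF// sqrtr_gt0.
  by apply: (mulIf q0); rewrite -expr2 sqr_sqrtr// /r mulfVK.
have r0 : 0 < r by rewrite invr_gt0 sqrtr_gt0.
rewrite sq2 (gtr0_norm r0) => h1 h2.
have k1 : `|(z1 : E) + z2| <= 2 * `|z1 : E| + `|(z1 : E) - z2|.
  have -> : (z1 : E) + z2 = (2 *: (z1 : E)) - (z1 - z2).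
    by rewrite scaler_nat mulr2n opprB addrACA subrr addr0.
  by rewrite (le_trans (ler_normB _ _))// normrZ ger0_norm.
have k2 : `|(z1 : E) + z2| <= 2 * `|z2 : E| + `|(z1 : E) - z2|.
  have -> : (z1 : E) + z2 = (2 *: (z2 : E)) + (z1 - z2).
    by rewrite scaler_nat mulr2n addrACA subrr addr0 addrC.
  by rewrite (le_trans (ler_normD _ _))// normrZ ger0_norm.
move: h1 h2 k1 k2; move: `|(z1 : E) + z2| `|(z1 : E) - z2| `|z1 : E| `|z2 : E|.
move=> a b p q h1 h2 k1 k2; split.
  have : r * a <= r * (2 * p + b) by rewrite ler_pM2l.
  move=> h3; have h4 : r * (2 * t) < r * (2 * p) by lra.
  by move: h4; rewrite ltr_pM2l// ltr_pM2l.
have : r * a <= r * (2 * q + b) by rewrite ler_pM2l.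
move=> h3; have h4 : r * (2 * t) < r * (2 * q) by lra.
by move: h4; rewrite ltr_pM2l// ltr_pM2l.
Qed.

End centered.
End fernique.

Section tail_recursion.
Context {R : realType} {E : completeNormedModType R}.
Variable Q : probability (borel E) R.
Hypothesis ineq : forall s t,
  (1 - norm_tail Q s) * norm_tail Q (s + Num.sqrt 2 * t) <= norm_tail Q t ^+ 2.

(** The value 1/16 starts the induction on tails at 2 (1/16) = 1/8, and s >= 1 makes the levels grow
    at least like n + 1. *)
Let small_tail : exists2 s : R, 1 <= s & norm_tail Q s <= 16^-1.
Proof.
pose B n := [set x : borel E | (n.+1%:R : R) < `|x : E|].
have mB n : measurable (B n) by exact: measurable_norm_gt.
have B0 : \bigcap_n B n = set0.
  apply/seteqP; split=> // x Bx; have := Bx (Num.truncn `|x : E|) I.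
  by rewrite /B/= => /(lt_trans (truncnS_gt _)); rewrite ltxx.
have := @nonincreasing_cvg_mu _ _ _ Q B.
rewrite B0 measure0 => /(_ _ mB measurable0) h.
have {h} h : Q (B n) @[n --> \oo] --> 0%E.
  apply: h; first by rewrite (le_lt_trans (probability_le1 Q (mB 0%N)))// ltry.
  move=> n m nm; rewrite subsetEset => x; rewrite /B/=; apply: le_lt_trans.
  by rewrite ler_nat.
have : fine (Q (B n)) @[n --> \oo] --> (0 : R) by apply: fine_cvg.
move=> /cvgrPdist_le/(_ 16^-1); rewrite invr_gt0 ltr0n => /(_ isT)[n _ /(_ n (leqnn n))].
rewrite sub0r normrN => /ler_normlW h'.
by exists n.+1%:R => //; rewrite ler1n.
Qed.

(** Passing from one level t n to the next nearly squares the tail, which thus falls faster than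
    geometrically. The crude rate 8^-n is enough for second moments, because the squared levels grow
    at most like (25/4)^n and 25/32 < 1. *)
Lemma tail_recursion_integrable : Q.-integrable setT (EFin \o (fun x : borel E => `|x : E| ^+ 2)).
Proof.
have [s s1 gs] := small_tail.
pose q : R := Num.sqrt 2.
have q0 : 0 <= q by exact: sqrtr_ge0.
have qq : q * q = 2 by rewrite -expr2 sqr_sqrtr.
have q1 : 1 <= q by rewrite leNgt; apply/negP => ?; nra.
have q32 : q <= 3 / 2 by rewrite leNgt; apply/negP => ?; nra.
pose t := fix t n : R := if n is m.+1 then s + q * t m else s.
have ts n : s <= t n.
  by case: n => // n /=; elim: n => [|n IH] /=; nra.
have tn n : n.+1%:R <= t n.
  elim: n => [//|n IH]; rewrite -natr1 /=; have := ts n; nra.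
(* From s <= t n and sqrt 2 <= 3/2, a step multiplies the level by at most 1 + 3/2. *)
have tub n : t n <= s * (5 / 2) ^+ n.
  elim: n => [|n IH]; first by rewrite expr0 mulr1.
  rewrite exprS mulrCA /=; have := ts n; nra.
have g0 n : 0 <= norm_tail Q (t n) by exact: norm_tail_ge0.
(* With a = 8^-(n+1) <= 1/8, the inequality gives (15/16) g' <= g^2 <= a^2 / 4, hence 2 g' <= (8/15)
   a^2 <= a / 15 <= a / 8. *)
have g2 n : 2 * norm_tail Q (t n) <= 8^-1 ^+ n.+1.
  elim: n => [|n IH]; first by rewrite expr1 /=; lra.
  have := ineq s (t n); rewrite -/q -/(t n.+1) => h.
  have h8 : (8^-1 : R) ^+ n.+2 = 8^-1 * 8^-1 ^+ n.+1 by rewrite exprS.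
  have a0 : 0 <= (8^-1 : R) ^+ n.+1 by rewrite exprn_ge0.
  have a1 : (8^-1 : R) ^+ n.+1 <= 8^-1.
    have e8 : (8^-1 : R) <= 1 by lra.
    by rewrite exprS ler_piMr// exprn_ile1.
  rewrite h8; have := g0 n.+1; have := g0 n; move: IH h a0 a1 gs.
  move: (8^-1 ^+ n.+1) (norm_tail Q (t n)) (norm_tail Q (t n.+1)) (norm_tail Q s).
  by move=> a g g' gs; nra.
pose f n (x : borel E) : R := Num.min `|x : E| (t n) ^+ 2.
have mmin n : measurable_fun setT (fun x : borel E => Num.min `|x : E| (t n)).
  by apply: measurable_minr => //; exact: norm_borel.
have mf n : measurable_fun setT (f n) by apply: measurable_funX.
have t0 n : 0 <= t n by rewrite (le_trans _ (ts n))// (le_trans _ s1).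
have f0 n x : 0 <= f n x by exact: sqr_ge0.
have min0 n (x : borel E) : 0 <= Num.min `|x : E| (t n) by rewrite le_min normr_ge0 t0.
have fi n : Q.-integrable setT (EFin \o f n).
  apply: (@integrable_of_bounded _ _ _ Q _ (t n ^+ 2)) => // x.
  by rewrite ger0_norm// /f ler_sqr ?nnegrE ?min0 ?t0// ge_min lexx orbT.
(* [rho] is (5/2)^2 / 8, and [D] is the sum of s^2 / 2 * rho^k over k >= 1, since rho / (1 - rho) =
   25/7; [D * rho ^+ n] is what remains of it after n terms. *)
pose rho : R := 25 / 32; pose D := s ^+ 2 / 2 * (25 / 7).
have I n : \int[Q]_x f n x <= (s ^+ 2 + D) - D * rho ^+ n.
  elim: n => [|n IH].
    rewrite expr0 mulr1 addrK -[leRHS](Rintegral_cstP Q); apply: le_Rintegral => //.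
      exact: integrable_cstP.
    move=> x _; rewrite /f ler_sqr ?nnegrE ?min0 ?(t0 0%N)//.
    by rewrite ge_min /= lexx orbT.
  pose A := [set x : borel E | t n < `|x : E|].
  have mA : measurable A by exact: measurable_norm_gt.
  have iA : Q.-integrable setT (EFin \o (fun x => t n.+1 ^+ 2 * \1_A x)).
    apply: integrableZR; apply: (@integrable_of_bounded _ _ _ Q _ 1) => // x.
    by rewrite indicE; case: (_ \in _); rewrite ?normr1 ?normr0.
  (* Raising the truncation level changes the integrand only where the norm exceeds t n. *)
  have h1 : \int[Q]_x f n.+1 x <= \int[Q]_x (f n x + t n.+1 ^+ 2 * \1_A x).
    apply: le_Rintegral => //; first exact: integrableDR.
    move=> x _; rewrite indicE; have [Ax|nAx] := pselect (A x).
      rewrite mem_set// mulr1 (@le_trans _ _ (t n.+1 ^+ 2))//.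
        by rewrite /f ler_sqr ?nnegrE ?min0 ?t0// ge_min lexx orbT.
      by rewrite lerDr.
    rewrite memNset// mulr0 addr0 /f ler_sqr ?nnegrE ?min0//.
    move/negP: nAx; rewrite -leNgt => xt.
    by rewrite ge_min !(min_idPl xt) lexx.
  rewrite (le_trans h1)// RintegralD// RintegralZl//; last first.
    apply: (@integrable_of_bounded _ _ _ Q _ 1) => // x.
    by rewrite indicE; case: (_ \in _); rewrite ?normr1 ?normr0.
  have -> : \int[Q]_x \1_A x = norm_tail Q (t n) by rewrite /Rintegral integral_indic// setIT.
  have h2 : t n.+1 ^+ 2 * norm_tail Q (t n) <= s ^+ 2 / 2 * rho ^+ n.+1.
    have -> : s ^+ 2 / 2 * rho ^+ n.+1 = (s * (5 / 2) ^+ n.+1) ^+ 2 * (2^-1 * 8^-1 ^+ n.+1).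
      have -> : rho = (5 / 2) ^+ 2 * 8^-1 by rewrite /rho; field.
      by rewrite exprMn exprAC; move: ((5 / 2) ^+ n.+1) (8^-1 ^+ n.+1) => a b; field.
    rewrite ler_pM ?sqr_ge0// ?g0//.
      by rewrite ler_sqr ?nnegrE ?t0// ?tub// (le_trans (t0 n.+1)).
    by have := g2 n; lra.
  have -> : s ^+ 2 + D - D * rho ^+ n.+1 = s ^+ 2 + D - D * rho ^+ n + s ^+ 2 / 2 * rho ^+ n.+1.
    by rewrite (exprS rho) /D; move: (rho ^+ n) => a; rewrite /rho; field.
  exact: lerD.
have D0 : 0 <= D by rewrite /D mulr_ge0// divr_ge0// sqr_ge0.
have [||_ //] := @fatou_integrable _ _ _ Q f (fun x => `|x : E| ^+ 2) (s ^+ 2 + D) mf f0.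
  move=> x; apply: cvg_near_cst; exists (Num.truncn `|x : E|) => // n /= xn.
  have xt : `|x : E| <= t n.
    rewrite (le_trans _ (tn n))// (le_trans (ltW (truncnS_gt _)))// ler_nat//.
  by rewrite /f (min_idPl xt).
move=> n; rewrite -[leLHS]fineK; last exact: (integrable_fin_num measurableT (fi n)).
rewrite lee_fin (le_trans (I n))// gerBl mulr_ge0// exprn_ge0// /rho; lra.
Qed.

End tail_recursion.

Section marginals.
Context {d1 d2 : measure_display} {T1 : measurableType d1} {T2 : measurableType d2}.
Context {R : realType} (P1 : probability T1 R) (P2 : probability T2 R).

Lemma product_fst A : measurable A -> P1 A = (P1 \x P2)%E (fst @^-1` A).
Proof.
move=> mA; have -> : fst @^-1` A = A `*` [set: T2].
  by apply/seteqP; split=> z /=; [|case].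
have e : P2 [set: T2] = 1%E := probability_setT P2.
by rewrite product_measure1E// [X in (_ * X)%E]e mule1.
Qed.

Lemma product_snd A : measurable A -> P2 A = (P1 \x P2)%E (snd @^-1` A).
Proof.
move=> mA; have -> : snd @^-1` A = [set: T1] `*` A.
  by apply/seteqP; split=> z /=; [|case].
have e : P1 [set: T1] = 1%E := probability_setT P1.
by rewrite product_measure1E// [X in (X * _)%E]e mul1e.
Qed.

End marginals.

Lemma gaussian_cfN {d : measure_display} {T : measurableType d} {R : realType}
    (P : probability T R) (f : T -> R) m v :
  gaussian_cf P f m v -> gaussian_cf P (fun x => - f x) (- m) v.
Proof.
move=> cf t c; have := cf (- t) c; rewrite sqrrN mulNr -mulrN => <-.
by apply: eq_Rintegral => x _; rewrite mulNr mulrN.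
Qed.

Section second_moment.
Context {R : realType} {E : completeNormedModType R}.
Hypothesis sepE : separable E.

Lemma measurable_sub_prod : measurable_fun setT
  (fun z : borel E * borel E => (z.1 : E) - (z.2 : E) : borel E).
Proof.
apply: (borel_measurableP sepE) => x'.
rewrite (_ : (fun w => _) = (fun z : borel E * borel E => x' z.1 - x' z.2)).
  apply: measurable_funB; first exact: (measurableT_comp (dual_borel x') measurable_fst).
  exact: (measurableT_comp (dual_borel x') measurable_snd).
by apply/funext => z; rewrite dualB.
Qed.

(* Replacing x by the difference of two independent copies reduces to the
   centered case. *)
Lemma fernique (Q : probability (borel E) R) : gaussian_measure Q ->
  Q.-integrable setT (EFin \o (fun x : borel E => `|x : E| ^+ 2)).
Proof.
move=> gQ.
pose phi (z : borel E * borel E) : borel E := (z.1 : E) - (z.2 : E).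
have mphi : measurable_fun setT phi by exact: measurable_sub_prod.
pose F : {mfun (borel E * borel E)%type >-> borel E} := mfun_Sub (mem_set mphi).
pose D := distribution (Q \x Q)%E F.
have imD (A : set (borel E)) : measurable A -> D A = (Q \x Q)%E (phi @^-1` A) by move=> _.
have Dx (x' : dual E) : (Q \x Q)%E.-integrable setT (EFin \o (fun z : borel E * borel E => x' z.1)) /\
    (Q \x Q)%E.-integrable setT (EFin \o (fun z : borel E * borel E => x' z.2)).
  have [sx _] := gaussian_dual x' gQ; have ix := square_integrable_integrable sx.
  split.
    exact: ((integrable_image measurable_fst (@product_fst _ _ _ _ _ Q Q) sx.1).1 ix).
  exact: ((integrable_image measurable_snd (@product_snd _ _ _ _ _ Q Q) sx.1).1 ix).
have gD : gaussian_measure D.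
  move=> x'; have [sx cx] := gaussian_dual x' gQ.
  set m := \int[Q]_x x' x in cx *; set v := \int[Q]_x _ in cx *.
  apply: (@gaussian_of_cf _ _ _ D x' (m - m) (v + v)); first exact: dual_borel.
    by rewrite addr_ge0//; apply: Rintegral_ge0 => x _; exact: sqr_ge0.
  move=> t c.
  have mN : measurable_fun setT (fun x : borel E => - x' x).
    by apply: measurableT_comp => //; exact: dual_borel.
  rewrite -(product_gaussian_cf sx.1 mN cx (gaussian_cfN cx)).
  have mc : measurable_fun setT (fun x : borel E => cos (t * x' x + c)).
    apply: measurableT_comp.
      by apply: continuous_measurable_fun; exact: continuous_cos.
    by apply: measurable_funD => //; apply: measurable_funM => //; exact: dual_borel.
  rewrite (Rintegral_image mphi imD mc); last first.
    by apply: (@integrable_of_bounded _ _ _ D _ 1) => // x; exact: cos_max.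
  by apply: eq_Rintegral => z _; rewrite /phi dualB.
have D0 (x' : dual E) : \int[D]_x x' x = 0.
  have [sD _] := gaussian_dual x' gD.
  rewrite (Rintegral_image mphi imD (dual_borel x') (square_integrable_integrable sD)).
  have [i1 i2] := Dx x'.
  transitivity (\int[(Q \x Q)%E]_z (x' z.1 - x' z.2)).
    by apply: eq_Rintegral => z _; rewrite /phi dualB.
  rewrite RintegralB//; have [sx _] := gaussian_dual x' gQ.
  have ix := square_integrable_integrable sx.
  rewrite -(Rintegral_image measurable_fst (@product_fst _ _ _ _ _ Q Q) sx.1 ix).
  by rewrite -(Rintegral_image measurable_snd (@product_snd _ _ _ _ _ Q Q) sx.1 ix) subrr.
have msq : measurable_fun setT (fun x : borel E => `|x : E| ^+ 2).
  by apply: measurable_funX; exact: norm_borel.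
have := tail_recursion_integrable (gaussian_tail_ineq sepE gD D0).
move/(integrable_image mphi imD msq).1.
move=> /integrableP[mz]; rewrite fubini_tonelli1//; last exact: measurableT_comp.
move=> fin.
(* By Tonelli the double integral of |a - x|^2 is finite, so the inner one cannot be infinite for
   every a; then |x|^2 <= 2 |a - x|^2 + 2 |a|^2. *)
have [a fina] : exists a : borel E, (\int[Q]_x `|(`|(a : E) - (x : E)| ^+ 2)%:E| < +oo)%E.
  apply/not_existsP => h; move: fin; rewrite (eq_integral (cst +oo%E)).
    have eQ : Q [set: borel E] = 1%E := probability_setT Q.
    by rewrite integral_cst// [X in (_ * X)%E]eQ mule1 ltxx.
  move=> a _; apply/eqP; rewrite -leye_eq leNgt; apply/negP; exact: h.
have ia : Q.-integrable setT (EFin \o (fun x : borel E => `|(a : E) - (x : E)| ^+ 2)).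
  apply/integrableP; split => //; apply/measurable_EFinP; apply: measurable_funX.
  apply: (measurableT_comp (@norm_borel R E)); apply: (borel_measurableP sepE) => x'.
  under eq_fun do rewrite dualB; apply: measurable_funB => //; exact: dual_borel.
apply: (@integrable_le _ _ _ Q _ (fun x : borel E => 2 * `|(a : E) - (x : E)| ^+ 2 + 2 * `|a : E| ^+ 2)) => //.
  by apply: integrableDR; [exact: integrableZR|exact: integrable_cstP].
move=> x; rewrite ger0_norm ?sqr_ge0//.
have : `|x : E| <= `|(a : E) - (x : E)| + `|a : E|.
  by rewrite distrC -{1}(subrK (a : E) (x : E)) ler_normD.
have := normr_ge0 (x : E); move: `|x : E| `|(a : E) - (x : E)| `|a : E| => p q r p0 pqr.
have h1 : p ^+ 2 <= (q + r) ^+ 2 by rewrite ler_sqr ?nnegrE// (le_trans p0).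
by have h2 := sqr_ge0 (q - r); rewrite !expr2 in h1 h2 *; lra.
Qed.

End second_moment.

(** * Bochner integral *)

Section borel_functions.
Context {R : realType} {E : normedModType R}.
Hypothesis sepE : separable E.
Context {d : measure_display} {T : measurableType d}.
Implicit Types f g : T -> E.

Lemma borel_fun_dual f (x' : dual E) :
  borel_fun setT f -> measurable_fun setT (fun w => x' (f w)).
Proof. exact: borel_measurable_dual. Qed.

Lemma borel_fun_norm f : borel_fun setT f -> measurable_fun setT (fun w => `|f w|).
Proof. by move=> mf; exact: (measurableT_comp (@norm_borel R E) mf). Qed.

Lemma borel_funB f g : borel_fun setT f -> borel_fun setT g ->
  borel_fun setT (fun w => f w - g w).
Proof.
move=> mf mg; apply: (borel_measurableP sepE) => x'.
under eq_fun do rewrite dualB.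
by apply: measurable_funB; exact: borel_fun_dual.
Qed.

Lemma borel_funD f g : borel_fun setT f -> borel_fun setT g ->
  borel_fun setT (fun w => f w + g w).
Proof.
move=> mf mg; apply: (borel_measurableP sepE) => x'.
under eq_fun do rewrite dualD.
by apply: measurable_funD; exact: borel_fun_dual.
Qed.

Lemma borel_funZ (a : T -> R) f : measurable_fun setT a -> borel_fun setT f ->
  borel_fun setT (fun w => a w *: f w).
Proof.
move=> ma mf; apply: (borel_measurableP sepE) => x'.
under eq_fun do rewrite dualZ.
by apply: measurable_funM => //; exact: borel_fun_dual.
Qed.

Lemma borel_set1 (v : E) : measurable ([set v] : set (borel E)).
Proof.
have c : continuous (fun x : E => `|x - v|).
  move=> x; apply: cvg_norm; apply: cvgB; [exact: cvg_id|exact: cvg_cst].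
have := continuous_borel c measurableT (measurable_set1 0); rewrite setTI.
congr measurable; apply/seteqP; split=> x /=; last by move->; rewrite subrr normr0.
by move/eqP; rewrite normr_eq0 subr_eq0 => /eqP.
Qed.

End borel_functions.

Section simple_approximation.
Context {R : realType} {E : normedModType R}.
Hypothesis sepE : separable E.
Context {d : measure_display} {T : measurableType d} (P : probability T R).
Implicit Types f : T -> E.

(* The n-th approximation picks the nearest of the first n points of a dense
   sequence, starting from 0. *)
Lemma bochner_approx_of_norm f : borel_fun setT f ->
  P.-integrable setT (EFin \o (fun w => `|f w|)) -> exists s, bochner_approx P setT f s.
Proof.
move=> mf intf; have [e de] := dense_seq sepE.
pose s := fix s n w : E := if n is m.+1
  then (if `|f w - e m| < `|f w - s m w| then e m else s m w) else 0.
have ss n : simple (s n).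
  elim: n => [|n [ms fs]]; first split; first exact: measurable_cst.
    by apply: (@sub_finite_set _ _ [set 0]) => // _ [w _ <-].
  split.
    apply: measurable_fun_ifT => //.
    apply: measurable_fun_ltr; apply: borel_fun_norm => //; apply: borel_funB => //.
    exact: measurable_cst.
  apply: (@sub_finite_set _ _ (range (s n) `|` [set e n])).
    by move=> _ [w _ <-] /=; case: ifP => _; [right|left; exists w].
  by rewrite finite_setU.
exists s; split=> //.
(* Starting from 0 pays off here: |f| itself dominates all errors. *)
have sle n w : `|f w - s n w| <= `|f w|.
  elim: n => [|n IH] /=; first by rewrite subr0.
  by case: ifP => // /ltW/le_trans; exact.
have snd w : {homo (fun n => `|f w - s n w|) : n m / (n <= m)%N >-> m <= n}.
  by apply/nonincreasing_seqP => n /=; case: ifP => // /ltW.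
have scvg w : `|f w - s n w| @[n --> \oo] --> (0 : R).
  apply/cvgrPdist_lt => r r0; have [n fn] := de (f w) r r0.
  exists n.+1 => // m /= nm; rewrite sub0r normrN normr_id.
  rewrite (le_lt_trans (snd w _ _ nm))//= (le_lt_trans _ fn)//.
  by case: ifP => // /negbT; rewrite -leNgt.
have msn n : measurable_fun setT (fun w => `|f w - s n w|).
  by apply: borel_fun_norm; apply: borel_funB => //; exact: (ss n).1.
have := @dominated_cvg _ _ _ P _ measurableT (fun n w => (`|f w - s n w|)%:E) (cst 0%E)
  (EFin \o (fun w => `|f w|)).
rewrite integral0; apply => //.
- by move=> n; exact/measurable_EFinP.
- by move=> w _; apply: cvg_EFin; [exact: nearW|exact: scvg].
- by move=> n w _; rewrite /= lee_fin normr_id.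
Qed.

End simple_approximation.

Section bochner_integral.
Context {R : realType} {E : completeNormedModType R}.
Hypothesis sepE : separable E.
Context {d : measure_display} {T : measurableType d} (P : probability T R).
Variables (D : set T) (f : T -> E).
Hypothesis mD : measurable D.
Hypothesis mf : borel_fun setT f.

Lemma simple_integral_dual (s : T -> E) (x' : dual E) : simple s ->
  P.-integrable D (EFin \o (fun w => x' (s w))) /\
  x' (simple_integral P D s) = \int[P]_(w in D) x' (s w).
Proof.
move=> [ms fs]; rewrite /simple_integral.
have mpre v : measurable (s @^-1` [set v]).
  by rewrite -[X in measurable X]setTI; apply: ms => //; exact: borel_set1.
rewrite fsbig_finite//= raddf_sum/=.
pose r0 := finmap.enum_fset (fset_set (range s)).
have sE w : x' (s w) = \sum_(v <- r0) x' v * \1_(s @^-1` [set v]) w.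
  have sr : s w \in r0 by apply: etrans (in_fset_set fs (s w)) _; apply: mem_set; exists w.
  rewrite (bigD1_seq (s w) sr (finmap.fset_uniq _))/=.
  rewrite indicE mem_set// mulr1 big1 ?addr0// => v vs.
  by rewrite indicE memNset ?mulr0// => /= e; rewrite -e eqxx in vs.
have iv v : P.-integrable D (EFin \o (fun w => x' v * \1_(s @^-1` [set v]) w)).
  apply: (@integrableS _ _ _ _ setT) => //; apply: integrableZR.
  apply: (@integrable_of_bounded _ _ _ P _ 1) => // w.
  by rewrite indicE; case: (_ \in _); rewrite ?normr1 ?normr0.
have i1 v : P.-integrable D (EFin \o \1_(s @^-1` [set v])).
  apply: (@integrableS _ _ _ _ setT) => //.
  apply: (@integrable_of_bounded _ _ _ P _ 1) => // w.
  by rewrite indicE; case: (_ \in _); rewrite ?normr1 ?normr0.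
have key (r : seq E) : P.-integrable D (EFin \o (fun w => \sum_(v <- r) x' v * \1_(s @^-1` [set v]) w)) /\
    \int[P]_(w in D) (\sum_(v <- r) x' v * \1_(s @^-1` [set v]) w) =
    \sum_(v <- r) x' (fine (P (D `&` s @^-1` [set v])) *: v).
  elim: r => [|v r [IH1 IH2]].
    split; first by under eq_fun do rewrite big_nil; exact: integrable0.
    rewrite big_nil; under eq_Rintegral do rewrite big_nil.
    by rewrite Rintegral_cst// mul0r.
  have dec : (fun w => \sum_(u <- v :: r) x' u * \1_(s @^-1` [set u]) w) =
      (fun w => x' v * \1_(s @^-1` [set v]) w + \sum_(u <- r) x' u * \1_(s @^-1` [set u]) w).
    by apply/funext => w; rewrite big_cons.
  rewrite dec; split; first exact: (@integrableD _ _ _ P _ mD _ _ (iv v) IH1).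
  rewrite RintegralD// IH2 big_cons RintegralZl//; congr (_ + _).
  by rewrite /Rintegral integral_indic// setIC dualZ mulrC.
have [k1 k2] := key r0.
have -> : (fun w => x' (s w)) = (fun w => \sum_(v <- r0) x' v * \1_(s @^-1` [set v]) w).
  exact/funext.
by split => //; rewrite k2.
Qed.

(** Convergence to 0 in the extended reals makes the errors finite only from some rank on, whence
    the [fin_num] premise. The constant C is explicit so that it can be 1 for all norming
    functionals at once. *)
Lemma bochner_approx_dual (s : nat -> T -> E) (x' : dual E) C :
  bochner_approx P D f s -> 0 <= C -> (forall x, `|x' x| <= C * `|x|) ->
  P.-integrable D (EFin \o (fun w => x' (f w))) /\
  forall n, (\int[P]_(w in D) (`|f w - s n w|)%:E)%E \is a fin_num ->
    `|x' (simple_integral P D (s n)) - \int[P]_(w in D) x' (f w)| <=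
    C * fine (\int[P]_(w in D) (`|f w - s n w|)%:E)%E.
Proof.
move=> [ss sf] C0 x'C; have /fine_cvgP[fin _] := sf.
have mfs n : measurable_fun setT (fun w => `|f w - s n w|).
  by apply: borel_fun_norm; apply: borel_funB => //; exact: (ss n).1.
have ifs n : (\int[P]_(w in D) (`|f w - s n w|)%:E)%E \is a fin_num ->
    P.-integrable D (EFin \o (fun w => `|f w - s n w|)).
  move=> fn; apply/integrableP; split; first exact/measurable_EFinP/measurable_funTS.
  under eq_integral do rewrite /= normr_id.
  by rewrite ltey_eq fn.
have idiff n : (\int[P]_(w in D) (`|f w - s n w|)%:E)%E \is a fin_num ->
    P.-integrable D (EFin \o (fun w => x' (f w - s n w))).
  move=> fn; apply: (@le_integrable _ _ _ P _ mD _ (EFin \o (fun w => C * `|f w - s n w|))).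
  - apply/measurable_EFinP/measurable_funTS; apply: borel_fun_dual.
    by apply: borel_funB => //; exact: (ss n).1.
  - by move=> w _; rewrite /= lee_fin (le_trans (x'C _))// ler_norm.
  - exact: (@integrableZl _ _ _ P _ mD C _ (ifs n fn)).
have dec n : (fun w => x' (f w)) = (fun w => x' (f w - s n w) + x' (s n w)).
  by apply/funext => w; rewrite dualB subrK.
have fx : P.-integrable D (EFin \o (fun w => x' (f w))).
  have [n _ /(_ n (leqnn n)) fn] := fin; rewrite (dec n).
  exact: (@integrableD _ _ _ P _ mD _ _ (idiff n fn) (simple_integral_dual x' (ss n)).1).
split=> // n fn.
have [isn ->] := simple_integral_dual x' (ss n).
rewrite distrC -RintegralB//.
under eq_Rintegral do rewrite -dualB.
rewrite (le_trans (le_normr_Rintegral mD (idiff n fn)))//.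
rewrite -RintegralZl//; last exact: ifs.
apply: le_Rintegral => //.
- apply: (@le_integrable _ _ _ P _ mD _ _ _ _ (idiff n fn)) => //.
    apply/measurable_EFinP/measurable_funTS; apply: measurableT_comp => //.
    by apply: borel_fun_dual; apply: borel_funB => //; exact: (ss n).1.
  by move=> w _; rewrite /= lee_fin normr_id.
- exact: (@integrableZl _ _ _ P _ mD C _ (ifs n fn)).
Qed.

Lemma bochner_approx_cvg (s : nat -> T -> E) (x' : dual E) :
  bochner_approx P D f s ->
  x' (simple_integral P D (s n)) @[n --> \oo] --> \int[P]_(w in D) x' (f w).
Proof.
move=> ap; have [C C0 x'C] := dual_bound x'.
have [_ Cn] := bochner_approx_dual ap (ltW C0) x'C.
have /fine_cvgP[fin c0] := ap.2.
have c1 : C * fine (\int[P]_(w in D) (`|f w - s n w|)%:E)%E @[n --> \oo] --> (0 : R).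
  by rewrite -(mulr0 C); apply: cvgM; [exact: cvg_cst|exact: c0].
apply/cvgrPdist_le => e e0; have /cvgrPdist_le/(_ e e0) c2 := c1.
near=> n; rewrite distrC.
have fn : (\int[P]_(w in D) (`|f w - s n w|)%:E)%E \is a fin_num by near: n.
rewrite (le_trans (Cn n fn))// (le_trans (ler_norm _))//.
by rewrite -normrN -sub0r; near: n.
Unshelve. all: end_near. Qed.

(** The value of [bochner] is a limit as soon as one exists, which completeness of E ensures. The
    chosen limit may come from another approximating sequence, but under x' all of them tend to the
    same real integral. *)
Lemma bochner_dual (s : nat -> T -> E) (x' : dual E) : bochner_approx P D f s ->
  x' (bochner P D f) = \int[P]_(w in D) x' (f w).
Proof.
move=> ap.
pose S : set E := [set v | exists s : nat -> T -> E, bochner_approx P D f s /\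
                         simple_integral P D (s n) @[n --> \oo] --> v].
suff [v Sv] : S !=set0.
  have [s' [ap' cv]] : S (bochner P D f) by apply: getPex; exists v.
  have c1 := bochner_approx_cvg (x' := x') ap'.
  have c2 : x' (simple_integral P D (s' n)) @[n --> \oo] --> x' (bochner P D f).
    by apply: (continuous_cvg _ (@dual_continuous _ _ x' _) cv).
  exact: (cvg_unique _ c2 c1).
have /fine_cvgP[fin c0] := ap.2.
suff : cvgn (fun n => simple_integral P D (s n)) by move=> c; eexists; exists s; split=> //; exact: c.
apply/cauchy_cvgP; apply: cauchy_exP => e e0.
have [N _ NP] : \forall n \near \oo, (\int[P]_(w in D) (`|f w - s n w|)%:E)%E \is a fin_num /\
    fine (\int[P]_(w in D) (`|f w - s n w|)%:E)%E < e / 2.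
  have e20 : 0 < e / 2 by rewrite divr_gt0.
  have /cvgrPdist_lt/(_ _ e20) c2 := c0.
  near=> n; split; first by near: n.
  rewrite (le_lt_trans (ler_norm _))// -normrN -sub0r.
  by near: n.
exists (simple_integral P D (s N)); exists N => // n /= Nn.
rewrite -ball_normE /=.
(* The norm of the difference is its value under a functional of norm at most 1, which reduces the
   Cauchy estimate to real integrals. *)
have [y' [<- y'1]] := norming_functional (simple_integral P D (s N) - simple_integral P D (s n)).
have y'C x : `|y' x| <= 1 * `|x| by rewrite mul1r.
have [_ Cn] := bochner_approx_dual ap ler01 y'C.
have [f1 h1] := NP N (leqnn N); have [f2 h2] := NP n Nn.
have := Cn N f1; have := Cn n f2; rewrite !mul1r dualB.
move: h1 h2; set a := fine _; set b := fine _; set I := Rintegral _ _ _.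
by rewrite !ler_norml => h1 h2 /andP[k1 k2] /andP[k3 k4]; lra.
Unshelve. all: end_near. Qed.

End bochner_integral.

Section bochner_corollaries.
Context {R : realType} {E : completeNormedModType R}.
Hypothesis sepE : separable E.
Context {d : measure_display} {T : measurableType d} (P : probability T R).
Implicit Types (D : set T) (f : T -> E).

Lemma bochner_approxS D f s : measurable D -> borel_fun setT f ->
  bochner_approx P setT f s -> bochner_approx P D f s.
Proof.
move=> mD mf [ss sf]; split=> //.
have mfs n : measurable_fun setT (fun w => (`|f w - s n w|)%:E).
  apply/measurable_EFinP; apply: borel_fun_norm; apply: borel_funB => //.
  exact: (ss n).1.
apply: (squeeze_cvge _ (@cvg_cst _ _ _ _ _) sf).
apply: nearW => n; rewrite integral_ge0//=; apply: ge0_subset_integral => //.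
Qed.

Lemma bochner_integrable_of_norm f : borel_fun setT f ->
  P.-integrable setT (EFin \o (fun w => `|f w|)) -> bochner_integrable P setT f.
Proof. by move=> mf fi; split=> //; exact: bochner_approx_of_norm. Qed.

Lemma bochner_integrable_dual f (x' : dual E) : bochner_integrable P setT f ->
  P.-integrable setT (EFin \o (fun w => x' (f w))).
Proof.
move=> [mf [s ap]]; have [C C0 x'C] := dual_bound x'.
exact: (bochner_approx_dual sepE measurableT mf ap (ltW C0) x'C).1.
Qed.

Lemma bochner_integrableE D f (x' : dual E) : measurable D -> bochner_integrable P setT f ->
  x' (bochner P D f) = \int[P]_(w in D) x' (f w).
Proof.
by move=> mD [mf [s ap]]; apply: (bochner_dual sepE) => //; exact: bochner_approxS ap.
Qed.

End bochner_corollaries.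

(** * Regression on affine functionals *)

Section cosine_lipschitz.
Context {R : realType}.

Lemma cos_lipschitz (x y : R) : `|cos x - cos y| <= `|x - y|.
Proof.
wlog xy : x y / x < y => [wl|].
  have [xy|yx|->] := ltgtP x y; first exact: wl.
    by rewrite distrC (distrC x); exact: wl.
  by rewrite !subrr.
have d (z : R) : z \in `]x, y[ -> is_derive z 1 (cos : R -> R) (- sin z).
  by move=> _; exact: is_derive_cos.
have c : {within `[x, y], continuous (cos : R -> R)}.
  by apply: continuous_subspaceT => z; exact: continuous_cos.
have [z _] := MVT xy d c.
rewrite distrC => ->; rewrite normrM normrN (distrC x) ler_piMl//; exact: sin_max.
Qed.

End cosine_lipschitz.

Section l1_completeness.
Context {d : measure_display} {T : measurableType d} {R : realType}.
Variable P : probability T R.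

(** The increments are summable almost everywhere because the integral of their sum is at most 2 C;
    Fatou then bounds the distance to the limit. *)
Lemma fast_cauchy_l1 (h : nat -> T -> R) C :
  (forall n, measurable_fun setT (h n)) -> (forall n, P.-integrable setT (EFin \o h n)) ->
  (forall n, \int[P]_x `|h n.+1 x - h n x| <= C * 2^-1 ^+ n) ->
  exists g : T -> R, [/\ measurable_fun setT g, P.-integrable setT (EFin \o g) &
    forall n, \int[P]_x `|g x - h n x| <= C * 2 * 2^-1 ^+ n].
Proof.
move=> mh ih hC.
have C0 : 0 <= C.
  have := hC 0%N; rewrite expr0 mulr1; apply: le_trans.
  by apply: Rintegral_ge0 => x _.
pose D n x := `|h n.+1 x - h n x|.
have mD n : measurable_fun setT (D n).
  by apply: measurableT_comp => //; exact: measurable_funB.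
have iB n m : P.-integrable setT (EFin \o (fun x => h n x - h m x)).
  exact: (@integrableB _ _ _ P _ measurableT _ _ (ih n) (ih m)).
have mB n m : measurable_fun setT (fun x => `|h n x - h m x|).
  by apply: measurableT_comp => //; exact: measurable_funB.
have iN n m : P.-integrable setT (EFin \o (fun x => `|h n x - h m x|)).
  apply: (@le_integrable _ _ _ P _ measurableT _ _ _ _ (iB n m)).
    exact/measurable_EFinP.
  by move=> x _; rewrite /= lee_fin normr_id.
(* The factor 1 - 2^-m is that of the partial geometric sum; keeping it is what lets the induction
   on m close. *)
have tri n m : \int[P]_x `|h (n + m)%N x - h n x| <= C * 2 * 2^-1 ^+ n * (1 - 2^-1 ^+ m).
  elim: m => [|m IH].
    rewrite expr0 subrr mulr0 addn0; under eq_Rintegral do rewrite subrr normr0.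
    by rewrite Rintegral_cstP.
  apply: (@le_trans _ _ (\int[P]_x (`|h (n + m).+1 x - h (n + m)%N x| + `|h (n + m)%N x - h n x|))).
    rewrite addnS; apply: le_Rintegral => //; first exact: integrableDR.
    by move=> x _; rewrite (le_trans _ (ler_normD _ _))// addrA subrK.
  rewrite RintegralD// (le_trans (lerD (hC _) IH))//.
  rewrite exprD exprS; move: (2^-1 ^+ n) (2^-1 ^+ m) => a b.
  have -> : C * (a * b) + C * 2 * a * (1 - b) = C * 2 * a * (1 - 2^-1 * b) by field.
  exact: lexx.
have D0 n x : (0 <= (D n x)%:E)%E by rewrite lee_fin /D.
pose S x := (\sum_(0 <= n <oo) (D n x)%:E)%E.
have S0 x : (0 <= S x)%E by apply: nneseries_ge0.
have mED n : measurable_fun setT (fun x => (D n x)%:E) by exact/measurable_EFinP.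
have mS : measurable_fun setT S.
  by apply: ge0_emeasurable_sum.
have intS : (\int[P]_x S x <= (C * 2)%:E)%E.
  rewrite integral_nneseries//.
  apply: lime_le; first by apply: is_cvg_nneseries => n _ _; apply: integral_ge0.
  apply: nearW => n; suff : (\sum_(0 <= k < n) \int[P]_x (D k x)%:E <= (C * 2 * (1 - 2^-1 ^+ n))%:E)%E.
    by move/le_trans; apply; rewrite lee_fin ler_piMr ?mulr_ge0// gerBl exprn_ge0.
  elim: n => [|n IH]; first by rewrite big_nil expr0 subrr mulr0.
  rewrite big_nat_recr//= (_ : (C * 2 * _)%:E = (C * 2 * (1 - 2^-1 ^+ n))%:E + (C * 2^-1 ^+ n)%:E)%E.
    apply: leeD => //; rewrite -[leLHS]fineK; last exact: (integrable_fin_num measurableT (iN _ _)).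
    by rewrite lee_fin; exact: hC.
  by rewrite -EFinD exprS; congr EFin; move: (2^-1 ^+ n) => a; field.
have iS : P.-integrable setT S.
  apply/integrableP; split => //.
  under eq_integral do rewrite gee0_abs//.
  exact: le_lt_trans intS (ltry _).
(* Setting all functions to 0 on a measurable null set makes the sequence converge everywhere, so
   that its limit is measurable. *)
have [N [mN N0 SN]] := integrable_ae measurableT iS.
pose A := ~` N.
have mA : measurable A by exact: measurableC.
have Sfin x : A x -> S x \is a fin_num.
  by move=> Ax; apply/negPn/negP => h'; apply: Ax; apply: SN => /= /(_ I); exact/negP.
pose k n x := h n x * \1_A x.
have mk n : measurable_fun setT (k n) by apply: measurable_funM.
have kE n x : A x -> k n x = h n x by move=> Ax; rewrite /k indicE mem_set// mulr1.
have kE0 n x : ~ A x -> k n x = 0 by move=> Ax; rewrite /k indicE memNset// mulr0.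
have kcvg x : cvgn (fun n => k n x).
  have [Ax|nAx] := pselect (A x); last first.
    by under eq_fun do rewrite kE0//; exact: is_cvg_cst.
  under eq_fun do rewrite kE//.
  have c1 : cvgn (series (fun n => h n.+1 x - h n x)).
    apply: (@normed_cvg R R^o).
    have -> : [normed series (fun n => h n.+1 x - h n x)] =
        (fun n => \sum_(0 <= i < n) D i x) by apply/funext => n; rewrite /series/=.
    apply: nondecreasing_is_cvgn.
      by apply: nondecreasing_series => n _ _; rewrite -lee_fin; exact: D0.
    exists (fine (S x)) => _ [n _ <-]; rewrite -lee_fin fineK ?Sfin//.
    by rewrite -sumEFin; apply: nneseries_lim_ge => m _ _; exact: D0.
  have c2 : cvgn (fun n => series (fun n => h n.+1 x - h n x) n + h 0%N x).
    by apply: is_cvgD => //; exact: is_cvg_cst.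
  have e : (fun n => series (fun n => h n.+1 x - h n x) n + h 0%N x) = (fun n => h n x).
    by apply/funext => n; rewrite seriesEnat/= telescope_sumr// subrK.
  by rewrite e in c2.
pose g x := limn (fun n => k n x).
have gk : forall y, k n y @[n --> \oo] --> g y by move=> y; exact: (kcvg y).
have mg : measurable_fun setT g.
  exact: (@measurable_fun_cvg _ _ _ setT k g mk (fun x _ => gk x)).
have ik n : P.-integrable setT (EFin \o k n).
  apply: (@le_integrable _ _ _ P _ measurableT _ _ _ _ (ih n)).
    exact/measurable_EFinP.
  move=> x _; rewrite /= lee_fin; have [Ax|nAx] := pselect (A x); first by rewrite kE.
  by rewrite kE0// normr0.
have est n : (\int[P]_x `|g x - k n x|%:E <= (C * 2 * 2^-1 ^+ n)%:E)%E /\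
    P.-integrable setT (EFin \o (fun x => `|g x - k n x|)).
  apply: (@fatou_integrable _ _ _ P (fun m x => `|k (n + m)%N x - k n x|)).
  - by move=> m; apply: measurableT_comp => //; exact: measurable_funB.
  - by move=> m x.
  - move=> x; apply: cvg_norm; apply: cvgB; last exact: cvg_cst.
    have := gk x; rewrite -(cvg_shiftn n (fun m => k m x)).
    by under eq_fun do rewrite addnC.
  - move=> m; apply: (@le_trans _ _ (\int[P]_x `|h (n + m)%N x - h n x|%:E)%E).
      have mkB : measurable_fun setT (fun x => `|k (n + m)%N x - k n x|).
        by apply: measurableT_comp => //; exact: measurable_funB.
      apply: ge0_le_integral => //.
      + exact/measurable_EFinP.
      + exact/measurable_EFinP.
      + move=> x _; rewrite lee_fin; have [Ax|nAx] := pselect (A x); first by rewrite !kE.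
        by rewrite !kE0// subr0 normr0.
    rewrite -[leLHS]fineK; last exact: (integrable_fin_num measurableT (iN _ _)).
    have hp : 0 <= C * 2 * 2^-1 ^+ n by rewrite !mulr_ge0// exprn_ge0.
    by rewrite lee_fin (le_trans (tri n m))// ler_piMr// gerBl exprn_ge0.
exists g; split => //.
  apply: (@integrable_le _ _ _ P _ (fun x => `|g x - k 0%N x| + `|k 0%N x|)) => //.
    apply: integrableDR; first exact: (est 0%N).2.
    apply: (@le_integrable _ _ _ P _ measurableT _ _ _ _ (ik 0%N)).
      by apply/measurable_EFinP; apply: measurableT_comp.
    by move=> x _; rewrite /= lee_fin normr_id.
  by move=> x; rewrite -{1}(subrK (k 0%N x) (g x)) ler_normD.
move=> n; have [e1 e2] := est n.
have -> : \int[P]_x `|g x - h n x| = \int[P]_x `|g x - k n x|.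
  rewrite /Rintegral; congr fine; apply: ae_eq_integral => //.
  - by apply/measurable_EFinP; apply: measurableT_comp => //; exact: measurable_funB.
  - exact: measurable_int e2.
  - exists N; split => // x /= Nx; apply/not_notP => Ax; apply: Nx => _.
    by rewrite kE.
by rewrite -lee_fin fineK//; exact: (integrable_fin_num measurableT e2).
Qed.

End l1_completeness.

Lemma cvg_geometric_bound (R : realType) (u : nat -> R) (l C : R) :
  (forall n, `|u n - l| <= C * 2^-1 ^+ n) -> u n @[n --> \oo] --> l.
Proof.
move=> uC; have c : C * 2^-1 ^+ n @[n --> \oo] --> (0 : R).
  by apply: cvg_geometric; rewrite ger0_norm ?invf_lt1 ?ltr1n.
apply/cvgrPdist_le => e e0; have /cvgrPdist_le/(_ e e0) c' := c.
near=> n; rewrite distrC (le_trans (uC n))// (le_trans (ler_norm _))//.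
by rewrite -normrN -sub0r; near: n.
Unshelve. all: end_near. Qed.

Section second_moments.
Context {d : measure_display} {T : measurableType d} {R : realType}.
Variable P : probability T R.
Implicit Types u v : T -> R.

Lemma Rintegral_sqr_lin u v a b : square_integrable P u -> square_integrable P v ->
  \int[P]_x (a * u x + b * v x) ^+ 2 =
  a ^+ 2 * \int[P]_x (u x ^+ 2) + 2 * a * b * \int[P]_x (u x * v x)
  + b ^+ 2 * \int[P]_x (v x ^+ 2).
Proof.
move=> su sv; have iuv := square_integrableM su sv.
transitivity (\int[P]_x ((a ^+ 2 * (u x ^+ 2) + (2 * a * b) * (u x * v x)) + b ^+ 2 * (v x ^+ 2))).
  by apply: eq_Rintegral => x _; ring.
have i1 := integrableZR (a ^+ 2) su.2; have i2 := integrableZR (2 * a * b) iuv.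
have i3 := integrableZR (b ^+ 2) sv.2.
rewrite RintegralD//; last exact: integrableDR.
rewrite RintegralD// RintegralZl//; last exact: su.2.
by rewrite RintegralZl// RintegralZl//; exact: sv.2.
Qed.

Lemma Rintegral_lin u v a b : P.-integrable setT (EFin \o u) -> P.-integrable setT (EFin \o v) ->
  \int[P]_x (a * u x + b * v x) = a * \int[P]_x u x + b * \int[P]_x v x.
Proof.
move=> iu iv; rewrite RintegralD//; [|exact: integrableZR|exact: integrableZR].
by rewrite !RintegralZl.
Qed.

Lemma variance_expand u : square_integrable P u ->
  \int[P]_x (u x - \int[P]_x u x) ^+ 2 = \int[P]_x (u x ^+ 2) - (\int[P]_x u x) ^+ 2.
Proof.
move=> su; set m := \int[P]_x u x.
have s1 := square_integrable_cst P 1.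
transitivity (\int[P]_x (1 * u x + (- m) * 1) ^+ 2).
  by apply: eq_Rintegral => x _; rewrite mulr1 mul1r.
rewrite (Rintegral_sqr_lin _ _ su s1) expr1n (Rintegral_cstP P).
under [X in _ + 2 * _ * _ * X + _]eq_Rintegral do rewrite mulr1.
by rewrite -/m; ring.
Qed.

End second_moments.

Section regression.
Context {d d' : measure_display} {T : measurableType d} {T' : measurableType d'}.
Context {R : realType} (P : probability T R) (Y : T -> T') (f : T -> R).
(** In the application, the continuous affine functionals on F. *)
Variable L : set (T' -> R).
Hypothesis mY : measurable_fun setT Y.
Hypothesis mL : forall l, L l -> measurable_fun setT l.
Hypothesis LD : forall k l, L k -> L l -> L (k \+ l).
Hypothesis LZ : forall a l, L l -> L (a \*o l).
Hypothesis Lcst : forall c, L (cst c).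
Hypothesis Lgen : forall B, measurable B -> <<s [set [set y | l y < 0] | l in L] >> B.
Hypothesis sf : square_integrable P f.
Hypothesis sL : forall l, L l -> square_integrable P (l \o Y).
Hypothesis gauss : forall a l, L l -> let h := fun w => a * f w + l (Y w) in
  gaussian_cf P h (\int[P]_w h w) (\int[P]_w (h w - \int[P]_w h w) ^+ 2).

Let q l := \int[P]_w (f w - l (Y w)) ^+ 2.

(** This is the number called q in the overview; [q l] is the error of a single functional. *)
Let dist := inf [set q l | l in L].

Let q_ge0 l : 0 <= q l.
Proof. by apply: Rintegral_ge0 => w _; exact: sqr_ge0. Qed.

Let dist_le l : L l -> dist <= q l.
Proof.
move=> Ll; apply: ge_inf; last by exists l.
by exists 0 => _ [k _ <-]; exact: q_ge0.
Qed.

Let dist_ge0 : 0 <= dist.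
Proof.
apply: lb_le_inf; first by exists (q (cst 0)); exists (cst 0).
by move=> _ [k _ <-]; exact: q_ge0.
Qed.

(** The excess is a square, so that successive functionals lie at L2-distance of order 2^-n. *)
Let minimizing : exists l : nat -> T' -> R,
  forall n, L (l n) /\ q (l n) < dist + (2^-1 ^+ n) ^+ 2.
Proof.
suff h : forall n, exists l, L l /\ q l < dist + (2^-1 ^+ n) ^+ 2.
  by have [l hl] := choice h; exists l.
move=> n; have [||_ [l Ll <-] lt] := @inf_adherent R [set q l | l in L] ((2^-1 ^+ n) ^+ 2).
- by rewrite !exprn_gt0// invr_gt0 ltr0n.
- split; first by exists (q (cst 0)); exists (cst 0).
  by exists 0 => _ [k _ <-]; exact: q_ge0.
by exists l.
Qed.

Let residual l := fun w => f w - l (Y w).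

Let s_residual l : L l -> square_integrable P (residual l).
Proof. by move=> Ll; apply: square_integrableB => //; exact: sL. Qed.

(** The midpoint of l and k is a competitor, so the parallelogram identity bounds the squared
    distance by 2 (q l + q k) - 4 dist. *)
Let residual_close l k e : L l -> L k -> q l < dist + e -> q k < dist + e ->
  \int[P]_w (l (Y w) - k (Y w)) ^+ 2 <= 4 * e.
Proof.
move=> Ll Lk ql qk; have sl := s_residual Ll; have sk := s_residual Lk.
have Lm : L (2^-1 \*o (l \+ k)) by apply: LZ; exact: LD.
have e1 : \int[P]_w (l (Y w) - k (Y w)) ^+ 2 =
    q l - 2 * \int[P]_w (residual l w * residual k w) + q k.
  transitivity (\int[P]_w (1 * residual l w + (-1) * residual k w) ^+ 2).
    by apply: eq_Rintegral => w _; rewrite /residual; ring.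
  by rewrite (Rintegral_sqr_lin _ _ sl sk) /q /residual; ring.
have e2 : q (2^-1 \*o (l \+ k)) =
    (q l + 2 * \int[P]_w (residual l w * residual k w) + q k) / 4.
  transitivity (\int[P]_w (2^-1 * residual l w + 2^-1 * residual k w) ^+ 2).
    by apply: eq_Rintegral => w _; rewrite /residual/=; congr (_ ^+ 2); field.
  by rewrite (Rintegral_sqr_lin _ _ sl sk) /q /residual; field.
have := dist_le Lm; rewrite e2 e1; lra.
Qed.

(** Without an exact minimiser orthogonality is only approximate. With c and v as below, the
    competitor l - t k gives - 2 t c <= e^2 + t^2 v, and t = e, t = - e balance the two terms. *)
Let residual_orthogonal l k e : L l -> L k -> q l < dist + e ^+ 2 -> 0 < e ->
  `|\int[P]_w (residual l w * k (Y w))| <= e * (1 + \int[P]_w (k (Y w) ^+ 2)).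
Proof.
move=> Ll Lk ql e0; have sl := s_residual Ll; have sk := sL Lk.
set c := \int[P]_w _; set v := \int[P]_w (k (Y w) ^+ 2).
have v0 : 0 <= v by apply: Rintegral_ge0 => w _; exact: sqr_ge0.
have main t : - 2 * t * c <= e ^+ 2 + t ^+ 2 * v.
  have Lm : L (l \+ (- t \*o k)) by apply: LD => //; exact: LZ.
  have := dist_le Lm.
  have -> : q (l \+ (- t \*o k)) = q l + 2 * t * c + t ^+ 2 * v.
    transitivity (\int[P]_w (1 * residual l w + t * (k \o Y) w) ^+ 2).
      by apply: eq_Rintegral => w _; rewrite /residual/=; congr (_ ^+ 2); ring.
    by rewrite (Rintegral_sqr_lin _ _ sl sk) /q /residual/= -/c -/v; ring.
  lra.
have h1 := main e; have h2 := main (- e).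
rewrite ler_norml; apply/andP; split.
  have : e * (- c) <= e * (e * (1 + v)).
    by move: h1; rewrite !expr2; have := mulr_ge0 (ltW e0) (mulr_ge0 (ltW e0) v0); lra.
  by rewrite ler_pM2l//; lra.
have : e * c <= e * (e * (1 + v)).
  by move: h2; rewrite sqrrN !expr2; have := mulr_ge0 (ltW e0) (mulr_ge0 (ltW e0) v0); lra.
by rewrite ler_pM2l.
Qed.

(** For each n the Gaussian formula holds with l_n in place of g, up to two error terms: the mean of
    the residual and its correlation with l(Y). Both are of order 2^-n by near orthogonality. *)
Lemma regression_limit : exists g : T' -> R, [/\ measurable_fun setT g,
  P.-integrable setT (EFin \o (g \o Y)) &
  forall a l, L l -> \int[P]_w cos (a * (f w - g (Y w)) + l (Y w)) =
    cos (\int[P]_w l (Y w)) *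
    expR (- ((a ^+ 2 * dist + (\int[P]_w (l (Y w) ^+ 2) - (\int[P]_w l (Y w)) ^+ 2)) / 2))].
Proof.
have [l lP] := minimizing.
pose e n : R := 2^-1 ^+ n.
have e0 n : 0 < e n by rewrite exprn_gt0// invr_gt0 ltr0n.
have Ll n : L (l n) := (lP n).1.
have ql n : q (l n) < dist + e n ^+ 2 := (lP n).2.
pose F : {mfun T >-> T'} := mfun_Sub (mem_set mY).
pose PY := distribution P F.
have imY B : measurable B -> PY B = P (Y @^-1` B) by move=> _.
have il k : L k -> PY.-integrable setT (EFin \o k).
  move=> Lk; apply: (integrable_image mY imY (mL Lk)).2.
  exact: square_integrable_integrable (sL Lk).
have iBn n m : PY.-integrable setT (EFin \o (fun y => l n y - l m y)).
  exact: (@integrableB _ _ _ PY _ measurableT _ _ (il _ (Ll n)) (il _ (Ll m))).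
have ml n : measurable_fun setT (l n) := mL (Ll n).
have mN (k : T' -> R) : measurable_fun setT k -> measurable_fun setT (fun y => `|k y|).
  by move=> mk; apply: measurableT_comp.
have iN (k : T' -> R) : measurable_fun setT k -> PY.-integrable setT (EFin \o k) ->
    PY.-integrable setT (EFin \o (fun y => `|k y|)).
  move=> mk ik; apply: (@le_integrable _ _ _ PY _ measurableT _ _ _ _ ik).
    by apply/measurable_EFinP; exact: mN.
  by move=> y _; rewrite /= lee_fin normr_id.
have step n : \int[PY]_y `|l n.+1 y - l n y| <= 5 / 2 * 2^-1 ^+ n.
  rewrite (Rintegral_image mY imY); last 2 first.
  - by apply: mN; exact: measurable_funB.
  - by apply: iN => //; exact: measurable_funB.
  rewrite -/(e n).
  have sd : square_integrable P (fun w => l n.+1 (Y w) - l n (Y w)).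
    by apply: square_integrableB; exact: sL.
  have en1 : e n.+1 ^+ 2 <= e n ^+ 2.
    have -> : e n.+1 = 2^-1 * e n by rewrite /e exprS.
    by have := sqr_ge0 (e n); rewrite exprMn !expr2; lra.
  have close := residual_close (Ll n.+1) (Ll n) (lt_le_trans (ql n.+1) (lerD (lexx _) en1)) (ql n).
  (* From L2 to L1 by |x| <= e / 2 + x^2 / (2 e). As the integral of x^2 is at most 4 e^2, the total
     is e / 2 + 2 e, the origin of 5/2. *)
  apply: (@le_trans _ _ (\int[P]_w (e n / 2 * 1 + (e n)^-1 / 2 * (l n.+1 (Y w) - l n (Y w)) ^+ 2))).
    apply: le_Rintegral => //.
    - apply: (@le_integrable _ _ _ P _ measurableT _ _ _ _ (square_integrable_integrable sd)).
        apply/measurable_EFinP; apply: measurableT_comp => //; exact: sd.1.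
      by move=> w _; rewrite /= lee_fin normr_id.
    - apply: integrableDR; first exact: integrable_cstP.
      exact: integrableZR sd.2.
    - move=> w _; set x := l n.+1 (Y w) - l n (Y w).
      rewrite -[x ^+ 2]real_normK ?num_real//; move: `|x| => z.
      have ie0 : 0 <= (e n)^-1 by rewrite invr_ge0 ltW.
      have := mulr_ge0 ie0 (sqr_ge0 (e n - z)).
      have -> : (e n)^-1 * (e n - z) ^+ 2 = e n - 2 * z + (e n)^-1 * z ^+ 2.
        by field; rewrite gt_eqF.
      lra.
  rewrite Rintegral_lin; [|exact: integrable_cstP|exact: sd.2].
  rewrite Rintegral_cstP mulr1.
  have : (e n)^-1 / 2 * \int[P]_w (l n.+1 (Y w) - l n (Y w)) ^+ 2 <= (e n)^-1 / 2 * (4 * e n ^+ 2).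
    by rewrite ler_wpM2l// divr_ge0// invr_ge0 ltW.
  have -> : (e n)^-1 / 2 * (4 * e n ^+ 2) = 2 * e n by field; rewrite gt_eqF.
  lra.
have [g [mg ig gl]] := fast_cauchy_l1 ml (fun n => il _ (Ll n)) step.
have igY : P.-integrable setT (EFin \o (g \o Y)) := (integrable_image mY imY mg).1 ig.
exists g; split => // a k Lk.
have mh n : L (k \+ (- a \*o l n)) by apply: LD => //; exact: LZ.
set m := \int[P]_w k (Y w); set v := \int[P]_w (k (Y w) ^+ 2).
(* The mean of the residual, written as a product with the constant 1 of [L] so that near
   orthogonality applies to it. *)
pose r n := \int[P]_w (residual (l n) w * 1).
pose c n := \int[P]_w (residual (l n) w * k (Y w)).
have rE n : `|r n| <= e n * 2.
  have := residual_orthogonal (Ll n) (Lcst 1) (ql n) (e0 n).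
  under [X in _ <= _ * (1 + X) -> _]eq_Rintegral do rewrite expr1n.
  by rewrite Rintegral_cstP.
have cE n : `|c n| <= e n * (1 + v) := residual_orthogonal (Ll n) Lk (ql n) (e0 n).
have In n : \int[P]_w cos (a * (f w - l n (Y w)) + k (Y w)) =
    cos (a * r n + m) * expR (- ((a ^+ 2 * q (l n) + 2 * a * c n + v - (a * r n + m) ^+ 2) / 2)).
  pose h := fun w => a * residual (l n) w + 1 * (k \o Y) w.
  have hE : (fun w => a * f w + (k \+ (- a \*o l n)) (Y w)) = h.
    by apply/funext => w; rewrite /h /residual/=; ring.
  have G : gaussian_cf P h (\int[P]_w h w) (\int[P]_w (h w - \int[P]_w h w) ^+ 2).
    by rewrite -hE; exact: gauss (mh n).
  have sh : square_integrable P h.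
    by apply: square_integrableD; apply: square_integrableZ; [exact: s_residual|exact: sL].
  have hM : \int[P]_w h w = a * r n + m.
    rewrite (Rintegral_lin _ _ (square_integrable_integrable (s_residual (Ll n)))
      (square_integrable_integrable (sL Lk))) mul1r; congr (_ * _ + _).
    by apply: eq_Rintegral => w _; rewrite mulr1.
  have hV : \int[P]_w (h w ^+ 2) = a ^+ 2 * q (l n) + 2 * a * c n + v.
    by rewrite (Rintegral_sqr_lin _ _ (s_residual (Ll n)) (sL Lk)) /q /c /v /residual/=; ring.
  have := G 1 0; rewrite (variance_expand sh) hM hV mul1r addr0 expr1n mul1r => <-.
  by apply: eq_Rintegral => w _; rewrite mul1r addr0 -hE/=; congr cos; ring.
have lim1 : \int[P]_w cos (a * (f w - l n (Y w)) + k (Y w)) @[n --> \oo] -->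
    \int[P]_w cos (a * (f w - g (Y w)) + k (Y w)).
  have mcos (u : T -> R) : measurable_fun setT u -> P.-integrable setT (EFin \o (fun w => cos (u w))).
    move=> mu; apply: (@integrable_of_bounded _ _ _ P _ 1) => [|w]; last exact: cos_max.
    apply: (measurableT_comp _ mu); apply: continuous_measurable_fun; exact: continuous_cos.
  have mYk k' : measurable_fun setT k' -> measurable_fun setT (fun w => k' (Y w) : R).
    by move=> mk'; exact: (measurableT_comp mk' mY).
  have mu (k' : T' -> R) : measurable_fun setT k' -> measurable_fun setT (fun w => a * (f w - k' (Y w)) + k (Y w)).
    move=> mk'; apply: measurable_funD; last by apply: mYk; exact: mL.
    by apply: measurable_funM => //; apply: measurable_funB; [exact: sf.1|exact: mYk].
  (* The factor |a| comes from the Lipschitz bound on the cosine, and 5/2 * 2 is the rate that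
     [fast_cauchy_l1] returns for steps bounded with 5/2. *)
  apply: (@cvg_geometric_bound _ _ _ (`|a| * (5 / 2 * 2))) => n.
  have mgl : measurable_fun setT (fun y => g y - l n y) by exact: measurable_funB.
  have igl : PY.-integrable setT (EFin \o (fun y => `|g y - l n y|)).
    apply: iN => //; exact: (@integrableB _ _ _ PY _ measurableT _ _ ig (il _ (Ll n))).
  have iglY := (integrable_image mY imY (mN _ mgl)).1 igl.
  have ic1 := mcos _ (mu _ (ml n)); have ic2 := mcos _ (mu _ mg).
  rewrite -RintegralB//; rewrite (le_trans (le_normr_Rintegral _ _))//.
    exact: (@integrableB _ _ _ P _ measurableT _ _ ic1 ic2).
  apply: (@le_trans _ _ (\int[P]_w (`|a| * `|g (Y w) - l n (Y w)|))).
    apply: le_Rintegral => //.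
    - have ic3 := @integrableB _ _ _ P _ measurableT _ _ ic1 ic2.
      apply: (@le_integrable _ _ _ P _ measurableT _ _ _ _ ic3).
        apply/measurable_EFinP; apply: measurableT_comp => //.
        by apply/measurable_EFinP; exact: measurable_int ic3.
      by move=> w _; rewrite /= lee_fin normr_id.
    - exact: integrableZR iglY.
    - move=> w _; rewrite (le_trans (cos_lipschitz _ _))// -normrM.
      rewrite le_eqVlt; apply/orP; left; apply/eqP; congr (`|_|); ring.
  rewrite RintegralZl//.
  rewrite -(Rintegral_image mY imY (mN _ mgl) igl) -!mulrA ler_wpM2l//.
  by rewrite (le_trans (gl n))// -!mulrA.
have lim2 : \int[P]_w cos (a * (f w - l n (Y w)) + k (Y w)) @[n --> \oo] -->
    cos m * expR (- ((a ^+ 2 * dist + (v - m ^+ 2)) / 2)).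
  have rc : r n @[n --> \oo] --> (0 : R).
    by apply: (@cvg_geometric_bound _ _ _ 2) => n; rewrite subr0 mulrC; exact: rE.
  have cc : c n @[n --> \oo] --> (0 : R).
    by apply: (@cvg_geometric_bound _ _ _ (1 + v)) => n; rewrite subr0 mulrC; exact: cE.
  have qc : q (l n) @[n --> \oo] --> dist.
    apply: (@cvg_geometric_bound _ _ _ 1) => n; rewrite mul1r -/(e n).
    rewrite ger0_norm ?subr_ge0 ?dist_le//.
    have e1 : e n <= 1 by rewrite /e exprn_ile1//; lra.
    have := ql n; have := e0 n; rewrite expr2; nra.
  have mc : a * r n + m @[n --> \oo] --> m.
    rewrite -[X in _ --> X]add0r -(mulr0 a); apply: cvgD; last exact: cvg_cst.
    by apply: cvgM => //; exact: cvg_cst.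
  under eq_fun do rewrite In.
  apply: cvgM; first by apply: continuous_cvg => //; exact: continuous_cos.
  apply: continuous_cvg; first exact: continuous_expR.
  apply: cvgN; apply: cvgM; last exact: cvg_cst.
  have -> : a ^+ 2 * dist + (v - m ^+ 2) = a ^+ 2 * dist + 2 * a * 0 + v - m * m by ring.
  under eq_fun do rewrite [(_ + m) ^+ 2]expr2.
  apply: cvgB; last exact: cvgM.
  apply: cvgD; last exact: cvg_cst.
  by apply: cvgD; apply: cvgM => //; exact: cvg_cst.
exact: cvg_unique lim1 lim2.
Qed.

Local Notation rT := (measurableTypeR R).

(* The residual r satisfies (r, Y) ~ (-r, Y), so it integrates to 0 on the
   events of Y. *)
Lemma symmetric_residual (r : T -> R) :
  measurable_fun setT r -> P.-integrable setT (EFin \o r) ->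
  (forall a l, L l -> \int[P]_w cos (a * r w + l (Y w)) =
                      \int[P]_w cos (- a * r w + l (Y w))) ->
  forall B, measurable B -> \int[P]_(w in Y @^-1` B) r w = 0.
Proof.
move=> mr ir sym B mB.
have mr' : @measurable_fun _ _ T rT setT r := mr.
have mrN : @measurable_fun _ _ T rT setT (fun w => - r w) by apply: measurableT_comp.
pose p1 w : rT * T' := (r w, Y w); pose p2 w : rT * T' := (- r w, Y w).
have mp1 : measurable_fun setT p1 by exact: measurable_fun_pair.
have mp2 : measurable_fun setT p2 by exact: measurable_fun_pair.
pose F1 : {mfun T >-> (rT * T')%type} := mfun_Sub (mem_set mp1).
pose F2 : {mfun T >-> (rT * T')%type} := mfun_Sub (mem_set mp2).
pose m1 := distribution P F1; pose m2 := distribution P F2.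
have im1 A : measurable A -> m1 A = P (p1 @^-1` A) by move=> _.
have im2 A : measurable A -> m2 A = P (p2 @^-1` A) by move=> _.
pose V : set (rT * T' -> R) :=
  [set h | exists a l, L l /\ h = (fun z => a * z.1 + l z.2)].
have mVal a l : L l -> measurable_fun setT (fun z : rT * T' => a * z.1 + l z.2 : R).
  move=> Ll; apply: measurable_funD; last exact: (measurableT_comp (mL Ll) measurable_snd).
  by apply: measurable_funM => //; exact: measurable_fst.
have law A : measurable A -> m1 A = m2 A.
  move=> mA; apply: (@cos_unique _ _ _ m1 m2 V _ _ _ _ _ A mA).
  - by move=> _ [a [l [Ll ->]]]; exact: mVal.
  - by move=> c; exists 0, (cst c); split => //; apply/funext => z; rewrite mul0r add0r.
  - move=> _ _ [a [l [Ll ->]]] [b [k [Lk ->]]]; exists (a + b), (l \+ k).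
    by split; [exact: LD|apply/funext => z /=; ring].
  - move=> b _ [a [l [Ll ->]]]; exists (b * a), (b \*o l).
    by split; [exact: LZ|apply/funext => z /=; ring].
  - move=> _ [a [l [Ll ->]]].
    have mc : measurable_fun setT (fun z : rT * T' => cos (a * z.1 + l z.2)).
      apply: (measurableT_comp _ (mVal a l Ll)).
      by apply: continuous_measurable_fun; exact: continuous_cos.
    have ic (m : probability (rT * T')%type R) :
        m.-integrable setT (EFin \o (fun z : rT * T' => cos (a * z.1 + l z.2))).
      by apply: (@integrable_of_bounded _ _ _ m _ 1) => // z; exact: cos_max.
    rewrite (Rintegral_image mp1 im1 mc (ic m1)) (Rintegral_image mp2 im2 mc (ic m2)).
    by rewrite /p1 /p2/= sym//; apply: eq_Rintegral => w _; rewrite mulNr mulrN.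
  pose W := <<s [set [set x | h x < 0] | h in V] >>.
  have sW : sigma_algebra setT W by exact: smallest_sigma_algebra.
  have [W0 WC Wbig] := sW.
  have Wpre (U : Type) (phi : rT * T' -> U) : sigma_algebra setT [set C | W (phi @^-1` C)].
    split=> /=.
    - by rewrite preimage_set0.
    - by move=> C WC'; rewrite setTD preimage_setC -setTD; exact: WC.
    - by move=> G WG; rewrite preimage_bigcup; exact: Wbig.
  have W1 (C : set rT) : measurable C -> W (fst @^-1` C).
    rewrite RGenOInfty.measurableE => mC.
    apply: (smallest_sub (Wpre _ fst) _ mC) => _ [y ->].
    apply: sub_sigma_algebra; exists (fun z => (-1) * z.1 + cst y z.2).
      by exists (-1), (cst y).
    by apply/seteqP; split=> z /=; rewrite in_itv/= andbT; lra.
  have W2 (C : set T') : measurable C -> W (snd @^-1` C).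
    move=> mC; apply: (smallest_sub (Wpre _ snd) _ (Lgen mC)) => _ [l Ll <-].
    apply: sub_sigma_algebra; exists (fun z => 0 * z.1 + l z.2); first by exists 0, l.
    by apply/seteqP; split=> z /=; rewrite mul0r add0r.
  apply: (smallest_sub sW _ mA) => _ [[C mC <-]|[C mC <-]]; rewrite setTI.
    exact: W1.
  exact: W2.
(* Its integral under [m1] is the one sought and under [m2] the opposite; the laws being equal, it
   is 0. *)
pose phi (z : rT * T') : R := z.1 * \1_B z.2.
have mphi : measurable_fun setT phi.
  apply: measurable_funM; first exact: measurable_fst.
  exact: (measurableT_comp _ measurable_snd).
have iphi w : `|r w * \1_B (Y w)| <= `|r w|.
  by rewrite normrM ler_piMr// indicE; case: (_ \in _); rewrite ?normr1 ?normr0.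
have irB : P.-integrable setT (EFin \o (fun w => r w * \1_B (Y w))).
  apply: (@le_integrable _ _ _ P _ measurableT _ _ _ _ ir).
    by apply/measurable_EFinP; exact: (measurableT_comp mphi mp1).
  by move=> w _; rewrite /= lee_fin.
have i1 : m1.-integrable setT (EFin \o phi) := (integrable_image mp1 im1 mphi).2 irB.
have i2 : m2.-integrable setT (EFin \o phi).
  apply: (integrable_image mp2 im2 mphi).2.
  apply: (@le_integrable _ _ _ P _ measurableT _ _ _ _ ir).
    by apply/measurable_EFinP; exact: (measurableT_comp mphi mp2).
  by move=> w _; rewrite /= lee_fin /phi/= mulNr normrN.
have e : \int[m1]_z phi z = \int[m2]_z phi z.
  by rewrite /Rintegral; congr fine; apply: eq_measure_integral => A mA _; exact: law.
have e1 : \int[m1]_z phi z = \int[P]_w (r w * \1_B (Y w)) := Rintegral_image mp1 im1 mphi i1.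
have e2 : \int[m2]_z phi z = - \int[P]_w (r w * \1_B (Y w)).
  rewrite (Rintegral_image mp2 im2 mphi i2) -mulN1r -RintegralZl//.
  by apply: eq_Rintegral => w _; rewrite /phi/= mulN1r mulNr.
have -> : \int[P]_(w in Y @^-1` B) r w = \int[P]_w (r w * \1_B (Y w)).
  rewrite Rintegral_mkcond; apply: eq_Rintegral => w _; rewrite /patch.
  rewrite indicE (_ : (w \in Y @^-1` B) = (Y w \in B)).
    by case: ifP; rewrite ?mulr1 ?mulr0.
  by apply/idP/idP; rewrite !inE.
by move: e; rewrite e1 e2; lra.
Qed.

(** Both k(Y) and g(Y) have the integrals of f over the events of Y. Splitting along the event k(Y)
    >= g(Y) shows that they coincide in L1, and the Lipschitz bound on the cosine replaces g by
    k. *)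
Lemma regression_cf (k : T' -> R) : measurable_fun setT k ->
  P.-integrable setT (EFin \o (k \o Y)) ->
  (forall B, measurable B ->
     \int[P]_(w in Y @^-1` B) k (Y w) = \int[P]_(w in Y @^-1` B) f w) ->
  exists2 q : R, 0 <= q & forall a l, L l ->
    \int[P]_w cos (a * (f w - k (Y w)) + l (Y w)) =
    cos (\int[P]_w l (Y w)) *
    expR (- ((a ^+ 2 * q + (\int[P]_w (l (Y w) ^+ 2) - (\int[P]_w l (Y w)) ^+ 2)) / 2)).
Proof.
move=> mk ik kE; have [g [mg ig gE]] := regression_limit.
have if_ := square_integrable_integrable sf.
pose r w := f w - g (Y w).
have mgY : measurable_fun setT (g \o Y) := measurableT_comp mg mY.
have mkY : measurable_fun setT (k \o Y) := measurableT_comp mk mY.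
have mr : measurable_fun setT r by apply: measurable_funB => //; exact: sf.1.
have ir : P.-integrable setT (EFin \o r) := @integrableB _ _ _ P _ measurableT _ _ if_ ig.
have r0 := symmetric_residual mr ir.
have {}r0 B : measurable B -> \int[P]_(w in Y @^-1` B) r w = 0.
  by apply: r0 => a l Ll; rewrite !gE// sqrrN.
pose D w := k (Y w) - g (Y w).
have mD : measurable_fun setT D by exact: measurable_funB.
have iD : P.-integrable setT (EFin \o D) := @integrableB _ _ _ P _ measurableT _ _ ik ig.
have mYB B : measurable B -> measurable (Y @^-1` B).
  by move=> mB; rewrite -[X in measurable X]setTI; exact: mY.
have iS (u : T -> R) C : measurable C -> P.-integrable setT (EFin \o u) ->
    P.-integrable C (EFin \o u).
  by move=> mC; apply: integrableS.
have D0 B : measurable B -> \int[P]_(w in Y @^-1` B) D w = 0.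
  move=> mB; have mC := mYB B mB.
  rewrite /D (RintegralB mC (iS _ _ mC ik) (iS _ _ mC ig)) kE//.
  by rewrite -(RintegralB mC (iS _ _ mC if_) (iS _ _ mC ig)); exact: r0.
pose B := [set y | 0 <= k y - g y].
have mB : measurable B.
  have mkg : measurable_fun setT (fun y => k y - g y) by exact: measurable_funB.
  have := mkg measurableT `[0, +oo[%classic (measurable_itv _); rewrite setTI.
  by congr measurable; apply/seteqP; split=> y; rewrite /B/= in_itv/= andbT.
have iND : P.-integrable setT (EFin \o (fun w => `|D w|)).
  apply: (@le_integrable _ _ _ P _ measurableT _ _ _ _ iD).
    by apply/measurable_EFinP; exact: measurableT_comp.
  by move=> w _; rewrite /= lee_fin normr_id.
have ND0 : \int[P]_w `|D w| = 0.
  have mC := mYB B mB; have mC' := measurableC mC.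
  have -> : \int[P]_w `|D w| = \int[P]_(w in Y @^-1` B) `|D w| + \int[P]_(w in ~` (Y @^-1` B)) `|D w|.
    rewrite -Rintegral_setU//; first by rewrite setUv.
    - by rewrite setUv.
    - by apply/disj_setPCl.
  have -> : \int[P]_(w in Y @^-1` B) `|D w| = \int[P]_(w in Y @^-1` B) D w.
    by apply: eq_Rintegral => w; rewrite inE => Bw; rewrite ger0_norm.
  have -> : \int[P]_(w in ~` (Y @^-1` B)) `|D w| = (-1) * \int[P]_(w in Y @^-1` (~` B)) D w.
    rewrite -RintegralZl//; last by apply: iS.
    apply: eq_Rintegral => w; rewrite inE => nBw; rewrite mulN1r ler0_norm//.
    by move/negP: nBw; rewrite -ltNge => /ltW.
  by rewrite !D0 ?mulr0 ?addr0//; exact: measurableC.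
exists dist => // a l Ll; rewrite -gE//.
have mcos (u : T -> R) : measurable_fun setT u -> P.-integrable setT (EFin \o (fun w => cos (u w))).
  move=> mu; apply: (@integrable_of_bounded _ _ _ P _ 1) => [|w]; last exact: cos_max.
  apply: (measurableT_comp _ mu); apply: continuous_measurable_fun; exact: continuous_cos.
have mlY : measurable_fun setT (l \o Y) := measurableT_comp (mL Ll) mY.
have ic1 : P.-integrable setT (EFin \o (fun w => cos (a * (f w - k (Y w)) + l (Y w)))).
  apply: mcos; apply: measurable_funD => //; apply: measurable_funM => //.
  by apply: measurable_funB => //; exact: sf.1.
have ic2 : P.-integrable setT (EFin \o (fun w => cos (a * (f w - g (Y w)) + l (Y w)))).
  apply: mcos; apply: measurable_funD => //; apply: measurable_funM => //.
have ic3 := @integrableB _ _ _ P _ measurableT _ _ ic1 ic2.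
apply/eqP; rewrite -subr_eq0 -normr_le0 -RintegralB//.
rewrite (le_trans (le_normr_Rintegral _ _))//.
rewrite -[leRHS](mulr0 `|a|) -[X in `|a| * X]ND0 -RintegralZl//.
apply: le_Rintegral => //.
- apply: (@le_integrable _ _ _ P _ measurableT _ _ _ _ ic3).
    apply/measurable_EFinP; apply: measurableT_comp => //.
    by apply/measurable_EFinP; exact: measurable_int ic3.
  by move=> w _; rewrite /= lee_fin normr_id.
- exact: integrableZR iND.
- move=> w _; rewrite (le_trans (cos_lipschitz _ _))// -normrM /D.
  have -> : a * (f w - k (Y w)) + l (Y w) - (a * (f w - g (Y w)) + l (Y w)) =
    - (a * (k (Y w) - g (Y w))) by ring.
  by rewrite normrN.
Qed.

End regression.

(** * Gaussian laws and their covariance *)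

Section covariance.
Context {R : realType} {E : completeNormedModType R}.
Hypothesis sepE : separable E.
Context {d : measure_display} {T : measurableType d} (P : probability T R).
Implicit Types V : T -> E.

Definition norm_square_integrable V :=
  borel_fun setT V /\ P.-integrable setT (EFin \o (fun w => `|V w| ^+ 2)).

Lemma norm_square_integrable_norm V : norm_square_integrable V ->
  P.-integrable setT (EFin \o (fun w => `|V w|)).
Proof.
move=> [mV iV]; apply: square_integrable_integrable.
by split=> //; exact: borel_fun_norm.
Qed.

Lemma norm_square_integrableB V V' : norm_square_integrable V ->
  norm_square_integrable V' -> norm_square_integrable (fun w => V w - V' w).
Proof.
move=> [mV iV] [mV' iV']; have mB := borel_funB sepE mV mV'; split=> //.
apply: (@integrable_le _ _ _ P _ (fun w => 2 * `|V w| ^+ 2 + 2 * `|V' w| ^+ 2)).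
- by apply: measurable_funX; exact: borel_fun_norm.
- by apply: integrableDR; exact: integrableZR.
- move=> w; rewrite ger0_norm ?sqr_ge0//.
  have := ler_normB (V w) (V' w); have := normr_ge0 (V w - V' w).
  move: `|V w - V' w| `|V w| `|V' w| => p q r p0 pqr.
  have h1 : p ^+ 2 <= (q + r) ^+ 2 by rewrite ler_sqr ?nnegrE// (le_trans p0).
  by have h2 := sqr_ge0 (q - r); rewrite !expr2 in h1 h2 *; lra.
Qed.

Lemma norm_square_integrable_cst v : norm_square_integrable (fun=> v).
Proof. by split; [exact: measurable_cst|exact: integrable_cstP]. Qed.

Lemma norm_square_integrable_dual V (x' : dual E) : norm_square_integrable V ->
  square_integrable P (fun w => x' (V w)).
Proof.
move=> [mV iV]; have mx := borel_fun_dual x' mV; split=> //.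
have [C C0 x'C] := dual_bound x'.
apply: (@integrable_le _ _ _ P _ (fun w => C ^+ 2 * `|V w| ^+ 2)).
- exact: measurable_funX.
- exact: integrableZR.
- move=> w; have h := x'C (V w).
  by rewrite normrX -exprMn ler_sqr ?nnegrE// (le_trans _ h).
Qed.

Lemma bochner_integrable_cov V m (x' : dual E) : norm_square_integrable V ->
  bochner_integrable P setT (fun w => x' (V w - m) *: (V w - m)).
Proof.
move=> sV; have [mB iB] := norm_square_integrableB sV (norm_square_integrable_cst m).
have [C C0 x'C] := dual_bound x'.
apply: (bochner_integrable_of_norm sepE).
  by apply: (borel_funZ sepE) => //; exact: borel_fun_dual.
apply: (@integrable_le _ _ _ P _ (fun w => C * `|V w - m| ^+ 2)).
- apply: borel_fun_norm; apply: (borel_funZ sepE) => //; exact: borel_fun_dual.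
- exact: integrableZR.
- by move=> w; rewrite normr_id normrZ expr2 mulrA ler_wpM2r.
Qed.

Lemma bochner_covE V m (x' z' : dual E) : norm_square_integrable V ->
  z' (bochner P setT (fun w => x' (V w - m) *: (V w - m))) =
  \int[P]_w (x' (V w - m) * z' (V w - m)).
Proof.
move=> sV; rewrite (bochner_integrableE sepE _ measurableT (bochner_integrable_cov m x' sV)).
by apply: eq_Rintegral => w _; rewrite dualZ.
Qed.

Lemma mean_dual V (x' : dual E) : bochner_integrable P setT V ->
  x' (mean P V) = \int[P]_w x' (V w).
Proof. by move=> iV; rewrite /mean (bochner_integrableE sepE). Qed.

End covariance.

Section normal_laws.
Context {R : realType} {E : completeNormedModType R}.
Hypothesis sepE : separable E.
Implicit Types (Q : probability (borel E) R) (m : E) (K : dual E -> E).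

Lemma borel_fun_id : borel_fun (T := borel E) setT (fun x : borel E => x : E).
Proof. by move=> _ A mA; rewrite setTI. Qed.

Lemma gaussian_norm_square_integrable Q : gaussian_measure Q ->
  norm_square_integrable Q (fun x : borel E => x : E).
Proof. by move=> gQ; split; [exact: borel_fun_id|exact: fernique]. Qed.

(** Under such a law x' has mean x' m and variance x' (K x'), which fixes all cosine integrals. *)
Lemma is_normal_unique m K Q Q' : is_normal m K Q -> is_normal m K Q' ->
  forall A, measurable A -> Q A = Q' A.
Proof.
move=> nQ nQ'; apply: (borel_law sepE) => x' c.
have key Q0 : is_normal m K Q0 ->
    \int[Q0]_x cos (x' x + c) = cos (x' m + c) * expR (- (x' (K x') / 2)).
  move=> [gQ iQ mQ KQ]; have [_ cf] := gaussian_dual x' gQ.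
  have eM : \int[Q0]_x x' x = x' m by rewrite -mQ mean_dual.
  have eV : \int[Q0]_x (x' x - x' m) ^+ 2 = x' (K x').
    have [_ <-] := KQ x'.
    rewrite (bochner_covE sepE m x' x' (gaussian_norm_square_integrable gQ)).
    by apply: eq_Rintegral => x _; rewrite dualB expr2.
  have := cf 1 c; rewrite eM eV mul1r expr1n mul1r => <-.
  by apply: eq_Rintegral => x _; rewrite mul1r.
by rewrite (key Q)// (key Q').
Qed.

(** Real integrals suffice as data: Gaussianity yields Bochner integrability through [fernique], and
    functionals separate points. *)
Lemma is_normal_law d (T : measurableType d) (P : probability T R)
    (V : {mfun T >-> borel E}) m K :
  (forall x' : dual E, real_gaussian (pushforward P (fun w => x' (V w) : measurableTypeR R))) ->
  (forall x' : dual E, \int[P]_w x' (V w) = x' m) ->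
  (forall x' z' : dual E, \int[P]_w (x' (V w - m : E) * z' (V w - m : E)) = z' (K x')) ->
  is_normal m K (distribution P V).
Proof.
move=> gV mV KV; set D := distribution P V.
have imD A : measurable A -> D A = P (V @^-1` A) by move=> _.
have mfV : measurable_fun setT V by [].
have gD : gaussian_measure D by move=> x'; exact: gV.
have sD := gaussian_norm_square_integrable gD.
have bD : bochner_integrable D setT (fun x : borel E => x : E).
  by apply: (bochner_integrable_of_norm sepE); [exact: borel_fun_id|exact: norm_square_integrable_norm].
split=> //.
  apply: dual_separates => x'; rewrite mean_dual//.
  rewrite (Rintegral_image mfV imD (dual_borel x')); first exact: mV.
  exact: bochner_integrable_dual.
move=> x'; split; first exact: (bochner_integrable_cov sepE m x' sD).
apply: dual_separates => z'; rewrite (bochner_covE sepE m x' z' sD).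
have sB := norm_square_integrableB sepE sD (norm_square_integrable_cst D m).
have sx := norm_square_integrable_dual x' sB; have sz := norm_square_integrable_dual z' sB.
rewrite (Rintegral_image mfV imD (g := fun x : borel E => x' (x - m : E) * z' (x - m : E))).
- exact: KV.
- by apply: measurable_funM; [exact: sx.1|exact: sz.1].
- exact: square_integrableM sx sz.
Qed.

End normal_laws.

(** * Conditional law *)

Section joint_gaussian.
Context {R : realType} {d : measure_display} {Omega : measurableType d}.
Variables (P : probability Omega R) (E F : completeNormedModType R).
Hypotheses (sepE : separable E) (sepF : separable F).
Variables (X : {RV P >-> borel E}) (Y : {RV P >-> borel F}).
Hypothesis XY : jointly_gaussian P (X : Omega -> E) (Y : Omega -> F).

Lemma dual_pair (x' : dual E) (y' : dual F) (a : R) :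
  exists z' : dual (E * F)%type, forall x y, z' (x, y) = a * x' x + y' y.
Proof.
have [C C0 x'C] := dual_bound x'; have [D D0 y'D] := dual_bound y'.
have [||z' z'E] := @dual_of R (E * F)%type (fun z => a * x' z.1 + y' z.2).
- by move=> b [x1 x2] [y1 y2] /=; rewrite !dualD !dualZ /GRing.scale/=; ring.
- exists (`|a| * C + D) => -[x y] /=.
  have h1 : `|x| <= `|(x, y)| by rewrite prod_normE/= le_max lexx.
  have h2 : `|y| <= `|(x, y)| by rewrite prod_normE/= le_max lexx orbT.
  rewrite (le_trans (ler_normD _ _))// normrM mulrDl -mulrA lerD//.
    by rewrite ler_wpM2l// (le_trans (x'C x))// ler_wpM2l// ltW.
  by rewrite (le_trans (y'D y))// ler_wpM2l// ltW.
by exists z' => x y; rewrite z'E.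
Qed.

Let mX : measurable_fun setT X. Proof. by []. Qed.
Let mY : measurable_fun setT Y. Proof. by []. Qed.

Let mx (x' : dual E) : measurable_fun setT (fun w => x' (X w)).
Proof. exact: borel_fun_dual. Qed.

Let my (y' : dual F) : measurable_fun setT (fun w => y' (Y w)).
Proof. exact: borel_fun_dual. Qed.

Lemma joint_gaussian_cf (x' : dual E) (y' : dual F) (a c : R) :
  let h := fun w => a * x' (X w) + (y' (Y w) + c) in
  square_integrable P h /\
  gaussian_cf P h (\int[P]_w h w) (\int[P]_w (h w - \int[P]_w h w) ^+ 2).
Proof.
have [z' z'E] := dual_pair x' y' a.
pose g w := a * x' (X w) + y' (Y w).
have mg : measurable_fun setT g by apply: measurable_funD => //; exact: measurable_funM.
have gg : real_gaussian (pushforward P (g : Omega -> measurableTypeR R)).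
  have := XY z'; congr (real_gaussian (pushforward P _)).
  by apply/funext => w; rewrite z'E.
have [sg cg] := gaussian_facts mg gg.
move=> h; have hE : h = (fun w => g w + c) by apply/funext => w; rewrite /h /g addrA.
have sc := square_integrable_cst P c.
have sh : square_integrable P h by rewrite hE; exact: square_integrableD.
have eh : \int[P]_w h w = \int[P]_w g w + c.
  rewrite hE RintegralD//; last 2 first.
  - exact: square_integrable_integrable.
  - exact: integrable_cstP.
  by rewrite Rintegral_cstP.
split; [exact: sh|move=> t e; rewrite eh].

have -> : \int[P]_w (h w - (\int[P]_w g w + c)) ^+ 2 = \int[P]_w (g w - \int[P]_w g w) ^+ 2.
  by apply: eq_Rintegral => w _; rewrite hE; congr (_ ^+ 2); ring.
have -> : cos (t * (\int[P]_w g w + c) + e) = cos (t * (\int[P]_w g w) + (t * c + e)).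
  by congr cos; ring.
rewrite -cg; apply: eq_Rintegral => w _; rewrite hE; congr cos; ring.
Qed.

Let zeroE : exists x' : dual E, forall x, x' x = 0.
Proof.
have [||z' z'E] := @dual_of R E (fun=> 0).
- by move=> a x y; rewrite scaler0 addr0.
- by exists 0 => x; rewrite normr0 mul0r.
by exists z' => x; rewrite z'E.
Qed.

Let zeroF : exists x' : dual F, forall x, x' x = 0.
Proof.
have [||z' z'E] := @dual_of R F (fun=> 0).
- by move=> a x y; rewrite scaler0 addr0.
- by exists 0 => x; rewrite normr0 mul0r.
by exists z' => x; rewrite z'E.
Qed.

Lemma joint_gaussian_fst (x' : dual E) :
  real_gaussian (pushforward P (fun w => x' (X w) : measurableTypeR R)).
Proof.
have [y' y'0] := zeroF; have [z' z'E] := dual_pair x' y' 1.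
have := XY z'; congr (real_gaussian (pushforward P _)).
by apply/funext => w; rewrite z'E y'0 mul1r addr0.
Qed.

Lemma joint_gaussian_norm_square : norm_square_integrable P (X : Omega -> E).
Proof.
pose D := distribution P X.
have gD : gaussian_measure D by move=> x'; exact: joint_gaussian_fst.
have imD A : measurable A -> D A = P (X @^-1` A) by move=> _.
split; first exact: mX.
apply: ((integrable_image mX imD (g := fun x : borel E => `|x : E| ^+ 2) _).1 (fernique sepE gD)).
by apply: measurable_funX; exact: norm_borel.
Qed.

Variable mu : {mfun borel F >-> borel E}.
Hypothesis muE : is_cond_expectation P (X : Omega -> E) Y (mu \o Y : Omega -> E).

Let Z : Omega -> E := mu \o Y.

Let bZ : bochner_integrable P setT Z. Proof. by case: muE. Qed.

Let bX : bochner_integrable P setT (X : Omega -> E).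
Proof.
apply: (bochner_integrable_of_norm sepE); first exact: mX.
exact: norm_square_integrable_norm joint_gaussian_norm_square.
Qed.

(** Turns the Bochner-valued condition on Z into the scalar one that [regression_cf] takes as
    hypothesis. *)
Lemma cond_expectation_dual (x' : dual E) (B : set (borel F)) : measurable B ->
  \int[P]_(w in Y @^-1` B) x' (Z w) = \int[P]_(w in Y @^-1` B) x' (X w).
Proof.
move=> mB; have mC : measurable (Y @^-1` B).
  by rewrite -[X in measurable X]setTI; exact: mY.
rewrite -(bochner_integrableE sepE x' mC bZ) -(bochner_integrableE sepE x' mC bX).
have [_ _ h] := muE; rewrite (h (Y @^-1` B)) //.
by exists B => //; rewrite setTI.
Qed.

Let U w : E := (X w : E) - Z w.

Lemma residual_borel : borel_fun setT U.
Proof. by apply: (borel_funB sepE); [exact: mX|exact: bZ.1]. Qed.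

Lemma residual_cf (x' : dual E) : exists2 q : R, 0 <= q &
  forall (a : R) (y' : dual F) (c : R), \int[P]_w cos (a * x' (U w) + (y' (Y w) + c)) =
    expR (- (a ^+ 2 * q / 2)) * \int[P]_w cos (y' (Y w) + c).
Proof.
pose L : set (borel F -> R) := [set l | exists (y' : dual F) c, l = (fun y => y' y + c)].
have [x0 x00] := zeroE; have [y0 y00] := zeroF.
have mL l : L l -> measurable_fun setT l.
  by move=> [y' [c ->]]; apply: measurable_funD => //; exact: dual_borel.
have LD k l : L k -> L l -> L (k \+ l).
  move=> [y' [c ->]] [z' [e ->]]; have [u' u'E] := dual_lin y' z' 1 1.
  by exists u', (c + e); apply/funext => y /=; rewrite u'E; ring.
have LZ a l : L l -> L (a \*o l).
  move=> [y' [c ->]]; have [u' u'E] := dual_lin y' y' a 0.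
  by exists u', (a * c); apply/funext => y /=; rewrite u'E; ring.
have Lcst c : L (cst c) by exists y0, c; apply/funext => y; rewrite y00 add0r.
have Lgen (B : set (borel F)) : measurable B -> <<s [set [set y | l y < 0] | l in L] >> B.
  move: B; apply: (borel_ind sepF); first exact: smallest_sigma_algebra.
  move=> y' c; apply: sub_sigma_algebra; exists (fun y => y' y - c).
    by exists y', (- c).
  by apply/seteqP; split=> y /=; lra.
have sf : square_integrable P (fun w => x' (X w)).
  have [sh _] := joint_gaussian_cf x' y0 1 0.
  by move: sh; congr (square_integrable P _); apply/funext => w; rewrite mul1r y00 !addr0.
have sL l : L l -> square_integrable P (l \o Y).
  move=> [y' [c ->]]; have [sh _] := joint_gaussian_cf x' y' 0 c.
  by move: sh; congr (square_integrable P _); apply/funext => w; rewrite mul0r add0r.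
have gL a l : L l -> let h := fun w => a * x' (X w) + l (Y w) in
    gaussian_cf P h (\int[P]_w h w) (\int[P]_w (h w - \int[P]_w h w) ^+ 2).
  by move=> [y' [c ->]]; have [_] := joint_gaussian_cf x' y' a c.
have mk : measurable_fun setT (fun y : borel F => x' (mu y)).
  by exact: (measurableT_comp (dual_borel x') (@measurable_funPT _ _ _ _ mu)).
have ik : P.-integrable setT (EFin \o ((fun y : borel F => x' (mu y)) \o Y)).
  exact: (bochner_integrable_dual sepE x' bZ).
have [q q0 qE] := regression_cf mY mL LD LZ Lcst Lgen sf sL gL mk ik (@cond_expectation_dual x').
exists q => // a y' c.
have Ll : L (fun y => y' y + c) by exists y', c.
have h1 := qE a _ Ll; have h0 := qE 0 _ Ll.
transitivity (\int[P]_w cos (a * (x' (X w) - x' (mu (Y w))) + (y' (Y w) + c))).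
  by apply: eq_Rintegral => w _; rewrite /U dualB.
(* The case a = 0 of the formula identifies the factor that depends only on Y as the integral of the
   cosine of [y' (Y w) + c]. *)
rewrite h1; move: h0; rewrite expr0n/= mul0r add0r.
under [X in X = _ -> _]eq_Rintegral do rewrite mul0r add0r.
by move=> ->; rewrite [RHS]mulrCA -expRD; congr (_ * expR _); field.
Qed.

Let mU : @measurable_fun _ _ Omega (borel E) setT U. Proof. exact: residual_borel. Qed.

Let QY : probability (borel F) R := distribution P Y.

Let QU : probability (borel E) R :=
  distribution P (@mfun_Sub _ _ Omega (borel E) U (mem_set mU)).

Let imU A : measurable A -> QU A = P (U @^-1` A). Proof. by move=> _. Qed.

Let imY A : measurable A -> QY A = P (Y @^-1` A). Proof. by move=> _. Qed.

Lemma residual_gaussian_cf (x' : dual E) :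
  exists2 q : R, 0 <= q & gaussian_cf P (fun w => x' (U w)) 0 q.
Proof.
have [q q0 qE] := residual_cf x'; have [y0 y00] := zeroF.
exists q => // t c; transitivity (\int[P]_w cos (t * x' (U w) + (y0 (Y w) + c))).
  by apply: eq_Rintegral => w _; rewrite y00 add0r.
rewrite qE mulr0 add0r [RHS]mulrC; congr (_ * _).
transitivity (\int[P]_w cos c); last exact: Rintegral_cstP.
by apply: eq_Rintegral => w _; rewrite y00 add0r.
Qed.

Let V w : (borel F * borel E)%type := (Y w, U w : borel E).

Let mV : measurable_fun setT V.
Proof. by apply: measurable_fun_pair; [exact: mY|exact: mU]. Qed.

(** Integrating over U first, with y' y + c as phase, produces the factor exp (- q / 2), the same
    that [residual_cf] extracts from the joint law at a = 1. Y is the first component because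
    sections at fixed y are needed later. *)
Lemma residual_independent A : measurable A ->
  (QY \x QU)%E A = P (V @^-1` A).
Proof.
pose D := distribution P (mfun_Sub (mem_set mV)).
have imD B : measurable B -> D B = P (V @^-1` B) by move=> _.
move=> mA; transitivity (D A); last exact: imD.
have mcosR : measurable_fun setT (cos : R -> R).
  by apply: continuous_measurable_fun; exact: continuous_cos.
apply: (@borel_prod_law R F E sepF sepE (QY \x QU)%E D _ A mA) => y' x' c.
have my1 : measurable_fun setT (fun z : borel F * borel E => y' z.1).
  exact: (measurableT_comp (dual_borel y') measurable_fst).
have mx2 : measurable_fun setT (fun z : borel F * borel E => x' z.2).
  exact: (measurableT_comp (dual_borel x') measurable_snd).
have mcos : measurable_fun setT (fun z : borel F * borel E => cos (y' z.1 + x' z.2 + c)).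
  apply: (measurableT_comp mcosR).
  by apply: measurable_funD => //; exact: measurable_funD.
rewrite (Rintegral_image mV imD mcos); last first.
  by apply: (@integrable_of_bounded _ _ _ D _ 1) => // z; exact: cos_max.
have mcosx b : measurable_fun setT (fun u : borel E => cos (1 * x' u + b)).
  apply: (measurableT_comp mcosR); apply: measurable_funD => //.
  apply: measurable_funM => //; exact: dual_borel.
have icosx b : QU.-integrable setT (EFin \o (fun u : borel E => cos (1 * x' u + b))).
  by apply: (@integrable_of_bounded _ _ _ QU _ 1) => // z; exact: cos_max.
rewrite Rintegral_prod; last 2 first.
- by apply: (@integrable_of_bounded _ _ _ (QY \x QU)%E _ 1) => // z; exact: cos_max.
- move=> y; have := icosx (y' y + c); congr (QU.-integrable _ _).
  by apply/funext => u; congr (cos _)%:E; ring.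
have [q q0 qE] := residual_cf x'; have [y0 y00] := zeroF.
have cU b : \int[QU]_u cos (1 * x' u + b) = expR (- (1 ^+ 2 * q / 2)) * cos b.
  rewrite (Rintegral_image mU imU (mcosx b) (icosx b)).
  transitivity (\int[P]_w cos (1 * x' (U w) + (y0 (Y w) + b))).
    by apply: eq_Rintegral => w _; rewrite y00 add0r.
  rewrite qE; congr (_ * _); rewrite -[RHS](Rintegral_cstP P).
  by apply: eq_Rintegral => w _; rewrite y00 add0r.
have mcosy : measurable_fun setT (fun y : borel F => cos (y' y + c)).
  apply: (measurableT_comp mcosR); apply: measurable_funD => //; exact: dual_borel.
have icosy : QY.-integrable setT (EFin \o (fun y : borel F => cos (y' y + c))).
  by apply: (@integrable_of_bounded _ _ _ QY _ 1) => // z; exact: cos_max.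
transitivity (\int[QY]_y (expR (- (1 ^+ 2 * q / 2)) * cos (y' y + c))).
  apply: eq_Rintegral => y _; rewrite -cU.
  by apply: eq_Rintegral => u _; congr cos; rewrite /=; ring.
rewrite RintegralZl// (Rintegral_image mY imY mcosy icosy) -qE.
by apply: eq_Rintegral => w _; rewrite /V/=; congr cos; ring.
Qed.

Let sX : norm_square_integrable P (X : Omega -> E) := joint_gaussian_norm_square.

Lemma residual_gaussian (x' : dual E) :
  real_gaussian (pushforward P (fun w => x' (U w) : measurableTypeR R)).
Proof.
have [q q0 qE] := residual_gaussian_cf x'.
by apply: (gaussian_of_cf _ q0 qE); exact: (borel_fun_dual x' mU).
Qed.

Lemma residual_norm_square : norm_square_integrable P U.
Proof.
have gU : gaussian_measure QU by move=> x'; exact: residual_gaussian.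
split; first exact: mU.
apply: ((integrable_image mU imU (g := fun x : borel E => `|x : E| ^+ 2) _).1 (fernique sepE gU)).
by apply: measurable_funX; exact: norm_borel.
Qed.

(** A version of the conditional expectation is only assumed Bochner integrable; its second moment
    comes from those of X and U. *)
Lemma cond_expectation_norm_square : norm_square_integrable P Z.
Proof.
suff -> : Z = (fun w => (X w : E) - U w).
  exact: norm_square_integrableB sX residual_norm_square.
by apply/funext => w; rewrite /U opprB addrC subrK.
Qed.

Let sZ := cond_expectation_norm_square.

Lemma residual_mean (x' : dual E) : \int[P]_w x' (U w) = 0.
Proof.
transitivity (\int[P]_w x' (X w) - \int[P]_w x' (Z w)).
  rewrite -RintegralB//; last 2 first.
  - exact: bochner_integrable_dual bX.
  - exact: bochner_integrable_dual bZ.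
  by apply: eq_Rintegral => w _; rewrite dualB.
have := @cond_expectation_dual x' setT measurableT.
by rewrite preimage_setT => ->; rewrite subrr.
Qed.

(** By independence and Fubini, g y factors out of an inner integral that is the mean of x'U. *)
Lemma residual_orthogonal (g : borel F -> R) (x' : dual E) : measurable_fun setT g ->
  square_integrable P (g \o Y) -> \int[P]_w (g (Y w) * x' (U w)) = 0.
Proof.
move=> mg sg; have sU := norm_square_integrable_dual x' residual_norm_square.
have mh : measurable_fun setT (fun z : borel F * borel E => g z.1 * x' z.2).
  apply: measurable_funM; first exact: (measurableT_comp mg measurable_fst).
  exact: (measurableT_comp (dual_borel x') measurable_snd).
have imV A : measurable A -> (QY \x QU)%E A = P (V @^-1` A) := @residual_independent A.
have ih : P.-integrable setT (EFin \o (fun z => g z.1 * x' z.2) \o V).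
  exact: (square_integrableM sg sU).
have ih' := (integrable_image mV imV mh).2 ih.
transitivity (\int[(QY \x QU)%E]_z (g z.1 * x' z.2)).
  by rewrite (Rintegral_image mV imV mh ih').
have iU : P.-integrable setT (EFin \o (x' \o U)) := square_integrable_integrable sU.
have iQ := (integrable_image mU imU (dual_borel x')).2 iU.
rewrite Rintegral_prod//; last by move=> y; exact: (integrableZR (g y) iQ).
rewrite -[RHS](Rintegral_cstP QY); apply: eq_Rintegral => y _ /=.
rewrite RintegralZl// (Rintegral_image mU imU (dual_borel x') iQ).
by rewrite [X in _ * X]residual_mean mulr0.
Qed.

Lemma residual_covariance (x' z' : dual E) :
  z' (cov P (X : Omega -> E) x' - cov P Z x') = \int[P]_w (x' (U w) * z' (U w)).
Proof.
have mXZ : mean P (X : Omega -> E) = mean P Z.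
  apply: dual_separates => y'; rewrite (mean_dual sepE y' bX) (mean_dual sepE y' bZ).
  by have := @cond_expectation_dual y' setT measurableT; rewrite preimage_setT => ->.
pose m := mean P Z.
rewrite dualB /cov mXZ -/m (bochner_covE sepE m x' z' sX) (bochner_covE sepE m x' z' sZ).
have sUx := norm_square_integrable_dual x' residual_norm_square.
have sUz := norm_square_integrable_dual z' residual_norm_square.
have sZm y' := norm_square_integrable_dual y'
  (norm_square_integrableB sepE sZ (norm_square_integrable_cst P m)).
have sXm y' := norm_square_integrable_dual y'
  (norm_square_integrableB sepE sX (norm_square_integrable_cst P m)).
have orth (y' u' : dual E) : \int[P]_w (y' (Z w - m) * u' (U w)) = 0.
  apply: (@residual_orthogonal (fun y => y' ((mu y : E) - m)) u'); last exact: sZm.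
  apply: (borel_fun_dual y'); apply: (borel_funB sepE) (@measurable_cst _ _ _ _ _ (m : borel E)).
  exact: (@measurable_funPT _ _ _ _ mu).
apply/eqP; rewrite subr_eq; apply/eqP.
(* X and Z share the mean m, so X - m = U + (Z - m); the two cross terms, put last, vanish by
   [orth]. *)
transitivity (\int[P]_w (x' (U w) * z' (U w) + (x' (Z w - m) * z' (Z w - m) +
    (x' (Z w - m) * z' (U w) + z' (Z w - m) * x' (U w))))).
  apply: eq_Rintegral => w _.
  have e (y' : dual E) : y' (X w - m : E) = y' (U w) + y' (Z w - m).
    have -> : (X w : E) - m = U w + (Z w - m) by rewrite /U addrA subrK.
    exact: dualD.
  by rewrite !e; ring.
have i1 := square_integrableM sUx sUz.
have i2 := square_integrableM (sZm x') (sZm z').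
have i3 := square_integrableM (sZm x') sUz.
have i4 := square_integrableM (sZm z') sUx.
have i34 := integrableDR i3 i4.
rewrite (RintegralD measurableT i1 (integrableDR i2 i34)).
rewrite (RintegralD measurableT i2 i34) (RintegralD measurableT i3 i4).
by rewrite !orth !addr0.
Qed.

Let K : dual E -> E := cov P (X : Omega -> E) \- cov P Z.

Let W (y : borel F) (w : Omega) : E := (mu y : E) + U w.

Let mW y : @measurable_fun _ _ Omega (borel E) setT (W y).
Proof.
apply: (borel_funD sepE) mU; exact: (@measurable_cst _ _ _ _ _ (mu y : borel E)).
Qed.

Let kappa (y : borel F) : probability (borel E) R :=
  distribution P (@mfun_Sub _ _ Omega (borel E) (W y) (mem_set (mW y))).

(** The witness that gives [normal] its meaning at every y. It also shows that K, a difference of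
    covariances, is itself a covariance, that of U. *)
Lemma conditional_normal y : is_normal (mu y : E) K (kappa y).
Proof.
apply: (is_normal_law sepE).
- move=> x'; have [q q0 qE] := residual_gaussian_cf x'.
  apply: (@gaussian_of_cf _ _ _ P (fun w => x' (W y w)) (x' (mu y : E)) q _ q0).
    exact: (borel_fun_dual x' (mW y)).
  move=> t c; transitivity (\int[P]_w cos (t * x' (U w) + (t * x' (mu y : E) + c))).
    by apply: eq_Rintegral => w _; rewrite dualD; congr cos; ring.
  by rewrite qE mulr0 add0r.
- move=> x'; have sU := norm_square_integrable_dual x' residual_norm_square.
  transitivity (\int[P]_w (x' (mu y : E) + x' (U w))).
    by apply: eq_Rintegral => w _; exact: dualD.
  rewrite RintegralD//; last 2 first.
  - exact: integrable_cstP.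
  - exact: square_integrable_integrable sU.
  by rewrite Rintegral_cstP residual_mean addr0.
- move=> x' z'; have -> := residual_covariance x' z'.
  have e w : (W y w : E) - (mu y : E) = U w by rewrite /W addrC addKr.
  by apply: eq_Rintegral => w _; rewrite -[in RHS]e.
Qed.

(** Presents [kappa y B] as the measure of a section of one measurable set of pairs, which reduces
    measurability in y to that of sections. *)
Let S (B : set (borel E)) : set (borel F * borel E) :=
  [set z | B ((mu z.1 : E) + (z.2 : E) : borel E)].

Let mS B : measurable B -> measurable (S B).
Proof.
move=> mB; have mh : @measurable_fun _ _ (borel F * borel E)%type (borel E) setT
    (fun z => (mu z.1 : E) + (z.2 : E)).
  apply: (borel_funD sepE).
    exact: (measurableT_comp (@measurable_funPT _ _ _ _ mu) measurable_fst).
  exact: measurable_snd.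
by rewrite -[X in measurable X]setTI; exact: mh.
Qed.

Let kappaE B y : measurable B -> kappa y B = QU (xsection (S B) y).
Proof.
move=> mB; rewrite imU; last exact: measurable_xsection (mS mB).
congr (P _); apply/seteqP; split=> w; rewrite /xsection/= inE //.
Qed.

Lemma conditional_measurable B : measurable B ->
  measurable_fun setT (fun y : borel F => kappa y B).
Proof.
move=> mB; have := @measurable_fun_xsection _ _ _ _ R QU (S B) (mS mB).
by congr (measurable_fun _ _); apply/funext => y; rewrite kappaE.
Qed.

(** The event says that (Y, U) lies in [S B] with first component in A. By independence its
    probability is a product measure, which is by definition an integral of measures of sections. *)
Lemma conditional_disintegration B A : measurable B -> measurable A ->
  P (X @^-1` B `&` Y @^-1` A) = (\int[QY]_(y in A) kappa y B)%E.
Proof.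
move=> mB mA.
have mSA : measurable (S B `&` (A `*` setT)).
  by apply: measurableI; [exact: mS|exact: measurableX].
transitivity (P (V @^-1` (S B `&` (A `*` setT)))).
  congr (P _); apply/seteqP; split=> w /=; rewrite /S/= /U (addrC (mu _ : E)) subrK.
    by move=> [].
  by move=> [? []].
rewrite -(residual_independent mSA) /product_measure1 [RHS]integral_mkcond.
apply: eq_integral => y _; rewrite /patch /=.
case: ifPn => yA.
  rewrite kappaE//; congr (QU _); apply/seteqP; split=> u; rewrite /xsection/= !inE/=.
    by move=> [].
  by move=> h; split=> //; split=> //; exact: set_mem.
(* For y outside A the section is empty. *)
rewrite -[RHS](measure0 QU); congr (QU _); apply/seteqP; split=> u //=.
by rewrite /xsection/= inE/= => -[_ [/mem_set]]; rewrite (negbTE yA).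
Qed.

End joint_gaussian.

Theorem theorem3p4 (R : realType) (d : measure_display) (Omega : measurableType d)
    (P : probability Omega R) (E F : completeNormedModType R)
    (sepE : separable E) (sepF : separable F)
    (X : {RV P >-> borel E}) (Y : {RV P >-> borel F})
    (XY : jointly_gaussian P (X : Omega -> E) (Y : Omega -> F))
    (mu : {mfun borel F >-> borel E})
    (muE : is_cond_expectation P (X : Omega -> E) Y (mu \o Y : Omega -> E)) :
  let K : dual E -> E :=
    cov P (X : Omega -> E) \- cov P (mu \o Y : Omega -> E) in
  (forall y : F, is_normal (mu y) K (normal (mu y) K)) /\
  is_regular_cond_prob X Y (fun y : F => normal (mu y) K).
Proof.
move=> K; have cn := @conditional_normal R d Omega P E F sepE sepF X Y XY mu muE.
have nK (y : F) : is_normal (mu y) K (normal (mu y) K).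
  (* A witness exists at every y, so the choice never falls back on its default. *)
  rewrite /normal; apply: getPex; eexists; exact: cn.
(* The chosen law and the explicit one agree on measurable sets, which is all that the kernel
   properties involve. *)
split=> //; have eK (B : set (borel E)) (mB : measurable B) (y : F) :=
  is_normal_unique sepE (nK y) (cn y) mB.
split=> [B mB|B A mB mA].
  have := @conditional_measurable R d Omega P E F sepE X Y mu muE B mB.
  by congr (measurable_fun _ _); apply/funext => y; rewrite eK.
rewrite (@conditional_disintegration R d Omega P E F sepE sepF X Y XY mu muE B A mB mA).
by apply: eq_integral => y _; rewrite eK.
Qed.
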